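(* Let $0\le b<1$ and $(X,Y)\in\mathbb{C}^2$. The Kobayashi pseudometric of $D_{1,1}$ for $((0,b),(X,Y))$ can be expressed as follows. (i) When $b=0$, then, for $Y\neq 0$, we have $\mathcal{K}_{D_{1,1}}((0,0),(X,Y))=\mu(X,Y)$, where $\mu=\mu(X,Y)$ is the Minkowski functional of $D_{1,1}$, which is uniquely determined by $$\frac{|X|^2}{\mu^2}+\ln|Y|^2-2\ln\mu=0.$$ Additionally, $\mathcal{K}_{D_{1,1}}((0,0),(X,0))=0$. (ii) When $0<b<1$ and $X=0$, we have $$\mathcal{K}_{D_{1,1}}^2((0,b),(0,Y))=\frac{|Y|^2}{1-b^2}+\frac{|bY|^2}{(1-b^2)^2}.$$ (iii) When $0<b<1$ and $X\neq 0$, put $v=\frac{|Y|^2}{|X|^2}$. Then $$\mathcal{K}_{D_{1,1}}^2((0,b),(X,Y))=\begin{cases}-\dfrac{1}{2\ln b}\left(|X|^2-\dfrac{|Y|^2}{2b^2\ln b}\right) & \text{for } v<4b^2,\\[2mm] \dfrac{|X|^2}{\alpha(1-b^2e^\alpha)} & \text{for } 0<\alpha\leq\beta,\ v\geq 4b^2,\\[2mm] -\dfrac{1}{2\ln b}\left(|X|^2-\dfrac{|Y|^2}{2b^2\ln b}\right) & \text{for } \beta<\alpha<-2\ln b,\ v\geq 4b^2,\end{cases}$$ where $\alpha$, $v$ satisfy $$\frac{b^4\alpha^2e^\alpha+(1-b^2e^\alpha)^2e^{-\alpha}}{\alpha(1-b^2e^\alpha)}=v-2b^2,$$ and $\beta$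 is the only solution in the interval $(0,-2\ln b)$ of the equation $$-\frac{1}{2\ln b}\beta(1-b^2e^\beta)e^\beta+\frac{1}{4b^2\ln^2 b}\big(b^2\beta e^\beta+(1-b^2e^\beta)\big)^2-e^\beta=0.$$
   Context: $E$ is the open unit disk in $\mathbb{C}$, and $D_{1,1}=\{(z,w)\in\mathbb{C}^2:\ |w|^2<e^{-|z|^2}\}$. For a domain $D\subset\mathbb{C}^N$ the Kobayashi pseudometric is, for $(z,\zeta)\in D\times\mathbb{C}^N$, $$\mathcal{K}_D(z,\zeta)=\inf_f\{|\alpha|:\ \exists f:E\to D \text{ holomorphic},\ f(0)=z,\ f'(0)\alpha=\zeta\}$$ (the $\alpha$ in this definition is unrelated to the $\alpha$ in the claim). $\mathcal{K}_D^2$ denotes its square. The Minkowski functional of $D_{1,1}$ is $\mu(X,Y)=\inf\{t>0:\ (X/t,Y/t)\in D_{1,1}\}$. $\ln^2 b$ means $(\ln b)^2$.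
   Formalization: For v>4b² the equation for α has two roots in (0,−2 ln b); for large v one is ≤β and the other >β, where the two formulas conflict. Here α is taken as the smaller root: the second case applies if some root is ≤β, the third if all roots exceed β. *)

(* Defs.v *)
From Stdlib Require Import Reals.
From Coquelicot Require Import Coquelicot.

Open Scope R_scope.

(* [C_NormedModule] carries the complex scalar action, so that differentiability
   of maps from [C] into [C2] is complex differentiability. *)
Definition C2 : NormedModule C_AbsRing :=
  prod_NormedModule C_AbsRing C_NormedModule C_NormedModule.

Definition unit_disk (z : C) : Prop := Cmod z < 1.

Definition D11 (p : C2) : Prop :=
  Cmod (snd p) ^ 2 < exp (- Cmod (fst p) ^ 2).

(* Maps are total in Rocq: only the values on the (open) set [U] matter. *)
Definition holomorphic_on {V : NormedModule C_AbsRing}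
    (U : C -> Prop) (f : C -> V) : Prop :=
  forall z : C, U z -> ex_derive (K := C_AbsRing) f z.

Definition kobayashi_competitor {V : NormedModule C_AbsRing}
    (D : V -> Prop) (z zeta : V) (r : R) : Prop :=
  exists (f : C -> V) (l : V) (a : C),
    holomorphic_on unit_disk f /\
    (forall t : C, unit_disk t -> D (f t)) /\
    f (RtoC 0) = z /\
    is_derive (K := C_AbsRing) f (RtoC 0) l /\
    scal a l = zeta /\
    r = Cmod a.

(* The infimum is taken in [Rbar], with value [p_infty] on the empty set, so that
   an identity with a [Finite] value also says that competitors exist. *)
Definition kobayashi {V : NormedModule C_AbsRing}
    (D : V -> Prop) (z zeta : V) : Rbar :=
  Glb_Rbar (kobayashi_competitor D z zeta).

Definition kobayashi_sqr {V : NormedModule C_AbsRing}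
    (D : V -> Prop) (z zeta : V) : Rbar :=
  Rbar_mult (kobayashi D z zeta) (kobayashi D z zeta).

Definition minkowski {V : NormedModule C_AbsRing} (D : V -> Prop) (p : V) : Rbar :=
  Glb_Rbar (fun t : R => 0 < t /\ D (scal (RtoC (/ t)) p)).

Definition minkowski_equation (X Y : C) (mu : R) : Prop :=
  Cmod X ^ 2 / mu ^ 2 + ln (Cmod Y ^ 2) - 2 * ln mu = 0.

Definition alpha_solution (b v alpha : R) : Prop :=
  0 < alpha < - 2 * ln b /\
  (b ^ 4 * alpha ^ 2 * exp alpha + (1 - b ^ 2 * exp alpha) ^ 2 * exp (- alpha))
    / (alpha * (1 - b ^ 2 * exp alpha))
  = v - 2 * b ^ 2.

Definition beta_solution (b beta : R) : Prop :=
  0 < beta < - 2 * ln b /\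
  - (1 / (2 * ln b)) * beta * (1 - b ^ 2 * exp beta) * exp beta
    + 1 / (4 * b ^ 2 * ln b ^ 2)
      * (b ^ 2 * beta * exp beta + (1 - b ^ 2 * exp beta)) ^ 2
    - exp beta = 0.

(* The square of the metric when the extremal disks have a zero-free second
   component; it is the value in two of the three cases. *)
Definition zero_free_value (b : R) (X Y : C) : R :=
  - (1 / (2 * ln b)) * (Cmod X ^ 2 - Cmod Y ^ 2 / (2 * b ^ 2 * ln b)).

(* Main.v *)
Require Import Defs.
From Stdlib Require Import Reals Lra Lia Psatz ClassicalEpsilon.
From Coquelicot Require Import Coquelicot.

Open Scope R_scope.

(** The domain is [|z|^2 + 2 ln |w| < 0]. Over the part [w <> 0] it is covered by the Siegel
    half-space [|z|^2 < Re F], with [w = exp (- F / 2)], which is a ball; discs with zero-free second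
    component are therefore governed by the ball, and their optimal value at [(0, b)] is
    [zero_free_value]. A general disc [(g, h)] is reduced to this situation by dividing [h] by a
    function [B] bounded by 1 that carries its zeros. If [exp (- A / 2) = b / |B(0)|], then the ball
    constrains [g'(0)] and the logarithmic derivative of [h / B], and the Schwarz-Pick lemma
    constrains [B'(0)]. Together they say that the derivative [(x, y)] of a disc, after a dilation by
    any [rho < 1], satisfies, for some [A] between [|x|^2] and [L = - 2 ln b],
      [|y| <= exp (- A / 2) - b^2 exp (A / 2) + b sqrt (A^2 - A |x|^2) = Phi b A |x|^2].
    This is [competitor_bound]. In place of a Blaschke factorization, its proof uses the quotient
    [h exp (F / 2)], where [F] is the holomorphic function whose real part is [|g|^2] on a circle;
    [g] is replaced by a Taylor polynomial, for which [F] is a polynomial ([Re_completion]). What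
    this takes from complex analysis (Cauchy's formula, the maximum principle, Taylor approximation,
    Schwarz-Pick) is derived from Goursat's theorem.

    Conversely every such vector is the derivative of an explicit disc, with one Moebius factor
    ([disc_competitor]). So the metric is determined by the maximum of [Phi] over [A]. By the sign of
    its derivative ([Phi_derive]), the maximum is attained either at [A = L], which gives the zero-free
    discs, or at the critical point [A < am] with [psi A = |x|^2], where [psi A = A (1 - b^2 exp A)]
    and [am] is its maximum point ([Phi_max]). For the critical value [phi A] the ratio
    [|y|^2 / |x|^2] is [phi A ^ 2 / psi A]; that it equals [v] is the equation for [alpha]. The
    difference of the two candidate values decreases along the curve of critical points
    ([gap_decreasing]), is positive near 0 and negative from [am] on; its only zero is [beta]. Hence
    discs with a zero are optimal exactly for [alpha <= beta].

    When [X = 0] the maximum is at [A = 0]; when [b = 0] only the term [exp (- A / 2)] is left, and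
    the bound says that the vector lies in the closure of the domain. *)

(** * Derivatives of complex-valued functions *)

(** [inc] embeds the parameter space into the plane, so that one calculus serves both complex
    derivatives ([T = C]) and derivatives of plane curves ([T = R], [inc = RtoC]). *)
Definition deriv_along {T : Type} (inc : T -> C) (f : T -> C) (z : T) (l : C) : Prop :=
  forall eps : R, 0 < eps -> exists delta : R, 0 < delta /\
    forall w : T, Cmod (inc w - inc z)%C < delta ->
      Cmod (f w - f z - l * (inc w - inc z))%C <= eps * Cmod (inc w - inc z)%C.

Notation cderiv := (deriv_along (fun z : C => z)).
Notation pderiv := (deriv_along RtoC).

Lemma Cmod_sub_triangle (x y : C) : Cmod (x - y)%C <= Cmod x + Cmod y.
Proof. unfold Cminus. rewrite <- (Cmod_opp y). apply Cmod_triangle. Qed.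

Lemma Cmod_sub_rev (x y : C) : Cmod x - Cmod y <= Cmod (x - y)%C.
Proof.
  assert (H := Cmod_triangle (x - y)%C y).
  replace (x - y + y)%C with x in H by ring. lra.
Qed.

Section Rules.
Context {T : Type} (inc : T -> C).

Lemma deriv_along_lipschitz f z l :
  deriv_along inc f z l -> exists delta, 0 < delta /\
    forall w, Cmod (inc w - inc z)%C < delta ->
      Cmod (f w - f z)%C <= (Cmod l + 1) * Cmod (inc w - inc z)%C.
Proof.
  intros H. destruct (H 1 Rlt_0_1) as [d [Hd H1]]. exists d; split; auto.
  intros w Hw. specialize (H1 w Hw).
  replace (f w - f z)%C with ((f w - f z - l * (inc w - inc z)) + l * (inc w - inc z))%C by ring.
  eapply Rle_trans; [apply Cmod_triangle|]. rewrite Cmod_mult. lra.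
Qed.

Lemma deriv_along_ext f g z l :
  (forall w, f w = g w) -> deriv_along inc f z l -> deriv_along inc g z l.
Proof.
  intros E H eps He. destruct (H eps He) as [d [Hd H1]]. exists d; split; auto.
  intros w Hw. rewrite <- !E. auto.
Qed.

Lemma deriv_along_const c z : deriv_along inc (fun _ => c) z (RtoC 0).
Proof.
  intros eps He. exists 1; split; [lra|]. intros w _.
  replace (c - c - 0 * (inc w - inc z))%C with (RtoC 0) by ring.
  rewrite Cmod_0. apply Rmult_le_pos; [lra|apply Cmod_ge_0].
Qed.

Lemma deriv_along_inc z : deriv_along inc inc z (RtoC 1).
Proof.
  intros eps He. exists 1; split; [lra|]. intros w _.
  replace (inc w - inc z - 1 * (inc w - inc z))%C with (RtoC 0) by ring.
  rewrite Cmod_0. apply Rmult_le_pos; [lra|apply Cmod_ge_0].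
Qed.

Lemma deriv_along_plus f g z l m :
  deriv_along inc f z l -> deriv_along inc g z m ->
  deriv_along inc (fun w => f w + g w)%C z (l + m)%C.
Proof.
  intros Hf Hg eps He.
  destruct (Hf (eps/2)) as [d1 [Hd1 H1]]; [lra|].
  destruct (Hg (eps/2)) as [d2 [Hd2 H2]]; [lra|].
  exists (Rmin d1 d2); split; [apply Rmin_glb_lt; auto|].
  intros w Hw. specialize (H1 w (Rlt_le_trans _ _ _ Hw (Rmin_l _ _))).
  specialize (H2 w (Rlt_le_trans _ _ _ Hw (Rmin_r _ _))).
  replace (f w + g w - (f z + g z) - (l + m) * (inc w - inc z))%C with
   ((f w - f z - l * (inc w - inc z)) + (g w - g z - m * (inc w - inc z)))%C by ring.
  eapply Rle_trans; [apply Cmod_triangle|]. lra.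
Qed.

Lemma deriv_along_mult f g z l m :
  deriv_along inc f z l -> deriv_along inc g z m ->
  deriv_along inc (fun w => f w * g w)%C z (l * g z + f z * m)%C.
Proof.
  intros Hf Hg eps He.
  destruct (deriv_along_lipschitz f z l Hf) as [d0 [Hd0 H0]].
  assert (A : 0 <= Cmod (f z)) by apply Cmod_ge_0.
  assert (B : 0 <= Cmod (g z)) by apply Cmod_ge_0.
  assert (L : 0 <= Cmod l) by apply Cmod_ge_0.
  assert (M : 0 <= Cmod m) by apply Cmod_ge_0.
  set (k := 3 * (Cmod (f z) + Cmod (g z) + Cmod l + Cmod m + 1)).
  assert (Hk : 0 < k) by (unfold k; lra).
  assert (Hek : 0 < eps / k) by (apply Rdiv_lt_0_compat; lra).
  assert (Hkk : eps / k * k = eps) by (field; lra).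
  destruct (deriv_along_lipschitz g z m Hg) as [d3 [Hd3 H3]].
  destruct (Hf (eps/k) Hek) as [d1 [Hd1 H1]].
  destruct (Hg (eps/k) Hek) as [d2 [Hd2 H2]].
  set (d4 := eps / (3 * (Cmod l + 1) * (Cmod m + 1))).
  assert (Hd4 : 0 < d4).
  { apply Rdiv_lt_0_compat; [lra|]. apply Rmult_lt_0_compat; lra. }
  exists (Rmin (Rmin d0 d1) (Rmin (Rmin d2 d3) d4)); split.
  { repeat apply Rmin_glb_lt; auto. }
  intros w Hw.
  assert (W0 : Cmod (inc w - inc z)%C < d0 /\ Cmod (inc w - inc z)%C < d1 /\ Cmod (inc w - inc z)%C < d2
    /\ Cmod (inc w - inc z)%C < d3 /\ Cmod (inc w - inc z)%C < d4).
  { repeat split; (eapply Rlt_le_trans; [exact Hw|]).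
    - eapply Rle_trans; [apply Rmin_l|apply Rmin_l].
    - eapply Rle_trans; [apply Rmin_l|apply Rmin_r].
    - eapply Rle_trans; [apply Rmin_r|]. eapply Rle_trans; [apply Rmin_l|apply Rmin_l].
    - eapply Rle_trans; [apply Rmin_r|]. eapply Rle_trans; [apply Rmin_l|apply Rmin_r].
    - eapply Rle_trans; [apply Rmin_r|apply Rmin_r]. }
  destruct W0 as [W0 [W1 [W2 [W3 W4]]]].
  specialize (H0 w W0). specialize (H1 w W1). specialize (H2 w W2). specialize (H3 w W3).
  set (t := Cmod (inc w - inc z)%C) in *.
  assert (Ht : 0 <= t) by apply Cmod_ge_0.
  replace (f w * g w - f z * g z - (l * g z + f z * m) * (inc w - inc z))%C with
    ((f w - f z - l * (inc w - inc z)) * g z + f z * (g w - g z - m * (inc w - inc z))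
     + (f w - f z) * (g w - g z))%C by ring.
  eapply Rle_trans; [apply Cmod_triangle|].
  eapply Rle_trans; [apply Rplus_le_compat_r, Cmod_triangle|].
  rewrite !Cmod_mult.
  assert (E1 : Cmod (f w - f z - l * (inc w - inc z)) * Cmod (g z) <= eps / 3 * t).
  { apply Rle_trans with (eps / k * t * (k / 3)).
    - apply Rmult_le_compat; auto using Cmod_ge_0. unfold k; lra.
    - right. field. lra. }
  assert (E2 : Cmod (f z) * Cmod (g w - g z - m * (inc w - inc z)) <= eps / 3 * t).
  { apply Rle_trans with ((k / 3) * (eps / k * t)).
    - apply Rmult_le_compat; auto using Cmod_ge_0. unfold k; lra.
    - right. field. lra. }
  assert (E3 : Cmod (f w - f z) * Cmod (g w - g z) <= eps / 3 * t).
  { apply Rle_trans with (((Cmod l + 1) * t) * ((Cmod m + 1) * d4)).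
    - apply Rmult_le_compat; auto using Cmod_ge_0.
      eapply Rle_trans; [exact H3|]. apply Rmult_le_compat_l; lra.
    - right. unfold d4. field. split; lra. }
  lra.
Qed.

Lemma deriv_along_scal c f z l :
  deriv_along inc f z l -> deriv_along inc (fun w => c * f w)%C z (c * l)%C.
Proof.
  intros H. replace (c * l)%C with (0 * f z + c * l)%C by ring.
  apply (deriv_along_mult (fun _ => c)); auto. apply deriv_along_const.
Qed.

Lemma deriv_along_minus f g z l m :
  deriv_along inc f z l -> deriv_along inc g z m ->
  deriv_along inc (fun w => f w - g w)%C z (l - m)%C.
Proof.
  intros Hf Hg.
  replace (l - m)%C with (l + (- (1)) * m)%C by ring.
  apply deriv_along_ext with (fun w => f w + (- (1)) * g w)%C; [intros; ring|].
  apply deriv_along_plus; auto. apply deriv_along_scal; auto.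
Qed.

(** The outer derivative is complex, the inner one arbitrary: this covers both the composition of
    holomorphic maps and the restriction of a holomorphic map to a curve. *)
Lemma deriv_along_comp g f z l m :
  cderiv g (f z) m -> deriv_along inc f z l ->
  deriv_along inc (fun w => g (f w)) z (m * l)%C.
Proof.
  intros Hg Hf eps He.
  assert (L : 0 <= Cmod l) by apply Cmod_ge_0.
  assert (M : 0 <= Cmod m) by apply Cmod_ge_0.
  destruct (deriv_along_lipschitz f z l Hf) as [d0 [Hd0 H0]].
  destruct (Hg (eps / (2 * (Cmod l + 1)))) as [d1 [Hd1 H1]].
  { apply Rdiv_lt_0_compat; lra. }
  destruct (Hf (eps / (2 * (Cmod m + 1)))) as [d2 [Hd2 H2]].
  { apply Rdiv_lt_0_compat; lra. }
  exists (Rmin d0 (Rmin d2 (d1 / (Cmod l + 1)))); split.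
  { repeat apply Rmin_glb_lt; auto. apply Rdiv_lt_0_compat; lra. }
  intros w Hw.
  assert (W0 : Cmod (inc w - inc z)%C < d0) by (eapply Rlt_le_trans; [exact Hw|apply Rmin_l]).
  assert (W2 : Cmod (inc w - inc z)%C < d2).
  { eapply Rlt_le_trans; [exact Hw|]. eapply Rle_trans; [apply Rmin_r|apply Rmin_l]. }
  assert (W1 : Cmod (inc w - inc z)%C < d1 / (Cmod l + 1)).
  { eapply Rlt_le_trans; [exact Hw|]. eapply Rle_trans; [apply Rmin_r|apply Rmin_r]. }
  specialize (H0 w W0). specialize (H2 w W2).
  set (t := Cmod (inc w - inc z)%C) in *.
  assert (Ht : 0 <= t) by apply Cmod_ge_0.
  assert (D : Cmod (f w - f z) < d1).
  { eapply Rle_lt_trans; [exact H0|].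
    apply Rlt_le_trans with ((Cmod l + 1) * (d1 / (Cmod l + 1))).
    - apply Rmult_lt_compat_l; lra.
    - right; field; lra. }
  specialize (H1 (f w) D). simpl in H1.
  replace (g (f w) - g (f z) - m * l * (inc w - inc z))%C with
    ((g (f w) - g (f z) - m * (f w - f z)) + m * (f w - f z - l * (inc w - inc z)))%C by ring.
  eapply Rle_trans; [apply Cmod_triangle|]. rewrite Cmod_mult.
  assert (E1 : Cmod (g (f w) - g (f z) - m * (f w - f z)) <= eps / 2 * t).
  { eapply Rle_trans; [exact H1|].
    apply Rle_trans with (eps / (2 * (Cmod l + 1)) * ((Cmod l + 1) * t)).
    - apply Rmult_le_compat_l; auto. apply Rlt_le, Rdiv_lt_0_compat; lra.
    - right; field; lra. }
  assert (E2 : Cmod m * Cmod (f w - f z - l * (inc w - inc z)) <= eps / 2 * t).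
  { apply Rle_trans with ((Cmod m + 1) * (eps / (2 * (Cmod m + 1)) * t)).
    - apply Rmult_le_compat; auto using Cmod_ge_0. lra.
    - right; field; lra. }
  lra.
Qed.

Lemma Cinv_cderiv z : z <> RtoC 0 -> cderiv Cinv z (- / (z * z))%C.
Proof.
  intros Hz eps He.
  assert (P : 0 < Cmod z) by (apply Cmod_gt_0; auto).
  exists (Rmin (Cmod z / 2) (eps * (Cmod z ^ 3) / 2)); split.
  { apply Rmin_glb_lt; [lra|]. assert (0 < Cmod z ^ 3) by (apply pow_lt; auto). nra. }
  intros w Hw.
  assert (W1 := Rlt_le_trans _ _ _ Hw (Rmin_l _ _)).
  assert (W2 := Rlt_le_trans _ _ _ Hw (Rmin_r _ _)).
  assert (Pw : Cmod z / 2 < Cmod w).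
  { assert (H := Cmod_sub_rev z w). replace (z - w)%C with (- (w - z))%C in H by ring.
    rewrite Cmod_opp in H. lra. }
  assert (Hw0 : w <> RtoC 0) by (apply Cmod_gt_0; lra).
  replace (/ w - / z - - / (z * z) * (w - z))%C with ((w - z) * ((w - z) * / (z * z * w)))%C
    by (field; auto).
  rewrite Cmod_mult, (Rmult_comm eps). apply Rmult_le_compat_l; [apply Cmod_ge_0|].
  rewrite Cmod_mult, Cmod_inv, !Cmod_mult.
  2:{ intros E. apply (f_equal Cmod) in E. rewrite !Cmod_mult, Cmod_0 in E.
      assert (0 < Cmod z * Cmod z * Cmod w) by (repeat apply Rmult_lt_0_compat; lra). lra. }
  assert (Q : 0 < Cmod z * Cmod z * Cmod w) by (repeat apply Rmult_lt_0_compat; lra).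
  apply Rmult_le_reg_r with (Cmod z * Cmod z * Cmod w); auto.
  rewrite Rmult_assoc, Rinv_l, Rmult_1_r by lra.
  eapply Rle_trans; [apply Rlt_le, W2|].
  replace (eps * Cmod z ^ 3 / 2) with (eps * (Cmod z * Cmod z * (Cmod z / 2))) by field.
  apply Rmult_le_compat_l; [lra|]. apply Rmult_le_compat_l; [nra|lra].
Qed.

Lemma deriv_along_inv f z l : f z <> RtoC 0 ->
  deriv_along inc f z l -> deriv_along inc (fun w => / f w)%C z (- / (f z * f z) * l)%C.
Proof. intros H0 H. apply (deriv_along_comp Cinv); auto. apply Cinv_cderiv; auto. Qed.

Lemma deriv_along_div f g z l m : g z <> RtoC 0 ->
  deriv_along inc f z l -> deriv_along inc g z m ->
  deriv_along inc (fun w => f w / g w)%C z ((l * g z - f z * m) / (g z * g z))%C.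
Proof.
  intros H0 Hf Hg. unfold Cdiv at 1.
  replace ((l * g z - f z * m) / (g z * g z))%C
    with (l * / g z + f z * (- / (g z * g z) * m))%C by (field; auto).
  apply deriv_along_mult; auto. apply deriv_along_inv; auto.
Qed.

Lemma deriv_along_pow f z l n :
  deriv_along inc f z l ->
  exists m, deriv_along inc (fun w => f w ^ n)%C z m.
Proof.
  intros H. induction n as [|n [m IH]].
  - exists (RtoC 0). apply (deriv_along_const (RtoC 1)).
  - exists (l * f z ^ n + f z * m)%C. exact (deriv_along_mult f _ z l m H IH).
Qed.

End Rules.

Lemma is_derive_C_iff {V : NormedModule C_AbsRing} (f : C -> V) (z : C) (l : V) :
  is_derive (K := C_AbsRing) f z l <->
  forall eps, 0 < eps -> exists delta, 0 < delta /\ forall w : C, Cmod (w - z)%C < delta ->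
    norm (minus (minus (f w) (f z)) (scal (w - z)%C l)) <= eps * Cmod (w - z)%C.
Proof.
  split.
  - intros [_ H] eps He.
    destruct (H z (fun P HP => HP) (mkposreal eps He)) as [[d Hd] H1].
    exists d; split; auto.
  - intros H. split; [apply is_linear_scal_l|].
    intros x Hx.
    assert (E : z = x).
    { apply (is_filter_lim_locally_unique (K := C_AbsRing) (V := AbsRing_NormedModule C_AbsRing)).
      exact Hx. }
    subst x. intros eps. destruct (H eps (cond_pos eps)) as [d [Hd H1]].
    exists (mkposreal d Hd). exact H1.
Qed.

Lemma pderiv_is_derive (f : R -> C) (t : R) (l : C) :
  pderiv f t l -> is_derive (K := R_AbsRing) (V := C_R_NormedModule) f t l.
Proof.
  intros H. split; [apply is_linear_scal_l|].
  intros x Hx.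
  assert (Ex : t = x).
  { apply (is_filter_lim_locally_unique (K := R_AbsRing) (V := R_NormedModule)). exact Hx. }
  subst x. intros eps. destruct (H eps (cond_pos eps)) as [d [Hd H1]].
  exists (mkposreal d Hd). simpl. intros w Hw.
  assert (E : Cmod (RtoC w - RtoC t)%C = Rabs (w - t)).
  { rewrite <- RtoC_minus. apply Cmod_R. }
  assert (Hw' : Cmod (w - t)%C < d) by (rewrite E; exact Hw).
  specialize (H1 w Hw'). rewrite E in H1.
  rewrite <- Cmod_norm. 
  eapply Rle_trans; [right; apply f_equal|exact H1].
  destruct l as [l1 l2], (f w) as [a1 a2], (f t) as [b1 b2].
  apply injective_projections; simpl; unfold minus, plus, opp, scal; simpl;
  unfold mult; simpl; ring.
Qed.

Lemma pderiv_continuous (f : R -> C) (t : R) (l : C) :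
  pderiv f t l -> continuous (U := C_R_NormedModule) f t.
Proof.
  intros H. apply (ex_derive_continuous (K := R_AbsRing) (V := C_R_NormedModule)).
  exists l. apply pderiv_is_derive; auto.
Qed.

Lemma is_derive_C2_iff (f : C -> C2) (z : C) (l : C2) :
  is_derive (K := C_AbsRing) f z l <->
  cderiv (fun w => fst (f w)) z (fst l) /\ cderiv (fun w => snd (f w)) z (snd l).
Proof.
  rewrite is_derive_C_iff.
  assert (E : forall w, norm (minus (minus (f w) (f z)) (scal (w - z)%C l)) =
     sqrt (Cmod (fst (f w) - fst (f z) - fst l * (w - z))%C ^ 2 +
           Cmod (snd (f w) - snd (f z) - snd l * (w - z))%C ^ 2)).
  { intros w. rewrite (Cmult_comm (fst l)), (Cmult_comm (snd l)). reflexivity. }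
  split.
  - assert (S1 : forall u v, 0 <= u -> u <= sqrt (u ^ 2 + v ^ 2)).
    { intros u v Hu. rewrite <- (sqrt_pow2 u Hu) at 1. apply sqrt_le_1_alt.
      generalize (pow2_ge_0 v). lra. }
    intros H; split; intros eps He; destruct (H eps He) as [d [Hd H1]]; exists d; (split; [exact Hd|]);
    intros w Hw; specialize (H1 w Hw); rewrite E in H1; (eapply Rle_trans; [|exact H1]).
    + apply S1, Cmod_ge_0.
    + rewrite Rplus_comm. apply S1, Cmod_ge_0.
  - intros [H1 H2] eps He.
    destruct (H1 (eps / 2)) as [d1 [Hd1 K1]]; [lra|].
    destruct (H2 (eps / 2)) as [d2 [Hd2 K2]]; [lra|].
    exists (Rmin d1 d2); split; [apply Rmin_glb_lt; auto|].
    intros w Hw. rewrite E.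
    specialize (K1 w (Rlt_le_trans _ _ _ Hw (Rmin_l _ _))).
    specialize (K2 w (Rlt_le_trans _ _ _ Hw (Rmin_r _ _))).
    assert (T := Cmod_ge_0 (w - z)).
    rewrite <- (sqrt_pow2 (eps * Cmod (w - z))) by nra. apply sqrt_le_1_alt.
    assert (A1 := Cmod_ge_0 (fst (f w) - fst (f z) - fst l * (w - z))).
    assert (A2 := Cmod_ge_0 (snd (f w) - snd (f z) - snd l * (w - z))).
    clear -A1 A2 K1 K2 T He.
    revert A1 A2 K1 K2 T. generalize (Cmod (fst (f w) - fst (f z) - fst l * (w - z))).
    generalize (Cmod (snd (f w) - snd (f z) - snd l * (w - z))). generalize (Cmod (w - z)).
    intros t v u A1 A2 K1 K2 T.
    assert (0 <= eps * t) by nra. nra.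
Qed.

(** * Goursat's theorem *)

Lemma nested_intervals (u h : nat -> R) :
  (forall n, 0 <= h n) -> (forall n, u n <= u (S n)) ->
  (forall n, u (S n) + h (S n) <= u n + h n) ->
  exists x, forall n, u n <= x <= u n + h n.
Proof.
  intros H0 Hu Hv.
  assert (U : forall n k, u n <= u (n + k)%nat).
  { intros n k; induction k; [rewrite Nat.add_0_r; lra|].
    rewrite Nat.add_succ_r. specialize (Hu (n + k)%nat); lra. }
  assert (V : forall n k, u (n + k)%nat + h (n + k)%nat <= u n + h n).
  { intros n k; induction k; [rewrite Nat.add_0_r; lra|].
    rewrite Nat.add_succ_r. specialize (Hv (n + k)%nat); lra. }
  assert (UV : forall m n, u m <= u n + h n).
  { intros m n. assert (A := U m n). assert (B := V n m). rewrite (Nat.add_comm n m) in B.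
    specialize (H0 (m + n)%nat). lra. }
  destruct (completeness (fun x => exists n, x = u n)) as [x [Hx1 Hx2]].
  - exists (u 0%nat + h 0%nat). intros x [n ->]. apply UV.
  - exists (u 0%nat), 0%nat; auto.
  - exists x. intros n; split.
    + apply Hx1; exists n; auto.
    + apply Hx2. intros y [m ->]. apply UV.
Qed.

(** Compactness by repeated quartering: if [P] failed on the unit square, nested squares on which
    it fails would shrink to a point near which it holds. *)
Lemma square_bisection (P : R -> R -> R -> Prop) :
  (forall x y h, 0 <= x -> x + h <= 1 -> 0 <= y -> y + h <= 1 -> 0 < h ->
     P x y (h / 2) -> P (x + h / 2) y (h / 2) ->
     P x (y + h / 2) (h / 2) -> P (x + h / 2) (y + h / 2) (h / 2) -> P x y h) ->
  (forall x0 y0, 0 <= x0 <= 1 -> 0 <= y0 <= 1 -> exists delta, 0 < delta /\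
     forall x y h, 0 <= x -> x + h <= 1 -> 0 <= y -> y + h <= 1 -> 0 < h < delta ->
       x <= x0 <= x + h -> y <= y0 <= y + h -> P x y h) ->
  P 0 0 1.
Proof.
  intros Hsplit Hloc. apply NNPP. intros H0.
  pose (next := fun (p : R * R) (h : R) =>
    let (x, y) := p in
    if excluded_middle_informative (P x y (h / 2)) then
      if excluded_middle_informative (P (x + h / 2) y (h / 2)) then
        if excluded_middle_informative (P x (y + h / 2) (h / 2)) then (x + h / 2, y + h / 2)
        else (x, y + h / 2)
      else (x + h / 2, y)
    else (x, y)).
  assert (Hnext : forall x y h, 0 <= x -> x + h <= 1 -> 0 <= y -> y + h <= 1 -> 0 < h ->
    ~ P x y h -> ~ P (fst (next (x, y) h)) (snd (next (x, y) h)) (h / 2)).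
  { intros x y h A1 A2 A3 A4 A5 HP. unfold next.
    repeat (destruct excluded_middle_informative); simpl; auto. }
  assert (Hbnd : forall x y h, 0 < h ->
    (x <= fst (next (x, y) h) <= x + h / 2) /\ (y <= snd (next (x, y) h) <= y + h / 2)).
  { intros x y h Hh. unfold next. repeat (destruct excluded_middle_informative); simpl; lra. }
  pose (hs := fun n : nat => (1 / 2) ^ n).
  assert (Hh : forall n, 0 < hs n) by (intros n; apply pow_lt; lra).
  assert (HS : forall n, hs (S n) = hs n / 2) by (intros n; unfold hs; simpl; field).
  pose (s := fix s (n : nat) : R * R := match n with O => (0, 0) | S k => next (s k) (hs k) end).
  assert (I : forall n, 0 <= fst (s n) /\ fst (s n) + hs n <= 1 /\ 0 <= snd (s n) /\
    snd (s n) + hs n <= 1 /\ ~ P (fst (s n)) (snd (s n)) (hs n)).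
  { induction n as [|n [I1 [I2 [I3 [I4 I5]]]]].
    - unfold hs; simpl. repeat split; try lra. exact H0.
    - change (s (S n)) with (next (s n) (hs n)). rewrite HS. specialize (Hh n).
      destruct (s n) as [x y]. simpl in I1, I2, I3, I4, I5.
      destruct (Hbnd x y (hs n) Hh) as [B1 B2].
      repeat split; try lra. apply Hnext; auto. }
  assert (St : forall n, (fst (s n) <= fst (s (S n)) <= fst (s n) + hs n / 2) /\
                         (snd (s n) <= snd (s (S n)) <= snd (s n) + hs n / 2)).
  { intros n. change (s (S n)) with (next (s n) (hs n)). specialize (Hh n).
    destruct (s n) as [x y]. apply Hbnd; auto. }
  destruct (nested_intervals (fun n => fst (s n)) hs) as [x0 Hx0].
  { intros n; apply Rlt_le; auto. } { intros n; apply St. }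
  { intros n. rewrite HS. destruct (St n). lra. }
  destruct (nested_intervals (fun n => snd (s n)) hs) as [y0 Hy0].
  { intros n; apply Rlt_le; auto. } { intros n; apply St. }
  { intros n. rewrite HS. destruct (St n). lra. }
  destruct (Hloc x0 y0) as [d [Hd HP]].
  { specialize (Hx0 0%nat). destruct (I 0%nat) as [? [? ?]]. lra. }
  { specialize (Hy0 0%nat). destruct (I 0%nat) as [? [? [? [? ?]]]]. lra. }
  destruct (pow_lt_1_zero (1 / 2)) with (y := d) as [n Hn]; auto.
  { rewrite Rabs_pos_eq; lra. }
  specialize (Hn n (le_n _)). rewrite Rabs_pos_eq in Hn by (apply Rlt_le, Hh).
  destruct (I n) as [I1 [I2 [I3 [I4 I5]]]]. apply I5, HP; auto.
Qed.

Definition CInt (f : R -> C) (a b : R) : C := RInt (V := C_R_CompleteNormedModule) f a b.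

Definition ex_CInt (f : R -> C) (a b : R) : Prop := ex_RInt (V := C_R_NormedModule) f a b.

Lemma differentiable_ex_CInt f a b :
  (forall t, Rmin a b <= t <= Rmax a b -> exists l, pderiv f t l) -> ex_CInt f a b.
Proof.
  intros H. apply (ex_RInt_continuous (V := C_R_CompleteNormedModule)).
  intros t Ht. destruct (H t Ht) as [l Hl]. eapply pderiv_continuous; eauto.
Qed.

Lemma CInt_derive (F f : R -> C) a b :
  (forall t, Rmin a b <= t <= Rmax a b -> pderiv F t (f t)) ->
  (forall t, Rmin a b <= t <= Rmax a b -> exists l, pderiv f t l) ->
  CInt f a b = (F b - F a)%C.
Proof.
  intros H1 H2. unfold CInt. apply (is_RInt_unique (V := C_R_CompleteNormedModule)).
  apply (is_RInt_derive (V := C_R_CompleteNormedModule)).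
  - intros t Ht. apply pderiv_is_derive; auto.
  - intros t Ht. destruct (H2 t Ht) as [l Hl]. eapply pderiv_continuous; eauto.
Qed.

Lemma CInt_bound f a b M : a <= b -> ex_CInt f a b ->
  (forall t, a <= t <= b -> Cmod (f t) <= M) -> Cmod (CInt f a b) <= (b - a) * M.
Proof.
  intros Hab Hex H. rewrite Cmod_norm.
  apply (norm_RInt_le_const (V := C_R_NormedModule) f); auto.
  - intros t Ht. rewrite <- Cmod_norm. auto.
  - apply (RInt_correct (V := C_R_CompleteNormedModule)); auto.
Qed.

Lemma CInt_ext f g a b : a <= b -> (forall t, a <= t <= b -> f t = g t) -> CInt f a b = CInt g a b.
Proof.
  intros Hab H. apply (RInt_ext (V := C_R_CompleteNormedModule)).
  intros t Ht. rewrite Rmin_left, Rmax_right in Ht by auto. apply H; lra.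
Qed.

Lemma CInt_Chasles f a b c : ex_CInt f a b -> ex_CInt f b c ->
  (CInt f a b + CInt f b c)%C = CInt f a c.
Proof. intros H1 H2. apply (RInt_Chasles (V := C_R_CompleteNormedModule)); auto. Qed.

Lemma CInt_plus f g a b : ex_CInt f a b -> ex_CInt g a b ->
  CInt (fun t => f t + g t)%C a b = (CInt f a b + CInt g a b)%C.
Proof. intros H1 H2. apply (RInt_plus (V := C_R_CompleteNormedModule)); auto. Qed.

Lemma CInt_minus f g a b : ex_CInt f a b -> ex_CInt g a b ->
  CInt (fun t => f t - g t)%C a b = (CInt f a b - CInt g a b)%C.
Proof. intros H1 H2. apply (RInt_minus (V := C_R_CompleteNormedModule)); auto. Qed.

Lemma ex_CInt_minus f g a b : ex_CInt f a b -> ex_CInt g a b ->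
  ex_CInt (fun t => f t - g t)%C a b.
Proof. intros H1 H2. apply (ex_RInt_minus (V := C_R_NormedModule)); auto. Qed.

Lemma CInt_components f a b : ex_CInt f a b ->
  is_RInt (fun t => fst (f t)) a b (fst (CInt f a b)) /\
  is_RInt (fun t => snd (f t)) a b (snd (CInt f a b)).
Proof.
  intros H.
  assert (K := RInt_correct (V := C_R_CompleteNormedModule) f a b H).
  split; [exact (is_RInt_fct_extend_fst f a b _ K)|exact (is_RInt_fct_extend_snd f a b _ K)].
Qed.

Lemma CInt_of_components f a b l1 l2 :
  is_RInt (fun t => fst (f t)) a b l1 -> is_RInt (fun t => snd (f t)) a b l2 ->
  CInt f a b = (l1, l2).
Proof.
  intros H1 H2. apply (is_RInt_unique (V := C_R_CompleteNormedModule)).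
  exact (is_RInt_fct_extend_pair f a b l1 l2 H1 H2).
Qed.

Lemma CInt_scal c f a b : ex_CInt f a b -> CInt (fun t => c * f t)%C a b = (c * CInt f a b)%C.
Proof.
  intros H. destruct (CInt_components f a b H) as [H1 H2]. destruct c as [c1 c2].
  apply CInt_of_components; simpl.
  - apply (is_RInt_minus (V := R_NormedModule)); apply (is_RInt_scal (V := R_NormedModule)); auto.
  - apply (is_RInt_plus (V := R_NormedModule)); apply (is_RInt_scal (V := R_NormedModule)); auto.
Qed.

Lemma CInt_conj f a b : ex_CInt f a b -> CInt (fun t => Cconj (f t)) a b = Cconj (CInt f a b).
Proof.
  intros H. destruct (CInt_components f a b H) as [H1 H2].
  apply CInt_of_components; simpl; auto. apply (is_RInt_opp (V := R_NormedModule)); auto.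
Qed.

Lemma path_lipschitz (g gd : R -> C) (a b K : R) :
  a <= b ->
  (forall t, pderiv g t (gd t)) -> (forall t, exists l, pderiv gd t l) ->
  (forall t, a <= t <= b -> Cmod (gd t) <= K) -> Cmod (g b - g a)%C <= (b - a) * K.
Proof.
  intros Hab H1 H2 HK. rewrite <- (CInt_derive g gd a b) by auto.
  apply CInt_bound; auto. apply differentiable_ex_CInt; auto.
Qed.

(** The affine part of [q] has a quadratic primitive, which accounts for the whole integral up to
    the remainder [M]. Around a square the increments of the primitive cancel. *)
Lemma edge_estimate (q : C -> C) (A B z0 : C) (g gd : R -> C) (u h M K : R) :
  0 <= h -> 0 <= M ->
  (forall t, pderiv g t (gd t)) -> (forall t, exists l, pderiv gd t l) ->
  (forall t, u <= t <= u + h -> exists l, cderiv q (g t) l) ->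
  (forall t, u <= t <= u + h -> Cmod (gd t) <= K) ->
  (forall t, u <= t <= u + h -> Cmod (q (g t) - A - B * (g t - z0))%C <= M) ->
  let prim := fun w : C => (A * w + B * / 2 * ((w - z0) * (w - z0)))%C in
  Cmod (CInt (fun t => q (g t) * gd t)%C u (u + h) - (prim (g (u + h)%R) - prim (g u)))%C
    <= h * (M * K).
Proof.
  intros Hh HM H1 H2 Hq HK Hr prim.
  assert (Dr : forall t, exists l, pderiv (fun t => (A + B * (g t - z0)) * gd t)%C t l).
  { intros t. destruct (H2 t) as [l Hl]. eexists.
    apply deriv_along_mult; [|exact Hl].
    apply deriv_along_plus; [apply deriv_along_const|].
    apply deriv_along_scal. apply deriv_along_minus; [apply H1|apply deriv_along_const]. }
  assert (Dq : forall t, Rmin u (u + h) <= t <= Rmax u (u + h) -> 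
     exists l, pderiv (fun t => q (g t) * gd t)%C t l).
  { intros t Ht. rewrite Rmin_left, Rmax_right in Ht by lra.
    destruct (H2 t) as [l Hl]. destruct (Hq t Ht) as [m Hm]. eexists.
    apply deriv_along_mult; [|exact Hl]. eapply deriv_along_comp; [exact Hm|apply H1]. }
  rewrite <- (CInt_derive (fun t => prim (g t)) (fun t => (A + B * (g t - z0)) * gd t)%C).
  2:{ intros t _. unfold prim.
      replace ((A + B * (g t - z0)) * gd t)%C with
       (A * gd t + B * / 2 * ((gd t - 0) * (g t - z0) + (g t - z0) * (gd t - 0)))%C.
      2:{ field. }
      apply deriv_along_plus; [apply deriv_along_scal, H1|].
      apply deriv_along_scal. 
      apply (deriv_along_mult RtoC (fun t => g t - z0)%C (fun t => g t - z0)%C);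
      apply deriv_along_minus; try apply H1; apply deriv_along_const. }
  2:{ intros t _. apply Dr. }
  rewrite <- CInt_minus; try (apply differentiable_ex_CInt; auto).
  replace (h * (M * K)) with ((u + h - u) * (M * K)) by ring.
  apply CInt_bound; [lra| |].
  - apply ex_CInt_minus; apply differentiable_ex_CInt; auto.
  - intros t Ht.
    replace (q (g t) * gd t - (A + B * (g t - z0)) * gd t)%C with
      ((q (g t) - A - B * (g t - z0)) * gd t)%C by ring.
    rewrite Cmod_mult. apply Rmult_le_compat; auto using Cmod_ge_0.
Qed.

(** At a point where [q] is differentiable, the boundary integral over a square of side [h] is
    [o(h^2)] by [edge_estimate]; bisection turns this into a bound by an arbitrarily small multiple
    of the area. The map [z] will be a homotopy of closed curves. *)
Lemma goursat_square (q : C -> C) (z zs zt : R -> R -> C) (K : R) :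
  (forall s t, pderiv (fun s => z s t) s (zs s t)) ->
  (forall s t, pderiv (fun t => z s t) t (zt s t)) ->
  (forall s t, exists l, pderiv (fun s => zs s t) s l) ->
  (forall s t, exists l, pderiv (fun t => zt s t) t l) ->
  (forall s t, 0 <= s <= 1 -> 0 <= t <= 1 -> Cmod (zs s t) <= K) ->
  (forall s t, 0 <= s <= 1 -> 0 <= t <= 1 -> Cmod (zt s t) <= K) ->
  (forall s t, 0 <= s <= 1 -> 0 <= t <= 1 -> exists l, cderiv q (z s t) l) ->
  (CInt (fun s => q (z s 0) * zs s 0)%C 0 1 + CInt (fun t => q (z 1 t) * zt 1 t)%C 0 1
   - CInt (fun s => q (z s 1) * zs s 1)%C 0 1 - CInt (fun t => q (z 0%R t) * zt 0%R t)%C 0 1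
   = 0)%C.
Proof.
  intros Dzs Dzt Dzs2 Dzt2 Bzs Bzt Dq.
  assert (K0 : 0 <= K).
  { eapply Rle_trans; [apply Cmod_ge_0|]. apply (Bzs 0 0); lra. }
  set (V := fun t a b => CInt (fun s => q (z s t) * zs s t)%C a b).
  set (H := fun s a b => CInt (fun t => q (z s t) * zt s t)%C a b).
  set (bd := fun x y h => (V y x (x + h)%R + H (x + h)%R y (y + h)%R
                           - V (y + h)%R x (x + h)%R - H x y (y + h)%R)%C).
  assert (EV : forall t a b, 0 <= t <= 1 -> 0 <= a -> a <= b -> b <= 1 ->
     ex_CInt (fun s => q (z s t) * zs s t)%C a b).
  { intros t a b Ht Ha Hab Hb. apply differentiable_ex_CInt. intros s Hs.
    rewrite Rmin_left, Rmax_right in Hs by auto.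
    destruct (Dq s t) as [l Hl]; try lra. destruct (Dzs2 s t) as [m Hm].
    eexists. apply deriv_along_mult; [|exact Hm]. eapply deriv_along_comp; [exact Hl|apply Dzs]. }
  assert (EH : forall s a b, 0 <= s <= 1 -> 0 <= a -> a <= b -> b <= 1 ->
     ex_CInt (fun t => q (z s t) * zt s t)%C a b).
  { intros s a b Ht Ha Hab Hb. apply differentiable_ex_CInt. intros t Hs.
    rewrite Rmin_left, Rmax_right in Hs by auto.
    destruct (Dq s t) as [l Hl]; try lra. destruct (Dzt2 s t) as [m Hm].
    eexists. apply deriv_along_mult; [|exact Hm]. eapply deriv_along_comp; [exact Hl|apply Dzt]. }
  assert (VC : forall t a b c, 0 <= t <= 1 -> 0 <= a -> a <= b -> b <= c -> c <= 1 ->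
    (V t a b + V t b c)%C = V t a c) by (intros; apply CInt_Chasles; apply EV; lra).
  assert (HC : forall s a b c, 0 <= s <= 1 -> 0 <= a -> a <= b -> b <= c -> c <= 1 ->
    (H s a b + H s b c)%C = H s a c) by (intros; apply CInt_Chasles; apply EH; lra).
  assert (small : forall eta, 0 < eta -> Cmod (bd 0 0 1) <= eta).
  { intros eta Heta.
    replace eta with (eta * (1 * 1)) by ring.
    apply (square_bisection (fun x y h => Cmod (bd x y h) <= eta * (h * h))).
    - intros x y h A1 A2 A3 A4 A5 P1 P2 P3 P4.
      replace (bd x y h) with (bd x y (h / 2)%R + bd (x + h / 2)%R y (h / 2)%R
        + bd x (y + h / 2)%R (h / 2)%R + bd (x + h / 2)%R (y + h / 2)%R (h / 2)%R)%C.
      + eapply Rle_trans; [apply Cmod_triangle|].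
        eapply Rle_trans; [apply Rplus_le_compat_r, Cmod_triangle|].
        eapply Rle_trans; [apply Rplus_le_compat_r, Rplus_le_compat_r, Cmod_triangle|].
        lra.
      + unfold bd.
        assert (X : x + h / 2 + h / 2 = x + h) by field.
        assert (Y : y + h / 2 + h / 2 = y + h) by field.
        rewrite X, Y.
        rewrite <- (VC y x (x + h / 2)%R (x + h)%R), <- (VC (y + h)%R x (x + h / 2)%R (x + h)%R),
          <- (HC x y (y + h / 2)%R (y + h)%R), <- (HC (x + h)%R y (y + h / 2)%R (y + h)%R) by lra.
        ring.
    - intros x0 y0 Hx0 Hy0.
      destruct (Dq x0 y0 Hx0 Hy0) as [B HB].
      set (z0 := z x0 y0) in *.
      (* four sides of length [h], with [|z - z0| <= 2 h K] and speed at most [K] on each *)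
      destruct (HB (eta / (8 * (K + 1) ^ 2))) as [d [Hd HB']].
      { apply Rdiv_lt_0_compat; auto. assert (0 < (K + 1) ^ 2) by (apply pow_lt; lra). lra. }
      exists (d / (2 * (K + 1))); split; [apply Rdiv_lt_0_compat; lra|].
      intros x y h A1 A2 A3 A4 [A5 A6] A7 A8.
      set (e := eta / (8 * (K + 1) ^ 2)) in *.
      assert (He : 0 < e).
      { apply Rdiv_lt_0_compat; auto. assert (0 < (K + 1) ^ 2) by (apply pow_lt; lra). lra. }
      assert (Lip : forall s t, x <= s <= x + h -> y <= t <= y + h ->
         Cmod (z s t - z0)%C <= 2 * h * K).
      { intros s t Hs Ht.
        replace (z s t - z0)%C with ((z s t - z x0 t) + (z x0 t - z0))%C by ring.
        eapply Rle_trans; [apply Cmod_triangle|].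
        assert (L1 : Cmod (z s t - z x0 t) <= h * K).
        { destruct (Rle_dec x0 s) as [Hle|Hle].
          - eapply Rle_trans; [apply (path_lipschitz (fun s => z s t) (fun s => zs s t) x0 s K); [lra|auto|auto|intros u Hu; apply Bzs; lra]|].
            apply Rmult_le_compat_r; lra.
          - replace (z s t - z x0 t)%C with (- (z x0 t - z s t))%C by ring. rewrite Cmod_opp.
            eapply Rle_trans; [apply (path_lipschitz (fun s => z s t) (fun s => zs s t) s x0 K); [lra|auto|auto|intros u Hu; apply Bzs; lra]|].
            apply Rmult_le_compat_r; lra. }
        assert (L2 : Cmod (z x0 t - z0) <= h * K).
        { unfold z0. destruct (Rle_dec y0 t) as [Hle|Hle].
          - eapply Rle_trans; [apply (path_lipschitz (fun t => z x0 t) (fun t => zt x0 t) y0 t K); [lra|auto|auto|intros u Hu; apply Bzt; lra]|].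
            apply Rmult_le_compat_r; lra.
          - replace (z x0 t - z x0 y0)%C with (- (z x0 y0 - z x0 t))%C by ring. rewrite Cmod_opp.
            eapply Rle_trans; [apply (path_lipschitz (fun t => z x0 t) (fun t => zt x0 t) t y0 K); [lra|auto|auto|intros u Hu; apply Bzt; lra]|].
            apply Rmult_le_compat_r; lra. }
        lra. }
      assert (Rem : forall s t, x <= s <= x + h -> y <= t <= y + h ->
         Cmod (q (z s t) - q z0 - B * (z s t - z0))%C <= e * (2 * h * K)).
      { intros s t Hs Ht. specialize (Lip s t Hs Ht).
        eapply Rle_trans; [apply HB'|].
        - eapply Rle_lt_trans; [exact Lip|].
          apply Rle_lt_trans with (h * (2 * (K + 1))); [nra|].
          apply Rlt_le_trans with (d / (2 * (K + 1)) * (2 * (K + 1))).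
          + apply Rmult_lt_compat_r; lra.
          + right; field; lra.
        - apply Rmult_le_compat_l; lra. }
      assert (M0 : 0 <= e * (2 * h * K)) by (apply Rmult_le_pos; [lra|apply Rmult_le_pos; lra]).
      pose proof (fun t (Ht : y <= t <= y + h) => (edge_estimate q (q z0) B z0 (fun s => z s t) (fun s => zs s t) x h (e * (2 * h * K)) K
         (Rlt_le _ _ A5) M0 (fun s => Dzs s t) (fun s => Dzs2 s t)
         (fun s Hs => Dq s t ltac:(lra) ltac:(lra)) (fun s Hs => Bzs s t ltac:(lra) ltac:(lra))
         (fun s Hs => Rem s t Hs Ht))) as ES.
      pose proof (fun s (Ht : x <= s <= x + h) => (edge_estimate q (q z0) B z0 (fun t => z s t) (fun t => zt s t) y h (e * (2 * h * K)) K
         (Rlt_le _ _ A5) M0 (fun t => Dzt s t) (fun t => Dzt2 s t)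
         (fun t Hs => Dq s t ltac:(lra) ltac:(lra)) (fun t Hs => Bzt s t ltac:(lra) ltac:(lra))
         (fun t Hs => Rem s t Ht Hs))) as ET.
      simpl in ES, ET.
      set (prim := fun w : C => (q z0 * w + B * / 2 * ((w - z0) * (w - z0)))%C).
      assert (ES1 := ES y ltac:(lra)). assert (ES2 := ES (y + h)%R ltac:(lra)).
      assert (ET1 := ET x ltac:(lra)). assert (ET2 := ET (x + h)%R ltac:(lra)).
      clear ES ET.
      change (Cmod (V y x (x + h)%R - (prim (z (x + h)%R y) - prim (z x y)))%C <= h * (e * (2 * h * K) * K)) in ES1.
      change (Cmod (V (y + h)%R x (x + h)%R - (prim (z (x + h)%R (y + h)%R) - prim (z x (y + h)%R)))%C <= h * (e * (2 * h * K) * K)) in ES2.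
      change (Cmod (H x y (y + h)%R - (prim (z x (y + h)%R) - prim (z x y)))%C <= h * (e * (2 * h * K) * K)) in ET1.
      change (Cmod (H (x + h)%R y (y + h)%R - (prim (z (x + h)%R (y + h)%R) - prim (z (x + h)%R y)))%C <= h * (e * (2 * h * K) * K)) in ET2.
      replace (bd x y h) with
       ((V y x (x + h)%R - (prim (z (x + h)%R y) - prim (z x y)))
       + (H (x + h)%R y (y + h)%R - (prim (z (x + h)%R (y + h)%R) - prim (z (x + h)%R y)))
       - (V (y + h)%R x (x + h)%R - (prim (z (x + h)%R (y + h)%R) - prim (z x (y + h)%R)))
       - (H x y (y + h)%R - (prim (z x (y + h)%R) - prim (z x y))))%C by (unfold bd; ring).
      eapply Rle_trans; [apply Cmod_sub_triangle|].
      eapply Rle_trans; [apply Rplus_le_compat_r, Cmod_sub_triangle|].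
      eapply Rle_trans; [apply Rplus_le_compat_r, Rplus_le_compat_r, Cmod_triangle|].
      apply Rle_trans with (8 * e * (K + 1) ^ 2 * (h * h)).
      + assert (0 <= e * (h * h)) by nra.
        assert (K * K <= (K + 1) ^ 2) by nra. nra.
      + right. unfold e. field. lra. }
  assert (Z : Cmod (bd 0 0 1) <= 0).
  { apply Rnot_lt_le. intros Hp. specialize (small (Cmod (bd 0 0 1) / 2)). lra. }
  assert (Z' : bd 0 0 1 = RtoC 0).
  { apply Cmod_eq_0. generalize (Cmod_ge_0 (bd 0 0 1)). lra. }
  unfold bd in Z'. rewrite !Rplus_0_l in Z'. exact Z'.
Qed.

(** * The complex exponential and the unit circle *)

Lemma Cmod_le_components (z : C) : Cmod z <= Rabs (fst z) + Rabs (snd z).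
Proof.
  destruct z as [x y]. replace (x, y) with (RtoC x + Ci * RtoC y)%C.
  2:{ apply injective_projections; simpl; ring. }
  eapply Rle_trans; [apply Cmod_triangle|]. rewrite Cmod_mult, Cmod_Ci, !Cmod_R. simpl.
  replace (x + (0 * y - 1 * 0)) with x by ring. replace (0 + (0 * 0 + 1 * y)) with y by ring. lra.
Qed.

Lemma pderiv_components (x y : R -> R) (t dx dy : R) :
  is_derive x t dx -> is_derive y t dy -> pderiv (fun s => (x s, y s)) t (dx, dy).
Proof.
  intros Hx Hy eps He.
  apply is_derive_Reals in Hx. apply is_derive_Reals in Hy.
  destruct (Hx (eps / 2)) as [d1 H1]; [lra|].
  destruct (Hy (eps / 2)) as [d2 H2]; [lra|].
  exists (Rmin d1 d2); split; [apply Rmin_glb_lt; apply cond_pos|].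
  intros w. rewrite <- RtoC_minus, Cmod_R. intros Hw.
  assert (Ew : w = t + (w - t)) by ring.
  destruct (Req_dec (w - t) 0) as [E|E].
  { replace w with t by lra. rewrite Rminus_diag, Rabs_R0, Rmult_0_r.
    replace ((x t, y t) - (x t, y t) - (dx, dy) * 0)%C with (RtoC 0) by ring.
    rewrite Cmod_0; lra. }
  specialize (H1 (w - t) E (Rlt_le_trans _ _ _ Hw (Rmin_l _ _))).
  specialize (H2 (w - t) E (Rlt_le_trans _ _ _ Hw (Rmin_r _ _))).
  rewrite <- Ew in H1, H2.
  eapply Rle_trans; [apply Cmod_le_components|]. simpl.
  replace (x w + - x t + - (dx * (w - t) - dy * 0)) with (((x w - x t) / (w - t) - dx) * (w - t))
    by (field; auto).
  replace (y w + - y t + - (dx * 0 + dy * (w - t))) with (((y w - y t) / (w - t) - dy) * (w - t))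
    by (field; auto).
  rewrite !Rabs_mult. assert (P := Rabs_pos (w - t)). nra.
Qed.

Definition cexp (z : C) : C := (exp (Re z) * cos (Im z), exp (Re z) * sin (Im z)).

Lemma Cmod_cexp z : Cmod (cexp z) = exp (Re z).
Proof.
  assert (H : Cmod (cexp z) ^ 2 = exp (Re z) ^ 2).
  { rewrite Cmod2_alt. simpl.
    assert (E := sin2_cos2 (Im z)). unfold Rsqr in E.
    replace (_ + _) with (exp (Re z) * exp (Re z) * (sin (Im z) * sin (Im z) + cos (Im z) * cos (Im z))) by ring.
    rewrite E. ring. }
  apply Rsqr_inj; [apply Cmod_ge_0|apply Rlt_le, exp_pos|].
  unfold Rsqr. simpl in H. rewrite !Rmult_1_r in H. exact H.
Qed.

Lemma cexp_0 : cexp 0 = 1%C.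
Proof. unfold cexp; simpl. rewrite exp_0, cos_0, sin_0. apply injective_projections; simpl; ring. Qed.

Lemma cexp_R x : cexp (RtoC x) = RtoC (exp x).
Proof. unfold cexp; simpl. rewrite cos_0, sin_0. apply injective_projections; simpl; ring. Qed.

Lemma cexp_plus z w : cexp (z + w)%C = (cexp z * cexp w)%C.
Proof.
  destruct z as [a b], w as [c d]. unfold cexp; simpl.
  rewrite exp_plus, cos_plus, sin_plus. apply injective_projections; simpl; ring.
Qed.

Lemma cexp_line_pderiv (w : C) (t : R) : pderiv (fun s => cexp (RtoC s * w)%C) t (w * cexp (t * w))%C.
Proof.
  destruct w as [a b].
  apply deriv_along_ext with (fun s => (exp (s * a) * cos (s * b), exp (s * a) * sin (s * b))).
  { intros s. unfold cexp. simpl. replace (s * a - 0 * b) with (s * a) by ring.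
    replace (s * b + 0 * a) with (s * b) by ring. reflexivity. }
  replace ((a, b) * cexp (t * (a, b)))%C with
    (a * exp (t * a) * cos (t * b) - b * (exp (t * a) * sin (t * b)),
     a * exp (t * a) * sin (t * b) + b * (exp (t * a) * cos (t * b))).
  2:{ unfold cexp. simpl. replace (t * a - 0 * b) with (t * a) by ring.
    replace (t * b + 0 * a) with (t * b) by ring. apply injective_projections; simpl; ring. }
  apply pderiv_components; auto_derive; auto; ring.
Qed.

Lemma differentiable_cexp_line (w : C) (t : R) :
  exists l, pderiv (fun s => w * cexp (RtoC s * w))%C t l.
Proof. eexists. apply deriv_along_scal, cexp_line_pderiv. Qed.

Lemma Re_le_Cmod z : Re z <= Cmod z.
Proof. eapply Rle_trans; [apply Rle_abs|apply re_le_Cmod]. Qed.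

Lemma cexp_line_bound (w : C) (t : R) : 0 <= t <= 1 ->
  Cmod (cexp (RtoC t * w) - 1)%C <= Cmod w * exp (Cmod w).
Proof.
  intros Ht.
  assert (W := Cmod_ge_0 w).
  assert (B : 0 <= Cmod w * exp (Cmod w)) by (apply Rmult_le_pos; [auto|apply Rlt_le, exp_pos]).
  replace (cexp (RtoC t * w) - 1)%C with (cexp (RtoC t * w) - cexp (RtoC 0 * w))%C.
  2:{ replace (RtoC 0 * w)%C with (RtoC 0) by ring. rewrite cexp_0. reflexivity. }
  eapply Rle_trans.
  - apply (path_lipschitz (fun s => cexp (RtoC s * w)%C) (fun s => (w * cexp (RtoC s * w))%C) 0 t
      (Cmod w * exp (Cmod w))); try lra.
    + intros s; apply cexp_line_pderiv.
    + apply differentiable_cexp_line.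
    + intros s Hs. rewrite Cmod_mult, Cmod_cexp. apply Rmult_le_compat_l; auto.
      assert (E : Re (RtoC s * w) <= Cmod w).
      { eapply Rle_trans; [apply Re_le_Cmod|]. rewrite Cmod_mult, Cmod_R, Rabs_pos_eq by lra. nra. }
      destruct E as [E|E]; [apply Rlt_le, exp_increasing; auto|rewrite E; lra].
  - rewrite Rminus_0_r. nra.
Qed.

(** By the functional equation it suffices to differentiate at 0, where
    [cexp w - 1 - w] is estimated along the segment from 0 to [w]. *)
Lemma cexp_cderiv z : cderiv cexp z (cexp z).
Proof.
  intros eps He.
  assert (P := exp_pos (Re z)). 
  set (d := Rmin 1 (eps / (exp (Re z) * exp 1))).
  assert (P1 := exp_pos 1).
  exists d; split.
  { apply Rmin_glb_lt; [lra|]. apply Rdiv_lt_0_compat; auto. nra. }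
  intros u Hu. set (w := (u - z)%C) in *.
  assert (H1 := Rlt_le_trans _ _ _ Hu (Rmin_l _ _)).
  assert (H2 := Rlt_le_trans _ _ _ Hu (Rmin_r _ _)).
  replace u with (z + w)%C by (unfold w; ring). rewrite cexp_plus.
  replace (cexp z * cexp w - cexp z - cexp z * w)%C with (cexp z * (cexp w - 1 - w))%C by ring.
  rewrite Cmod_mult, Cmod_cexp.
  assert (W := Cmod_ge_0 w).
  assert (L : Cmod (cexp w - 1 - w)%C <= (1 - 0) * (Cmod w * (Cmod w * exp (Cmod w)))).
  { replace (cexp w - 1 - w)%C with
      ((cexp (RtoC 1 * w) - RtoC 1 * w) - (cexp (RtoC 0 * w) - RtoC 0 * w))%C.
    2:{ replace (RtoC 0 * w)%C with (RtoC 0) by ring. rewrite cexp_0.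
        replace (RtoC 1 * w)%C with w by ring. ring. }
    apply (path_lipschitz (fun s => cexp (RtoC s * w) - RtoC s * w)%C
       (fun s => w * cexp (RtoC s * w) - w)%C); try lra.
    - intros s. apply deriv_along_minus; [apply cexp_line_pderiv|].
      apply deriv_along_ext with (fun s => w * RtoC s)%C; [intros; ring|].
      assert (D := deriv_along_scal RtoC w RtoC s 1 (deriv_along_inc RtoC s)).
      rewrite Cmult_1_r in D. exact D.
    - intros s. destruct (differentiable_cexp_line w s) as [l Hl]. eexists.
      apply deriv_along_minus; [exact Hl|apply deriv_along_const].
    - intros s Hs. replace (w * cexp (RtoC s * w) - w)%C with (w * (cexp (RtoC s * w) - 1))%C by ring.
      rewrite Cmod_mult. apply Rmult_le_compat_l; auto. apply cexp_line_bound; auto. }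
  assert (E : exp (Cmod w) <= exp 1) by (apply Rlt_le, exp_increasing; lra).
  assert (EP := exp_pos (Cmod w)).
  assert (A : Cmod w * (exp (Re z) * exp 1) <= eps).
  { apply Rle_trans with (eps / (exp (Re z) * exp 1) * (exp (Re z) * exp 1)).
    - apply Rmult_le_compat_r; [nra|lra].
    - right; field; lra. }
  apply Rle_trans with (exp (Re z) * (Cmod w * (Cmod w * exp 1))).
  - apply Rmult_le_compat_l; [lra|]. eapply Rle_trans; [exact L|].
    rewrite Rminus_0_r, Rmult_1_l. apply Rmult_le_compat_l; auto. apply Rmult_le_compat_l; auto.
  - replace (exp (Re z) * (Cmod w * (Cmod w * exp 1))) with ((Cmod w * (exp (Re z) * exp 1)) * Cmod w) by ring.
    apply Rmult_le_compat_r; auto.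
Qed.

Definition two_pi_i : C := (0, 2 * PI).

Definition circle (t : R) : C := cexp (RtoC t * two_pi_i)%C.

Lemma circle_pderiv t : pderiv circle t (two_pi_i * circle t)%C.
Proof. apply cexp_line_pderiv. Qed.

Lemma Cmod_circle t : Cmod (circle t) = 1.
Proof.
  unfold circle. rewrite Cmod_cexp. simpl. replace (t * 0 - 0 * (2 * PI)) with 0 by ring. apply exp_0.
Qed.

Lemma circle_0 : circle 0 = 1%C.
Proof. unfold circle. replace (RtoC 0 * two_pi_i)%C with (RtoC 0) by ring. apply cexp_0. Qed.

Lemma circle_1 : circle 1 = 1%C.
Proof.
  unfold circle, cexp. simpl. replace (1 * 0 - 0 * (2 * PI)) with 0 by ring.
  replace (1 * (2 * PI) + 0 * 0) with (2 * PI) by ring.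
  rewrite exp_0, cos_2PI, sin_2PI. apply injective_projections; simpl; ring.
Qed.

Lemma circle_neq_0 t : circle t <> RtoC 0.
Proof. apply Cmod_gt_0. rewrite Cmod_circle. lra. Qed.

Lemma Cconj_circle t : Cconj (circle t) = (/ circle t)%C.
Proof.
  assert (E := Cmod2_conj (circle t)). rewrite Cmod_circle in E.
  apply (f_equal (fun x => (x * / circle t)%C)) in E.
  replace (circle t * Cconj (circle t) * / circle t)%C with (Cconj (circle t)) in E
    by (field; apply circle_neq_0).
  rewrite <- E. replace (1 ^ 2) with 1 by ring. ring.
Qed.

Lemma circle_sub_neq_0 t a : Cmod a < 1 -> (circle t - a)%C <> RtoC 0.
Proof.
  intros Ha. apply Cmod_gt_0. assert (H := Cmod_sub_rev (circle t) a). rewrite Cmod_circle in H. lra.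
Qed.

Lemma circle_sub_bound t a : 1 - Cmod a <= Cmod (circle t - a)%C.
Proof. assert (H := Cmod_sub_rev (circle t) a). rewrite Cmod_circle in H. lra. Qed.

(** * Cauchy's formula and the maximum principle *)

Definition differentiable_disc (r : R) (f : C -> C) : Prop :=
  forall z, Cmod z < r -> exists l, cderiv f z l.

Definition cauchy_kernel (a : C) (t : R) : C := (circle t / (circle t - a))%C.

Lemma cauchy_integrand_differentiable f r a t : 1 < r -> differentiable_disc r f -> Cmod a < 1 ->
  exists l, pderiv (fun t => f (circle t) * cauchy_kernel a t)%C t l.
Proof.
  unfold cauchy_kernel.
  intros Hr Hf Ha. destruct (Hf (circle t)) as [l Hl]; [rewrite Cmod_circle; auto|].
  eexists. apply deriv_along_mult.
  - eapply deriv_along_comp; [exact Hl|apply circle_pderiv].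
  - apply deriv_along_div; [apply circle_sub_neq_0; auto|apply circle_pderiv|].
    apply deriv_along_minus; [apply circle_pderiv|apply deriv_along_const].
Qed.

Lemma convex_disc_bound (a c : C) (l : R) : 0 <= l <= 1 -> Cmod a < 1 -> Cmod c = 1 ->
  Cmod (a + RtoC l * (c - a))%C <= 1.
Proof.
  intros Hl Ha Hc. replace (a + RtoC l * (c - a))%C with (RtoC (1 - l) * a + RtoC l * c)%C
    by (rewrite RtoC_minus; ring).
  eapply Rle_trans; [apply Cmod_triangle|]. rewrite !Cmod_mult, !Cmod_R, !Rabs_pos_eq by lra.
  rewrite Hc. assert (A := Cmod_ge_0 a). nra.
Qed.

(** The circles [a + l (circle - a)], [eps <= l <= 1], form a homotopy that avoids [a], and
    [goursat_square] applies to [f z / (z - a)] along it. The two other sides of the square cancel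
    by periodicity. *)
Lemma cauchy_homotopy f r a eps : 1 < r -> differentiable_disc r f -> Cmod a < 1 -> 0 < eps < 1 ->
  CInt (fun t => f (circle t) * cauchy_kernel a t)%C 0 1 =
  CInt (fun t => f (a + RtoC eps * (circle t - a)) * cauchy_kernel a t)%C 0 1.
Proof.
  unfold cauchy_kernel.
  intros Hr Hf Ha Heps.
  assert (Pi4 := PI_4). assert (Pi0 := PI_RGT_0).
  set (w := two_pi_i).
  assert (Hw : Cmod w <= 8).
  { eapply Rle_trans; [apply Cmod_le_components|]. simpl. rewrite Rabs_R0, Rabs_pos_eq; lra. }
  assert (Hw0 : w <> RtoC 0).
  { intros E. unfold w, two_pi_i in E. injection E. lra. }
  set (q := fun z => (f z / (z - a))%C).
  set (lam := fun s => (RtoC eps + RtoC (1 - eps) * RtoC s)%C).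
  assert (Elam : forall s, lam s = RtoC (eps + (1 - eps) * s)).
  { intros s. unfold lam. rewrite RtoC_plus, RtoC_mult. reflexivity. }
  assert (Dlam : forall s, pderiv lam s (0 + RtoC (1 - eps) * 1)%C).
  { intros s. apply deriv_along_plus; [apply deriv_along_const|].
    apply deriv_along_scal, deriv_along_inc. }
  set (z := fun s t => (a + lam s * (circle t - a))%C).
  set (zs := fun (s t : R) => (RtoC (1 - eps) * (circle t - a))%C).
  set (zt := fun (s t : R) => (lam s * (w * circle t))%C).
  assert (Dc : forall t, pderiv (fun t => circle t - a)%C t (w * circle t)%C).
  { intros t. replace (w * circle t)%C with (w * circle t - 0)%C by ring.
    apply deriv_along_minus; [apply circle_pderiv|apply deriv_along_const]. }
  (* 8 bounds both [2 pi] and the diameter of the disc *)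
  assert (G := goursat_square q z zs zt 8).
  rewrite (CInt_ext (fun s => q (z s 1) * zs s 1)%C (fun s => q (z s 0) * zs s 0)%C) in G.
  2:{ lra. } 2:{ intros s _. unfold z, zs. rewrite circle_1, circle_0. reflexivity. }
  assert (E1 : CInt (fun t => q (z 1 t) * zt 1 t)%C 0 1 = CInt (fun t => q (z 0%R t) * zt 0%R t)%C 0 1).
  { match type of G with _ -> _ -> _ -> _ -> _ -> _ -> _ -> ?E => assert (GG : E) end.
    { apply G; clear G.
      - intros s t. unfold z, zs.
        replace (RtoC (1 - eps) * (circle t - a))%C with
          (0 + ((0 + RtoC (1 - eps) * 1) * (circle t - a) + lam s * 0))%C by ring.
        apply (deriv_along_plus RtoC (fun _ => a)); [apply deriv_along_const|].
        apply (deriv_along_mult RtoC lam (fun _ => (circle t - a)%C)); [apply Dlam|apply deriv_along_const].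
      - intros s t. unfold z, zt.
        replace (lam s * (w * circle t))%C with (0 + lam s * (w * circle t))%C by ring.
        apply (deriv_along_plus RtoC (fun _ => a)); [apply deriv_along_const|].
        apply deriv_along_scal, Dc.
      - intros s t. exists (RtoC 0). unfold zs. apply deriv_along_const.
      - intros s t. unfold zt. eexists. apply deriv_along_scal, deriv_along_scal, circle_pderiv.
      - intros s t Hs Ht. unfold zs. rewrite Cmod_mult, Cmod_R, Rabs_pos_eq by lra.
        assert (B : Cmod (circle t - a) <= 2).
        { eapply Rle_trans; [apply Cmod_sub_triangle|]. rewrite Cmod_circle. lra. }
        assert (B0 := Cmod_ge_0 (circle t - a)). nra.
      - intros s t Hs Ht. unfold zt. rewrite Elam, !Cmod_mult, Cmod_circle, Cmod_R, Rabs_pos_eq by nra.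
        assert (eps + (1 - eps) * s <= 1) by nra. assert (W0 := Cmod_ge_0 w). nra.
      - intros s t Hs Ht. unfold q.
        assert (Z1 : Cmod (z s t) <= 1).
        { unfold z. rewrite Elam. apply convex_disc_bound; auto using Cmod_circle. nra. }
        destruct (Hf (z s t)) as [l Hl]; [lra|]. eexists.
        apply deriv_along_div; [|exact Hl|].
        + unfold z. replace (a + lam s * (circle t - a) - a)%C with (lam s * (circle t - a))%C by ring.
          apply Cmult_neq_0; [|apply circle_sub_neq_0; auto].
          rewrite Elam. apply RtoC_neq_0 || (intros E; apply RtoC_inj in E; nra).
        + apply deriv_along_minus; [apply deriv_along_inc|apply deriv_along_const]. }
    clear G.
    set (X := CInt (fun s => q (z s 0) * zs s 0)%C 0 1) in GG.
    set (Y := CInt (fun t => q (z 1 t) * zt 1 t)%C 0 1) in *.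
    set (Z := CInt (fun t => q (z 0%R t) * zt 0%R t)%C 0 1) in *.
    replace Y with (X + Y - X - Z + Z)%C by ring. rewrite GG. ring. }
  assert (L1 : lam 1 = 1%C) by (rewrite Elam; f_equal; ring).
  assert (L0 : lam 0 = RtoC eps) by (rewrite Elam; f_equal; ring).
  assert (Heps0 : RtoC eps <> RtoC 0) by (intros E; apply RtoC_inj in E; lra).
  rewrite (CInt_ext _ (fun t => w * (f (circle t) * (circle t / (circle t - a))))%C) in E1.
  2:{ lra. }
  2:{ intros t _. unfold q, z, zt. rewrite L1.
      replace (a + 1 * (circle t - a))%C with (circle t) by ring.
      field. apply circle_sub_neq_0; auto. }
  rewrite (CInt_ext (fun t => q (z 0 t) * zt 0 t)%C
     (fun t => w * (f (a + RtoC eps * (circle t - a)) * (circle t / (circle t - a))))%C) in E1.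
  2:{ lra. }
  2:{ intros t _. unfold q, z, zt. rewrite L0.
      replace (a + eps * (circle t - a) - a)%C with (eps * (circle t - a))%C by ring.
      field. split; [apply circle_sub_neq_0; auto|auto]. }
  rewrite !CInt_scal in E1.
  - apply (f_equal (fun x => (/ w * x)%C)) in E1. rewrite !Cmult_assoc in E1.
    rewrite Cinv_l, !Cmult_1_l in E1 by auto. exact E1.
  - apply differentiable_ex_CInt. intros t _.
    destruct (Hf (a + eps * (circle t - a))%C) as [l Hl].
    { eapply Rle_lt_trans; [|exact Hr]. apply convex_disc_bound; auto using Cmod_circle; lra. }
    eexists. apply deriv_along_mult.
    + eapply deriv_along_comp; [exact Hl|].
      apply deriv_along_plus; [apply deriv_along_const|apply deriv_along_scal, Dc].
    + apply deriv_along_div; [apply circle_sub_neq_0; auto|apply circle_pderiv|apply Dc].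
  - apply differentiable_ex_CInt. intros t _. apply (cauchy_integrand_differentiable f r a t); auto.
Qed.

Lemma RtoC_neq (x y : R) : x <> y -> RtoC x <> RtoC y.
Proof. intros H E. apply H, RtoC_inj, E. Qed.

Lemma cauchy_kernel_bound a t : Cmod a < 1 -> Cmod (cauchy_kernel a t) <= / (1 - Cmod a).
Proof.
  intros Ha. unfold cauchy_kernel. rewrite Cmod_div by (apply circle_sub_neq_0; auto).
  rewrite Cmod_circle. unfold Rdiv. rewrite Rmult_1_l. apply Rinv_le_contravar; [lra|].
  apply circle_sub_bound.
Qed.

Lemma cauchy_kernel_pderiv a t : Cmod a < 1 -> exists l, pderiv (cauchy_kernel a) t l.
Proof.
  intros Ha. eexists. unfold cauchy_kernel.
  apply deriv_along_div; [apply circle_sub_neq_0; auto|apply circle_pderiv|].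
  apply deriv_along_minus; [apply circle_pderiv|apply deriv_along_const].
Qed.

Lemma small_bound_eq_0 (x K e0 : R) :
  0 < e0 -> 0 <= x -> (forall e, 0 < e < e0 -> x <= K * e) -> x = 0.
Proof.
  intros He Hx H. destruct (Req_dec x 0) as [E|E]; auto. exfalso.
  assert (HK : 0 <= Rabs K) by apply Rabs_pos.
  assert (HK' := Rle_abs K).
  set (e := Rmin (e0 / 2) (x / (2 * (Rabs K + 1)))).
  assert (0 < e).
  { apply Rmin_glb_lt; [lra|apply Rdiv_lt_0_compat; lra]. }
  assert (e <= e0 / 2) by apply Rmin_l.
  assert (e <= x / (2 * (Rabs K + 1))) by apply Rmin_r.
  specialize (H e ltac:(lra)).
  assert ((Rabs K + 1) * e <= x / 2).
  { apply Rle_trans with ((Rabs K + 1) * (x / (2 * (Rabs K + 1)))).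
    - apply Rmult_le_compat_l; lra.
    - right; field; lra. }
  nra.
Qed.

(** Shrinking the circle to [a] leaves [f a] times the integral of the kernel itself. *)
Lemma cauchy_integral_up_to_kernel f r a : 1 < r -> differentiable_disc r f -> Cmod a < 1 ->
  CInt (fun t => f (circle t) * cauchy_kernel a t)%C 0 1 = (f a * CInt (cauchy_kernel a) 0 1)%C.
Proof.
  intros Hr Hf Ha.
  destruct (Hf a) as [l Hl]; [lra|].
  destruct (deriv_along_lipschitz (fun z => z) f a l Hl) as [d [Hd Lip]].
  set (J := CInt (fun t => f (circle t) * cauchy_kernel a t)%C 0 1).
  assert (EK : ex_CInt (cauchy_kernel a) 0 1).
  { apply differentiable_ex_CInt. intros; apply cauchy_kernel_pderiv; auto. }
  assert (Z : Cmod (J - f a * CInt (cauchy_kernel a) 0 1)%C = 0).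
  { apply small_bound_eq_0 with ((Cmod l + 1) * 2 * / (1 - Cmod a)) (Rmin 1 (d / 2)).
    - apply Rmin_glb_lt; lra.
    - apply Cmod_ge_0.
    - intros e [He1 He2].
      assert (e < 1) by (eapply Rlt_le_trans; [exact He2|apply Rmin_l]).
      assert (e < d / 2) by (eapply Rlt_le_trans; [exact He2|apply Rmin_r]).
      unfold J. rewrite (cauchy_homotopy f r a e) by auto.
      assert (ES : ex_CInt (fun t => f (a + RtoC e * (circle t - a)) * cauchy_kernel a t)%C 0 1).
      { apply differentiable_ex_CInt. intros t _.
        destruct (Hf (a + e * (circle t - a))%C) as [m Hm].
        { eapply Rle_lt_trans; [|exact Hr]. apply convex_disc_bound; auto using Cmod_circle; lra. }
        destruct (cauchy_kernel_pderiv a t Ha) as [n Hn].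
        eexists. apply deriv_along_mult; [|exact Hn].
        eapply deriv_along_comp; [exact Hm|].
        apply deriv_along_plus; [apply deriv_along_const|apply deriv_along_scal].
        apply deriv_along_minus; [apply circle_pderiv|apply deriv_along_const]. }
      assert (EC : ex_CInt (fun t => f a * cauchy_kernel a t)%C 0 1).
      { apply differentiable_ex_CInt. intros t _.
        destruct (cauchy_kernel_pderiv a t Ha) as [n Hn]. eexists. apply deriv_along_scal; eauto. }
      rewrite <- CInt_scal by auto.
      rewrite <- CInt_minus by auto.
      replace ((Cmod l + 1) * 2 * / (1 - Cmod a) * e) with
        ((1 - 0) * ((Cmod l + 1) * (2 * e) * / (1 - Cmod a))) by ring.
      apply CInt_bound; [lra|apply ex_CInt_minus; auto|].
      intros t _.
      replace (f (a + e * (circle t - a)) * cauchy_kernel a t - f a * cauchy_kernel a t)%C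
        with ((f (a + e * (circle t - a)) - f a) * cauchy_kernel a t)%C by ring.
      rewrite Cmod_mult.
      assert (S : Cmod (a + e * (circle t - a) - a)%C <= 2 * e).
      { replace (a + e * (circle t - a) - a)%C with (e * (circle t - a))%C by ring.
        rewrite Cmod_mult, Cmod_R, Rabs_pos_eq by lra.
        assert (Cmod (circle t - a) <= 2).
        { eapply Rle_trans; [apply Cmod_sub_triangle|]. rewrite Cmod_circle. lra. }
        nra. }
      apply Rmult_le_compat; auto using Cmod_ge_0.
      + eapply Rle_trans; [apply Lip; lra|].
        apply Rmult_le_compat_l; auto. assert (L0 := Cmod_ge_0 l). lra.
      + apply cauchy_kernel_bound; auto. }
  apply Cmod_eq_0 in Z.
  replace J with (J - f a * CInt (cauchy_kernel a) 0 1 + f a * CInt (cauchy_kernel a) 0 1)%C by ring.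
  rewrite Z. ring.
Qed.

Lemma CInt_cauchy_kernel_0 : CInt (cauchy_kernel 0) 0 1 = 1%C.
Proof.
  rewrite (CInt_ext _ (fun _ => 1%C)).
  2:{ lra. }
  2:{ intros t _; unfold cauchy_kernel. replace (circle t - 0)%C with (circle t) by ring.
      apply Cinv_r, circle_neq_0. }
  rewrite (CInt_derive RtoC (fun _ => 1%C)).
  - ring.
  - intros t _. apply deriv_along_inc.
  - intros t _. eexists. apply deriv_along_const.
Qed.

Lemma mean_value f r : 1 < r -> differentiable_disc r f -> CInt (fun t => f (circle t)) 0 1 = f (RtoC 0).
Proof.
  intros Hr Hf.
  rewrite (CInt_ext _ (fun t => f (circle t) * cauchy_kernel 0 t)%C).
  - rewrite (cauchy_integral_up_to_kernel f r), CInt_cauchy_kernel_0; auto; [ring|].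
    rewrite Cmod_0; lra.
  - lra.
  - intros t _. unfold cauchy_kernel. replace (circle t - 0)%C with (circle t) by ring.
    field. apply circle_neq_0.
Qed.

(** The conjugate of the Cauchy kernel is the boundary value of [1 / (1 - conj a z)], to which the
    mean value property applies. *)
Lemma CInt_cauchy_kernel a : Cmod a < 1 -> CInt (cauchy_kernel a) 0 1 = 1%C.
Proof.
  intros Ha. assert (A0 := Cmod_ge_0 a).
  assert (EK : ex_CInt (cauchy_kernel a) 0 1).
  { apply differentiable_ex_CInt. intros; apply cauchy_kernel_pderiv; auto. }
  assert (E : Cconj (CInt (cauchy_kernel a) 0 1) = 1%C).
  { rewrite <- CInt_conj by auto.
    set (u := fun z : C => (/ (1 - Cconj a * z))%C).
    rewrite (CInt_ext _ (fun t => u (circle t))).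
    - rewrite (mean_value u (2 / (1 + Cmod a))).
      + unfold u. replace (1 - Cconj a * 0)%C with (RtoC 1) by ring. field.
      + apply Rmult_lt_reg_r with (1 + Cmod a); [lra|]. unfold Rdiv. rewrite Rmult_assoc, Rinv_l; lra.
      + intros z Hz. eexists. unfold u. apply deriv_along_inv.
        * intros E. 
          assert (E2 : Cmod (Cconj a * z) = 1).
          { replace (Cconj a * z)%C with (1 - (1 - Cconj a * z))%C by ring. rewrite E.
            replace (1 - 0)%C with (RtoC 1) by ring. apply Cmod_1. }
          rewrite Cmod_mult, Cmod_conj in E2.
          assert (B : (1 + Cmod a) * (2 / (1 + Cmod a)) = 2) by (field; lra).
          assert (Z0 := Cmod_ge_0 z). nra.
        * apply deriv_along_minus; [apply deriv_along_const|]. apply deriv_along_scal, deriv_along_inc.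
    - lra.
    - intros t _. unfold cauchy_kernel, u.
      assert (N := circle_sub_neq_0 t a Ha). assert (N0 := circle_neq_0 t).
      unfold Cdiv. rewrite Cmult_conj, Cinv_conj by auto. rewrite Cminus_conj, Cconj_circle.
      assert (N2 : (1 - Cconj a * circle t)%C <> 0).
      { intros E. apply N. rewrite <- (Cconj_conj (circle t - a)), Cminus_conj, Cconj_circle.
        replace (/ circle t - Cconj a)%C with ((1 - Cconj a * circle t) * / circle t)%C by (field; auto).
        rewrite E. rewrite Cmult_0_l. apply injective_projections; simpl; ring. }
      field. repeat split; auto. }
  rewrite <- (Cconj_conj (CInt _ _ _)), E. apply injective_projections; simpl; ring.
Qed.

Theorem cauchy_formula f r a : 1 < r -> differentiable_disc r f -> Cmod a < 1 ->
  CInt (fun t => f (circle t) * cauchy_kernel a t)%C 0 1 = f a.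
Proof.
  intros Hr Hf Ha. rewrite (cauchy_integral_up_to_kernel f r), CInt_cauchy_kernel; auto. ring.
Qed.

(** Cauchy's formula alone loses the factor [1 / (1 - |a|)]. Applied to [f ^ n] it loses the
    [n]-th root of that factor, which tends to 1. *)
Lemma maximum_principle f r a M : 1 < r -> differentiable_disc r f -> Cmod a < 1 -> 0 < M ->
  (forall t, 0 <= t <= 1 -> Cmod (f (circle t)) <= M) -> Cmod (f a) <= M.
Proof.
  intros Hr Hf Ha HM Hb.
  assert (P : forall n, Cmod (f a) ^ n <= M ^ n * / (1 - Cmod a)).
  { intros n. set (g := fun z => (f z ^ n)%C).
    assert (Hg : differentiable_disc r g).
    { intros z Hz. destruct (Hf z Hz) as [l Hl]. eapply deriv_along_pow; eauto. }
    rewrite <- Cmod_pow. change (f a ^ n)%C with (g a). rewrite <- (cauchy_formula g r a) by auto.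
    replace (M ^ n * / (1 - Cmod a)) with ((1 - 0) * (M ^ n * / (1 - Cmod a))) by ring.
    apply CInt_bound; [lra| |].
    - apply differentiable_ex_CInt. intros t _.
      apply (cauchy_integrand_differentiable g r a t); auto.
    - intros t Ht. rewrite Cmod_mult. apply Rmult_le_compat; auto using Cmod_ge_0, cauchy_kernel_bound.
      unfold g. rewrite Cmod_pow. apply pow_incr. split; auto using Cmod_ge_0. }
  apply Rnot_lt_le. intros Hlt.
  set (q := Cmod (f a) / M).
  assert (Hq : 1 < q).
  { unfold q. apply Rmult_lt_reg_r with M; auto. unfold Rdiv. rewrite Rmult_assoc, Rinv_l; lra. }
  destruct (Pow_x_infinity q) with (b := / (1 - Cmod a) + 1) as [N HN].
  { rewrite Rabs_pos_eq; lra. }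
  specialize (HN N (le_n _)). rewrite Rabs_pos_eq in HN by (apply pow_le; lra).
  specialize (P N).
  assert (E : q ^ N * M ^ N = Cmod (f a) ^ N).
  { rewrite <- Rpow_mult_distr. f_equal. unfold q. field. lra. }
  assert (MN : 0 < M ^ N) by (apply pow_lt; auto).
  nra.
Qed.

(** * Taylor polynomials and the Schwarz-Pick lemma *)

Fixpoint cpoly (c : nat -> C) (N : nat) (z : C) : C :=
  match N with
  | O => RtoC 0
  | S n => (cpoly c n z + c n * z ^ n)%C
  end.

Definition taylor_coef (f : C -> C) (n : nat) : C := CInt (fun t => f (circle t) * / circle t ^ n)%C 0 1.

Lemma circle_pow_neq_0 t n : (circle t ^ n)%C <> RtoC 0.
Proof. apply Cpow_nz, circle_neq_0. Qed.

(** Obtained by expanding the Cauchy kernel as a finite geometric sum with remainder. *)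
Lemma taylor_remainder f r M : 1 < r -> differentiable_disc r f ->
  (forall t, 0 <= t <= 1 -> Cmod (f (circle t)) <= M) ->
  forall N a, Cmod a < 1 ->
  Cmod (f a - cpoly (taylor_coef f) N a)%C <= Cmod a ^ N * (M / (1 - Cmod a)).
Proof.
  intros Hr Hf HM N a Ha.
  assert (Dn : forall n t, exists l, pderiv (fun t => f (circle t) * / circle t ^ n)%C t l).
  { intros n t. destruct (Hf (circle t)) as [l Hl]; [rewrite Cmod_circle; auto|].
    destruct (deriv_along_pow RtoC circle t _ n (circle_pderiv t)) as [m Hm].
    eexists. apply deriv_along_mult.
    - eapply deriv_along_comp; [exact Hl|apply circle_pderiv].
    - apply deriv_along_inv; [apply circle_pow_neq_0|exact Hm]. }
  assert (Dk : forall n t, exists l, pderiv (fun t => f (circle t) * / circle t ^ n * cauchy_kernel a t)%C t l).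
  { intros n t. destruct (Dn n t) as [l Hl]. destruct (cauchy_kernel_pderiv a t Ha) as [m Hm].
    eexists. apply deriv_along_mult; [exact Hl|exact Hm]. }
  set (rem := fun n => CInt (fun t => f (circle t) * / circle t ^ n * cauchy_kernel a t)%C 0 1).
  assert (E : forall n, (f a - cpoly (taylor_coef f) n a)%C = (a ^ n * rem n)%C).
  { induction n as [|n IH].
    - simpl. unfold rem. rewrite <- (cauchy_formula f r a) by auto.
      rewrite (CInt_ext (fun t => f (circle t) * / circle t ^ 0 * cauchy_kernel a t)%C
        (fun t => f (circle t) * cauchy_kernel a t)%C); [ring|lra|].
      intros t _. simpl. field.
    - simpl cpoly.
      replace (f a - (cpoly (taylor_coef f) n a + taylor_coef f n * a ^ n))%C
        with ((f a - cpoly (taylor_coef f) n a) - taylor_coef f n * a ^ n)%C by ring.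
      rewrite IH.
      assert (ER : rem n = (taylor_coef f n + a * rem (S n))%C).
      { unfold rem, taylor_coef. rewrite <- CInt_scal by (apply differentiable_ex_CInt; intros; apply Dk).
        rewrite <- CInt_plus.
        - apply CInt_ext; [lra|]. intros t _. unfold cauchy_kernel. simpl.
          assert (N0 := circle_neq_0 t). assert (N1 := circle_sub_neq_0 t a Ha).
          assert (N2 := circle_pow_neq_0 t n). field. auto.
        - apply differentiable_ex_CInt; intros; apply Dn.
        - apply differentiable_ex_CInt; intros t _. destruct (Dk (S n) t) as [l Hl].
          eexists. apply deriv_along_scal. exact Hl. }
      rewrite ER. simpl. ring. }
  rewrite E, Cmod_mult, Cmod_pow. apply Rmult_le_compat_l; [apply pow_le, Cmod_ge_0|].
  replace (M / (1 - Cmod a)) with ((1 - 0) * (M * / (1 - Cmod a))) by (unfold Rdiv; ring).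
  apply CInt_bound; [lra|apply differentiable_ex_CInt; intros; apply Dk|].
  intros t Ht. rewrite Cmod_mult. apply Rmult_le_compat; auto using Cmod_ge_0, cauchy_kernel_bound.
  rewrite Cmod_mult, Cmod_inv, Cmod_pow, Cmod_circle, pow1, Rinv_1, Rmult_1_r by apply circle_pow_neq_0.
  auto.
Qed.

Lemma taylor_coef_0 f r : 1 < r -> differentiable_disc r f -> taylor_coef f 0 = f (RtoC 0).
Proof.
  intros Hr Hf. rewrite <- (mean_value f r) by auto. apply CInt_ext; [lra|].
  intros t _. simpl. field.
Qed.

Lemma taylor_coef_1 f r M l : 1 < r -> differentiable_disc r f ->
  (forall t, 0 <= t <= 1 -> Cmod (f (circle t)) <= M) -> cderiv f (RtoC 0) l -> taylor_coef f 1 = l.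
Proof.
  intros Hr Hf HM Hl.
  assert (HM0 : 0 <= M) by (eapply Rle_trans; [apply Cmod_ge_0|apply (HM 0); lra]).
  assert (Z : Cmod (taylor_coef f 1 - l)%C = 0).
  { apply small_bound_eq_0 with 1 1; [lra|apply Cmod_ge_0|].
    intros e [He1 He2]. rewrite Rmult_1_l.
    destruct (Hl (e / 2)) as [d [Hd H]]; [lra|].
    set (x := Rmin (1 / 2) (Rmin (d / 2) (e / (4 * (M + 1))))).
    assert (X0 : 0 < x).
    { repeat apply Rmin_glb_lt; try lra. apply Rdiv_lt_0_compat; lra. }
    assert (X1 : x <= 1 / 2) by apply Rmin_l.
    assert (X2 : x <= d / 2) by (eapply Rle_trans; [apply Rmin_r|apply Rmin_l]).
    assert (X3 : x <= e / (4 * (M + 1))) by (eapply Rle_trans; [apply Rmin_r|apply Rmin_r]).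
    assert (Cx : Cmod (RtoC x) = x) by (rewrite Cmod_R, Rabs_pos_eq; lra).
    specialize (H (RtoC x)). replace (RtoC x - 0)%C with (RtoC x) in H by ring.
    rewrite Cx in H. specialize (H ltac:(lra)).
    assert (T := taylor_remainder f r M Hr Hf HM 2 (RtoC x) ltac:(lra)).
    simpl cpoly in T. rewrite (taylor_coef_0 f r Hr Hf), Cx in T.
    assert (B : x * Cmod (taylor_coef f 1 - l)%C <= x * e).
    { rewrite <- Cx at 1. rewrite <- Cmod_mult.
      replace (RtoC x * (taylor_coef f 1 - l))%C with
        ((f x - f 0 - l * x) - (f x - (0 + f 0 * 1 + taylor_coef f 1 * (x * 1))))%C by ring.
      eapply Rle_trans; [apply Cmod_sub_triangle|].
      assert (M / (1 - x) <= 2 * (M + 1)).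
      { apply Rmult_le_reg_r with (1 - x); [lra|]. unfold Rdiv. rewrite Rmult_assoc, Rinv_l by lra. nra. }
      assert (x * (2 * (M + 1)) <= e / 2).
      { apply Rle_trans with (e / (4 * (M + 1)) * (2 * (M + 1))); [apply Rmult_le_compat_r; lra|].
        right; field; lra. }
      assert (x ^ 2 * (M / (1 - x)) <= x * (e / 2)).
      { simpl. rewrite Rmult_1_r, Rmult_assoc. apply Rmult_le_compat_l; [lra|].
        eapply Rle_trans; [|eassumption]. apply Rmult_le_compat_l; lra. }
      lra. }
    nra. }
  apply Cmod_eq_0 in Z. replace (taylor_coef f 1) with (taylor_coef f 1 - l + l)%C by ring.
  rewrite Z. ring.
Qed.

Lemma derivative_bound f r M l : 1 < r -> differentiable_disc r f ->
  (forall t, 0 <= t <= 1 -> Cmod (f (circle t)) <= M) -> cderiv f (RtoC 0) l -> Cmod l <= M.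
Proof.
  intros Hr Hf HM Hl. rewrite <- (taylor_coef_1 f r M l) by auto.
  unfold taylor_coef. replace M with ((1 - 0) * M) by ring.
  apply CInt_bound; [lra| |].
  - apply differentiable_ex_CInt. intros t _.
    destruct (Hf (circle t)) as [m Hm]; [rewrite Cmod_circle; auto|].
    destruct (deriv_along_pow RtoC circle t _ 1 (circle_pderiv t)) as [n Hn].
    eexists. apply deriv_along_mult.
    + eapply deriv_along_comp; [exact Hm|apply circle_pderiv].
    + apply deriv_along_inv; [apply circle_pow_neq_0|exact Hn].
  - intros t Ht. rewrite Cmod_mult, Cmod_inv, Cmod_pow, Cmod_circle, pow1, Rinv_1, Rmult_1_r
      by apply circle_pow_neq_0. auto.
Qed.

Lemma mobius_identity (u v : C) :
  Cmod (1 - Cconj v * u)%C ^ 2 - Cmod (u - v)%C ^ 2 = (1 - Cmod u ^ 2) * (1 - Cmod v ^ 2).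
Proof. rewrite !Cmod2_alt. destruct u as [a b], v as [c d]. simpl. ring. Qed.

Lemma mobius_bound (u v : C) : Cmod u < 1 -> Cmod v < 1 ->
  (1 - Cconj v * u)%C <> RtoC 0 /\ Cmod ((u - v) / (1 - Cconj v * u))%C <= 1.
Proof.
  intros Hu Hv. assert (U := Cmod_ge_0 u). assert (V := Cmod_ge_0 v).
  assert (H := mobius_identity u v).
  assert (P : 0 <= (1 - Cmod u ^ 2) * (1 - Cmod v ^ 2)) by (apply Rmult_le_pos; nra).
  assert (D : 0 < Cmod (1 - Cconj v * u)%C).
  { eapply Rlt_le_trans; [|apply Cmod_sub_rev]. rewrite Cmod_1, Cmod_mult, Cmod_conj. nra. }
  split; [apply Cmod_gt_0; auto|].
  rewrite Cmod_div by (apply Cmod_gt_0; auto).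
  apply Rmult_le_reg_r with (Cmod (1 - Cconj v * u)); auto.
  unfold Rdiv. rewrite Rmult_assoc, Rinv_l, Rmult_1_r, Rmult_1_l by lra.
  assert (N := Cmod_ge_0 (u - v)). nra.
Qed.

Lemma differentiable_disc_scale f (r s : R) : 0 < s -> differentiable_disc r f ->
  differentiable_disc (r / s) (fun z => f (RtoC s * z)%C).
Proof.
  intros Hs Hf z Hz.
  destruct (Hf (s * z)%C) as [l Hl].
  { rewrite Cmod_mult, Cmod_R, Rabs_pos_eq by lra.
    apply Rlt_le_trans with (s * (r / s)); [apply Rmult_lt_compat_l; auto|right; field; lra]. }
  eexists. eapply (deriv_along_comp (fun z => z) f); [exact Hl|].
  apply deriv_along_scal, deriv_along_inc.
Qed.

Lemma cderiv_scale f (s : R) l : cderiv f (RtoC 0) l ->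
  cderiv (fun z => f (RtoC s * z)%C) (RtoC 0) (RtoC s * l)%C.
Proof.
  intros Hl. replace (s * l)%C with (l * (s * 1))%C by ring.
  apply (deriv_along_comp (fun z => z) f (fun z => s * z)%C).
  - replace (s * 0)%C with (RtoC 0) by ring. exact Hl.
  - apply deriv_along_scal, deriv_along_inc.
Qed.

(** The Moebius transformation that sends [k 0] to 0 reduces the inequality to the Cauchy estimate
    for the derivative. The factor [eta] inside and outside keeps the denominator away from 0. *)
Lemma schwarz_pick k r l : 1 < r -> differentiable_disc r k ->
  (forall t, 0 <= t <= 1 -> Cmod (k (circle t)) <= 1) -> cderiv k (RtoC 0) l ->
  Cmod l <= 1 - Cmod (k (RtoC 0)) ^ 2.
Proof.
  intros Hr Hk Hb Hl.
  assert (Step : forall eta, 0 < eta < 1 -> eta ^ 2 * (Cmod l + Cmod (k (RtoC 0)) ^ 2) <= 1).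
  { intros eta [E0 E1].
    set (u := fun z => (RtoC eta * k (RtoC eta * z))%C).
    assert (Au : Cmod (RtoC eta) = eta) by (rewrite Cmod_R, Rabs_pos_eq; lra).
    assert (Hin : forall z, Cmod z < 1 / eta -> Cmod (RtoC eta * z) < 1).
    { intros z Hz. rewrite Cmod_mult, Au.
      apply Rlt_le_trans with (eta * (1 / eta)); [apply Rmult_lt_compat_l; auto|right; field; lra]. }
    assert (Hu : forall z, Cmod z < 1 / eta -> Cmod (u z) < 1).
    { intros z Hz. unfold u. rewrite Cmod_mult, Au.
      assert (Cmod (k (RtoC eta * z)%C) <= 1).
      { apply maximum_principle with r; auto. lra. }
      nra. }
    assert (R1 : 1 < 1 / eta).
    { apply Rmult_lt_reg_r with eta; auto. unfold Rdiv. rewrite Rmult_assoc, Rinv_l; lra. }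
    assert (U0 : Cmod (u (RtoC 0)) < 1) by (apply Hu; rewrite Cmod_0; lra).
    assert (Du : differentiable_disc (1 / eta) u).
    { intros z Hz. destruct (Hk (RtoC eta * z)%C) as [m Hm]; [specialize (Hin z Hz); lra|].
      eexists. apply deriv_along_scal. eapply (deriv_along_comp (fun z => z) k); [exact Hm|].
      apply deriv_along_scal, deriv_along_inc. }
    set (v := u (RtoC 0)).
    set (G := fun z => ((u z - v) / (1 - Cconj v * u z))%C).
    assert (DG : forall z m, Cmod z < 1 / eta -> cderiv u z m -> 
      cderiv G z (((m - 0) * (1 - Cconj v * u z) - (u z - v) * (0 - Cconj v * m)) /
                  ((1 - Cconj v * u z) * (1 - Cconj v * u z)))%C).
    { intros z m Hz Hm. unfold G.
      apply (deriv_along_div (fun z => z) (fun z => u z - v)%C (fun z => 1 - Cconj v * u z)%C).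
      - exact (proj1 (mobius_bound (u z) v (Hu z Hz) U0)).
      - apply deriv_along_minus; [exact Hm|apply deriv_along_const].
      - apply deriv_along_minus; [apply deriv_along_const|apply deriv_along_scal, Hm]. }
    assert (DG0 := DG (RtoC 0) (RtoC eta * (RtoC eta * l))%C).
    assert (B := derivative_bound G (1 / eta) 1 _ R1
       (fun z Hz => let (m, Hm) := Du z Hz in ex_intro _ _ (DG z m Hz Hm))
       (fun t _ => proj2 (mobius_bound _ _ (Hu (circle t) ltac:(rewrite Cmod_circle; exact R1)) U0))
       (DG0 ltac:(rewrite Cmod_0; lra) (deriv_along_scal _ _ _ _ _ (cderiv_scale k eta l Hl)))).
    clear DG DG0. fold v in B.
    assert (V2 : (1 - Cconj v * v)%C = RtoC (1 - Cmod v ^ 2)).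
    { rewrite RtoC_minus, Cmod2_conj. ring. }
    rewrite V2 in B.
    replace ((eta * (eta * l) - 0) * RtoC (1 - Cmod v ^ 2) - (v - v) * (0 - Cconj v * (eta * (eta * l))))%C
      with (RtoC eta * (RtoC eta * l) * RtoC (1 - Cmod v ^ 2))%C in B by ring.
    assert (V0 := Cmod_ge_0 v).
    assert (VP : 0 < 1 - Cmod v ^ 2) by (change (Cmod v < 1) in U0; nra).
    assert (VN : RtoC (1 - Cmod v ^ 2) <> RtoC 0) by (apply RtoC_neq; lra).
    rewrite Cmod_div in B by (apply Cmult_neq_0; auto).
    rewrite !Cmod_mult, Au, !(Cmod_R (1 - _)), Rabs_pos_eq in B by lra.
    assert (Ev : Cmod v = eta * Cmod (k (RtoC 0))).
    { unfold v, u. rewrite Cmod_mult, Au. do 3 f_equal. ring. }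
    assert (B2 : eta * (eta * Cmod l) <= 1 - Cmod v ^ 2).
    { apply Rmult_le_reg_r with (1 - Cmod v ^ 2); auto.
      replace (eta * (eta * Cmod l) * (1 - Cmod v ^ 2)) with
       (eta * (eta * Cmod l) * (1 - Cmod v ^ 2) / ((1 - Cmod v ^ 2) * (1 - Cmod v ^ 2)) * ((1 - Cmod v ^ 2) * (1 - Cmod v ^ 2)))
       by (field; lra).
      eapply Rle_trans; [apply Rmult_le_compat_r; [|exact B]; nra|]. lra. }
    rewrite Ev in B2. nra. }
  apply Rnot_lt_le. intros Hlt. set (S := Cmod l + Cmod (k (RtoC 0)) ^ 2) in *.
  assert (HS : 1 < S) by (unfold S; lra).
  assert (Hs : 1 < sqrt S) by (rewrite <- sqrt_1; apply sqrt_lt_1; lra).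
  assert (SS : sqrt S * sqrt S = S) by (apply sqrt_sqrt; lra).
  (* [e < 1] and [e^2 S > 1] *)
  set (e := (1 + / sqrt S) / 2).
  assert (I1 : / sqrt S * sqrt S = 1) by (apply Rinv_l; lra).
  assert (I0 : 0 < / sqrt S) by (apply Rinv_0_lt_compat; lra).
  assert (I2 : / sqrt S < 1) by nra.
  specialize (Step e ltac:(unfold e; lra)).
  assert (e * sqrt S > 1) by (unfold e; nra).
  nra.
Qed.

Lemma differentiable_path_bounded (g : R -> C) : (forall t, 0 <= t <= 1 -> exists l, pderiv g t l) ->
  exists t0, 0 <= t0 <= 1 /\ forall t, 0 <= t <= 1 -> Cmod (g t) <= Cmod (g t0).
Proof.
  intros H.
  destruct (continuity_ab_maj (fun t => Cmod (g t)) 0 1) as [t0 [H1 H2]]; [lra| |].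
  - intros t Ht eps He. destruct (H t Ht) as [l Hl].
    destruct (deriv_along_lipschitz RtoC g t l Hl) as [d [Hd L]].
    assert (L0 := Cmod_ge_0 l).
    exists (Rmin d (eps / (Cmod l + 2))); split.
    { apply Rmin_glb_lt; auto. apply Rdiv_lt_0_compat; lra. }
    intros w [_ Hw]. simpl in *. unfold R_dist in *.
    assert (W1 := Rlt_le_trans _ _ _ Hw (Rmin_l _ _)). assert (W2 := Rlt_le_trans _ _ _ Hw (Rmin_r _ _)).
    specialize (L w). rewrite <- RtoC_minus, Cmod_R in L. specialize (L W1).
    assert (B : Rabs (Cmod (g w) - Cmod (g t)) <= Cmod (g w - g t)).
    { apply Rabs_le. split; [|apply Cmod_sub_rev].
      assert (X := Cmod_sub_rev (g t) (g w)).
      replace (g t - g w)%C with (- (g w - g t))%C in X by ring. rewrite Cmod_opp in X. lra. }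
    eapply Rle_lt_trans; [exact B|]. eapply Rle_lt_trans; [exact L|].
    assert (X : (Cmod l + 2) * (eps / (Cmod l + 2)) = eps) by (field; lra).
    assert (P := Rabs_pos (w - t)). nra.
  - exists t0; split; auto.
Qed.

Lemma differentiable_on_circle f r t : 1 < r -> differentiable_disc r f ->
  exists l, pderiv (fun t => f (circle t)) t l.
Proof.
  intros Hr Hf. destruct (Hf (circle t)) as [l Hl]; [rewrite Cmod_circle; auto|].
  eexists. eapply deriv_along_comp; [exact Hl|apply circle_pderiv].
Qed.

Lemma cpoly_scale c (s : R) N z : cpoly c N (RtoC s * z)%C = cpoly (fun n => c n * RtoC s ^ n)%C N z.
Proof. induction N as [|N IH]; simpl; auto. rewrite IH, Cpow_mult_l. ring. Qed.

(** The Taylor polynomials are taken on a larger circle, so that the remainder decays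
    geometrically on the closed unit disc. *)
Lemma taylor_approximation f r l eps : 1 < r -> differentiable_disc r f ->
  cderiv f (RtoC 0) l -> 0 < eps ->
  exists (c : nat -> C) (N : nat), c 0%nat = f (RtoC 0) /\ c 1%nat = l /\
    forall z, Cmod z <= 1 -> Cmod (f z - cpoly c (S (S N)) z)%C <= eps.
Proof.
  intros Hr Hf Hl Heps.
  set (s := (1 + r) / 2). assert (Hs : 1 < s < r) by (unfold s; lra).
  set (g := fun z => f (RtoC s * z)%C).
  assert (Dg : differentiable_disc (r / s) g) by (apply differentiable_disc_scale; auto; lra).
  assert (Hrs : 1 < r / s).
  { apply Rmult_lt_reg_r with s; [lra|]. unfold Rdiv. rewrite Rmult_assoc, Rinv_l; lra. }
  destruct (differentiable_path_bounded (fun t => g (circle t))) as [t0 [_ HM]].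
  { intros t _. eapply differentiable_on_circle; eauto. }
  set (M := Cmod (g (circle t0))) in *.
  assert (M0 : 0 <= M) by apply Cmod_ge_0.
  assert (Is : 0 < / s < 1).
  { split; [apply Rinv_0_lt_compat; lra|]. rewrite <- Rinv_1. apply Rinv_lt_contravar; lra. }
  destruct (pow_lt_1_zero (/ s)) with (y := eps * (1 - / s) / (M + 1)) as [N HN].
  { rewrite Rabs_pos_eq; lra. }
  { apply Rdiv_lt_0_compat; nra. }
  exists (fun n => taylor_coef g n * RtoC (/ s) ^ n)%C, N.
  assert (Es : (RtoC s * RtoC (/ s))%C = 1%C) by (rewrite <- RtoC_mult, Rinv_r; auto; lra).
  split; [|split].
  - rewrite (taylor_coef_0 g (r / s)) by auto. unfold g. simpl.
    replace (s * 0)%C with (RtoC 0) by ring. ring.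
  - rewrite (taylor_coef_1 g (r / s) M (s * l)%C) by (auto; apply cderiv_scale; auto). simpl.
    replace (s * l * (RtoC (/ s) * 1))%C with (s * RtoC (/ s) * l)%C by ring. rewrite Es. ring.
  - intros z Hz. rewrite <- cpoly_scale.
    replace (f z) with (g (RtoC (/ s) * z)%C).
    2:{ unfold g. f_equal. rewrite Cmult_assoc, Es. ring. }
    assert (Az : Cmod (RtoC (/ s) * z) <= / s).
    { rewrite Cmod_mult, Cmod_R, Rabs_pos_eq by lra. nra. }
    eapply Rle_trans; [apply (taylor_remainder g (r / s) M); auto; lra|].
    specialize (HN (S (S N)) ltac:(lia)). rewrite Rabs_pos_eq in HN by (apply pow_le; lra).
    assert (A0 := Cmod_ge_0 (RtoC (/ s) * z)).
    apply Rle_trans with ((/ s) ^ (S (S N)) * (M / (1 - / s))).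
    + apply Rmult_le_compat; [apply pow_le; auto| |apply pow_incr; auto|].
      * apply Rmult_le_pos; [auto|apply Rlt_le, Rinv_0_lt_compat; lra].
      * apply Rmult_le_compat_l; auto. apply Rinv_le_contravar; lra.
    + apply Rle_trans with (eps * (1 - / s) / (M + 1) * (M / (1 - / s))).
      * apply Rmult_le_compat_r; [|lra].
        apply Rmult_le_pos; [auto|apply Rlt_le, Rinv_0_lt_compat; lra].
      * replace (eps * (1 - / s) / (M + 1) * (M / (1 - / s))) with (eps * (M / (M + 1))) by (field; lra).
        rewrite <- (Rmult_1_r eps) at 2. apply Rmult_le_compat_l; [lra|].
        apply Rmult_le_reg_r with (M + 1); [lra|]. unfold Rdiv. rewrite Rmult_assoc, Rinv_l; lra.
Qed.

(** * The necessary condition on the 1-jet of a disc *)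

(** For the polynomial [p] with coefficients [c 0], ..., [c n] this is [z^n conj (p (1 / conj z))];
    on the unit circle it equals [z^n conj (p z)]. *)
Fixpoint reflected (c : nat -> C) (n : nat) (z : C) : C :=
  match n with
  | O => Cconj (c O)
  | S k => (z * reflected c k z + Cconj (c (S k)))%C
  end.

(** The polynomial [|c_0|^2 + ... + |c_n|^2 + 2 (m_1 z + m_2 z^2 + ...)], where [m_j] is the sum
    of the [conj (c_k) c_(k+j)]. It is built by adding one coefficient at a time, which avoids the
    double sum. *)
Fixpoint completion (c : nat -> C) (n : nat) (z : C) : C :=
  match n with
  | O => RtoC (Cmod (c O) ^ 2)
  | S k => (completion c k z + (RtoC (Cmod (c (S k)) ^ 2) + 2 * c (S k) * (z * reflected c k z)))%C
  end.

Fixpoint sum_sqr (c : nat -> C) (n : nat) : R :=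
  match n with O => Cmod (c O) ^ 2 | S k => sum_sqr c k + Cmod (c (S k)) ^ 2 end.

Fixpoint sum_shift (c : nat -> C) (n : nat) : C :=
  match n with O => RtoC 0 | S k => (sum_shift c k + Cconj (c k) * c (S k))%C end.

Lemma reflected_0 c n : reflected c n (RtoC 0) = Cconj (c n).
Proof. destruct n; simpl; auto. ring. Qed.

Lemma completion_0 c n : completion c n (RtoC 0) = RtoC (sum_sqr c n).
Proof.
  induction n as [|n IH]; simpl completion; simpl sum_sqr; auto.
  rewrite IH, RtoC_plus. ring.
Qed.

Lemma reflected_differentiable c n z : exists l, cderiv (reflected c n) z l.
Proof.
  induction n as [|n [l IH]]; simpl.
  - eexists. apply deriv_along_const.
  - eexists. apply deriv_along_plus; [|apply deriv_along_const].
    apply (deriv_along_mult (fun z => z) (fun z => z)); [apply deriv_along_inc|exact IH].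
Qed.

Lemma completion_differentiable c n z : exists l, cderiv (completion c n) z l.
Proof.
  induction n as [|n [l IH]]; simpl.
  - eexists. apply deriv_along_const.
  - destruct (reflected_differentiable c n z) as [m Hm].
    eexists. apply deriv_along_plus; [exact IH|].
    apply deriv_along_plus; [apply deriv_along_const|]. apply deriv_along_scal.
    apply (deriv_along_mult (fun z => z) (fun z => z)); [apply deriv_along_inc|exact Hm].
Qed.

Lemma completion_cderiv_0 c n : cderiv (completion c n) (RtoC 0) (2 * sum_shift c n)%C.
Proof.
  induction n as [|n IH]; simpl.
  - replace (2 * 0)%C with (RtoC 0) by ring. apply deriv_along_const.
  - destruct (reflected_differentiable c n (RtoC 0)) as [m Hm].
    replace (2 * (sum_shift c n + Cconj (c n) * c (S n)))%C with
      (2 * sum_shift c n + (0 + 2 * c (S n) * (1 * reflected c n (RtoC 0) + RtoC 0 * m)))%C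
      by (rewrite reflected_0; ring).
    apply deriv_along_plus; [exact IH|].
    apply deriv_along_plus; [apply deriv_along_const|].
    apply deriv_along_scal.
    apply (deriv_along_mult (fun z => z) (fun z => z)); [apply deriv_along_inc|exact Hm].
Qed.

Lemma Cmod_1_conj z : Cmod z = 1 -> (z * Cconj z)%C = 1%C.
Proof. intros H. rewrite <- Cmod2_conj, H. f_equal; ring. Qed.

Lemma reflected_circle c n z : Cmod z = 1 -> reflected c n z = (Cconj (cpoly c (S n) z) * z ^ n)%C.
Proof.
  intros Hz. assert (E := Cmod_1_conj z Hz). induction n as [|n IH].
  - simpl. rewrite Cplus_0_l, !Cmult_1_r. reflexivity.
  - change (reflected c (S n) z) with (z * reflected c n z + Cconj (c (S n)))%C.
    change (cpoly c (S (S n)) z) with (cpoly c (S n) z + c (S n) * z ^ S n)%C.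
    rewrite IH, Cplus_conj, Cmult_conj, Cpow_conj.
    replace ((Cconj (cpoly c (S n) z) + Cconj (c (S n)) * Cconj z ^ S n) * z ^ S n)%C with
     (Cconj (cpoly c (S n) z) * z ^ S n + Cconj (c (S n)) * (z * Cconj z) ^ S n)%C
     by (rewrite Cpow_mult_l; ring).
    rewrite E, Cpow_1_l. simpl. ring.
Qed.

Lemma Cmod_plus_sqr (u v : C) : Cmod (u + v)%C ^ 2 = Cmod u ^ 2 + Cmod v ^ 2 + 2 * Re (v * Cconj u)%C.
Proof. rewrite !Cmod2_alt. destruct u, v. simpl. ring. Qed.

(** Adding a top coefficient [c] to [p] adds [|c|^2 + 2 Re (c z^(n+1) conj p)] to [|p|^2], and on
    the circle [z^n conj p] is the reflected polynomial. So the Poisson integral of [|p|^2] is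
    explicit. *)
Lemma Re_completion c n z : Cmod z = 1 -> Re (completion c n z) = Cmod (cpoly c (S n) z) ^ 2.
Proof.
  intros Hz. induction n as [|n IH].
  - simpl. rewrite Cplus_0_l, !Cmult_1_r. reflexivity.
  - change (completion c (S n) z) with
     (completion c n z + (RtoC (Cmod (c (S n)) ^ 2) + 2 * c (S n) * (z * reflected c n z)))%C.
    change (cpoly c (S (S n)) z) with (cpoly c (S n) z + c (S n) * z ^ S n)%C.
    rewrite Cmod_plus_sqr, <- IH, (reflected_circle c n z Hz), Cmod_mult, Cmod_pow, Hz, pow1, Rmult_1_r.
    rewrite !re_plus, re_RtoC.
    replace (2 * c (S n) * (z * (Cconj (cpoly c (S n) z) * z ^ n)))%C with
      (2 * (c (S n) * z ^ S n * Cconj (cpoly c (S n) z)))%C by (simpl; ring).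
    rewrite re_scal_l. lra.
Qed.

Lemma sum_sqr_nonneg c n : 0 <= sum_sqr c n.
Proof. induction n; simpl; [|generalize (pow2_ge_0 (Cmod (c (S n))))]; generalize (pow2_ge_0 (Cmod (c 0%nat))); simpl in *; lra. Qed.

Lemma cauchy_schwarz_step m u v A B : 0 <= m -> 0 <= u -> 0 <= v -> 0 <= A -> 0 <= B ->
  m ^ 2 <= A * B -> (m + u * v) ^ 2 <= (A + u ^ 2) * (B + v ^ 2).
Proof.
  intros Hm Hu Hv HA HB H.
  assert (X : 2 * m * (u * v) <= A * v ^ 2 + B * u ^ 2).
  { assert (S1 : m <= sqrt A * sqrt B).
    { rewrite <- sqrt_mult by auto. rewrite <- (sqrt_pow2 m) by auto. apply sqrt_le_1_alt; auto. }
    assert (A2 : sqrt A * sqrt A = A) by (apply sqrt_sqrt; auto).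
    assert (B2 : sqrt B * sqrt B = B) by (apply sqrt_sqrt; auto).
    assert (UV : 0 <= u * v) by nra.
    apply Rle_trans with (2 * (sqrt A * sqrt B) * (u * v)); [nra|].
    assert (Q := pow2_ge_0 (sqrt A * v - sqrt B * u)).
    replace (A * v ^ 2 + B * u ^ 2) with ((sqrt A * sqrt A) * v ^ 2 + (sqrt B * sqrt B) * u ^ 2)
      by (rewrite A2, B2; ring). nra. }
  nra.
Qed.

(** This is the Schwarz inequality for the ball in disguise: with [A] the sum of all squares
    and [m] the shifted sum, it gives [|c_1|^2 <= A - |m|^2 / A]. *)
Lemma sum_shift_bound c n : c 0%nat = RtoC 0 ->
  Cmod (sum_shift c (S n)) ^ 2 <= sum_sqr c n * (sum_sqr c (S n) - Cmod (c 1%nat) ^ 2).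
Proof.
  intros H0. induction n as [|n IH].
  - simpl. rewrite H0, Cmod_0. replace (0 + Cconj 0 * c 1%nat)%C with (RtoC 0).
    + rewrite Cmod_0. right; ring.
    + apply injective_projections; simpl; ring.
  - change (sum_shift c (S (S n))) with (sum_shift c (S n) + Cconj (c (S n)) * c (S (S n)))%C.
    change (sum_sqr c (S (S n))) with (sum_sqr c (S n) + Cmod (c (S (S n))) ^ 2).
    change (sum_sqr c (S n)) with (sum_sqr c n + Cmod (c (S n)) ^ 2) at 1.
    assert (HS : 0 <= sum_sqr c (S n) - Cmod (c 1%nat) ^ 2).
    { clear IH. induction n as [|n IH]; simpl sum_sqr in *.
      - rewrite H0, Cmod_0. lra.
      - generalize (pow2_ge_0 (Cmod (c (S (S n))))). simpl in *. lra. }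
    apply Rle_trans with ((Cmod (sum_shift c (S n)) + Cmod (c (S n)) * Cmod (c (S (S n)))) ^ 2).
    + apply pow_incr. split; [apply Cmod_ge_0|].
      rewrite <- (Cmod_conj (c (S n))), <- Cmod_mult. apply Cmod_triangle.
    + replace (sum_sqr c (S n) + Cmod (c (S (S n))) ^ 2 - Cmod (c 1%nat) ^ 2) with
        ((sum_sqr c (S n) - Cmod (c 1%nat) ^ 2) + Cmod (c (S (S n))) ^ 2) by ring.
      apply cauchy_schwarz_step; auto using Cmod_ge_0, sum_sqr_nonneg.
Qed.

Lemma pderiv_conj f t l : pderiv f t l -> pderiv (fun s => Cconj (f s)) t (Cconj l).
Proof.
  intros H eps He. destruct (H eps He) as [d [Hd H1]]. exists d; split; auto.
  intros w Hw. specialize (H1 w Hw). rewrite <- Cmod_conj in H1.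
  rewrite !Cminus_conj, Cmult_conj, Cminus_conj in H1.
  assert (E : forall x : R, Cconj (RtoC x) = RtoC x).
  { intros x. apply injective_projections; simpl; ring. }
  rewrite !E in H1. exact H1.
Qed.

(** The slack on a compact circle absorbs the error made when the first component of a disc is
    replaced by a Taylor polynomial. *)
Lemma circle_margin g h r : 1 < r -> differentiable_disc r g -> differentiable_disc r h ->
  (forall t, Cmod (h (circle t)) ^ 2 < exp (- Cmod (g (circle t)) ^ 2)) ->
  exists delta, 0 < delta /\ forall t, 0 <= t <= 1 ->
    Cmod (h (circle t)) ^ 2 * exp (Cmod (g (circle t)) ^ 2) <= exp (- delta).
Proof.
  intros Hr Hg Hh HD.
  set (u := fun t => (h (circle t) * Cconj (h (circle t)) * cexp (g (circle t) * Cconj (g (circle t))))%C).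
  assert (Eu : forall t, Cmod (u t) = Cmod (h (circle t)) ^ 2 * exp (Cmod (g (circle t)) ^ 2)).
  { intros t. unfold u. rewrite <- !Cmod2_conj, Cmod_mult, Cmod_cexp, Cmod_R, Rabs_pos_eq.
    - reflexivity.
    - apply pow2_ge_0. }
  destruct (differentiable_path_bounded u) as [t0 [_ Hb]].
  { intros t _. destruct (differentiable_on_circle g r t Hr Hg) as [l Hl].
    destruct (differentiable_on_circle h r t Hr Hh) as [m Hm].
    eexists. apply deriv_along_mult.
    - apply deriv_along_mult; [exact Hm|apply pderiv_conj, Hm].
    - eapply (deriv_along_comp RtoC cexp); [apply cexp_cderiv|].
      apply deriv_along_mult; [exact Hl|apply pderiv_conj, Hl]. }
  (* the maximum may be 0, where the logarithm would be of no use *)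
  set (Q := Rmax (Cmod (u t0)) (1 / 2)).
  assert (Q0 : 0 < Q) by (eapply Rlt_le_trans; [|apply Rmax_r]; lra).
  assert (Q1 : Q < 1).
  { apply Rmax_lub_lt; [|lra]. rewrite Eu. specialize (HD t0).
    apply Rlt_le_trans with (exp (- Cmod (g (circle t0)) ^ 2) * exp (Cmod (g (circle t0)) ^ 2)).
    - apply Rmult_lt_compat_r; [apply exp_pos|exact HD].
    - rewrite <- exp_plus. replace (_ + _) with 0 by ring. rewrite exp_0; lra. }
  exists (- ln Q). split.
  - assert (ln Q < ln 1) by (apply ln_increasing; auto). rewrite ln_1 in H. lra.
  - intros t Ht. rewrite <- Eu, Ropp_involutive, exp_ln by auto.
    eapply Rle_trans; [apply Hb; auto|apply Rmax_l].
Qed.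

(** Let [p] be a Taylor polynomial of [g (rho z)] and [F] its completion. Then [|p|^2 = Re F] on the
    unit circle, so that [k = h (rho z) exp (F / 2)] is bounded by 1 there, and the Schwarz-Pick
    lemma bounds [k'(0)]. With [A = F(0)] and [m = F'(0) / 2] one has [k(0) = b exp (A / 2)] and
    [k'(0) = exp (A / 2) (rho y + b m)], and [sum_shift_bound] bounds [m]. The zeros of [h] are
    carried along by [k]. *)
Theorem competitor_bound g h b x y rho :
  0 <= b -> differentiable_disc 1 g -> differentiable_disc 1 h ->
  (forall z, Cmod z < 1 -> Cmod (h z) ^ 2 < exp (- Cmod (g z) ^ 2)) ->
  g (RtoC 0) = RtoC 0 -> h (RtoC 0) = RtoC b ->
  cderiv g (RtoC 0) x -> cderiv h (RtoC 0) y -> 0 < rho < 1 ->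
  exists A, 0 <= A /\ b * exp (A / 2) <= 1 /\ (rho * Cmod x) ^ 2 <= A /\
    rho * Cmod y <= exp (- A / 2) - b ^ 2 * exp (A / 2)
                    + b * sqrt (A ^ 2 - A * (rho * Cmod x) ^ 2).
Proof.
  intros Hb Hg Hh HD g0 h0 Dg Dh Hrho.
  set (g1 := fun z => g (RtoC rho * z)%C). set (h1 := fun z => h (RtoC rho * z)%C).
  assert (Hr : 1 < 1 / rho).
  { apply Rmult_lt_reg_r with rho; [lra|]. unfold Rdiv. rewrite Rmult_assoc, Rinv_l; lra. }
  assert (Hg1 : differentiable_disc (1 / rho) g1) by (apply differentiable_disc_scale; auto; lra).
  assert (Hh1 : differentiable_disc (1 / rho) h1) by (apply differentiable_disc_scale; auto; lra).
  assert (Dg1 := cderiv_scale g rho x Dg). fold g1 in Dg1.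
  assert (Dh1 := cderiv_scale h rho y Dh). fold h1 in Dh1.
  assert (Arho : Cmod (RtoC rho) = rho) by (rewrite Cmod_R, Rabs_pos_eq; lra).
  assert (g10 : g1 (RtoC 0) = RtoC 0) by (unfold g1; rewrite Cmult_0_r; auto).
  assert (h10 : h1 (RtoC 0) = RtoC b) by (unfold h1; rewrite Cmult_0_r; auto).
  destruct (circle_margin g1 h1 (1 / rho)) as [delta [Hdelta Hm]]; auto.
  { intros t. apply HD. rewrite Cmod_mult, Arho, Cmod_circle. lra. }
  destruct (differentiable_path_bounded (fun t => g1 (circle t))) as [t0 [_ HM]].
  { intros t _. eapply differentiable_on_circle; eauto. }
  set (M := Cmod (g1 (circle t0))) in *. assert (M0 : 0 <= M) by apply Cmod_ge_0.
  (* [(|g| + eps)^2 <= |g|^2 + eps (2 M + 1)] when [eps <= 1] *)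
  set (eps := Rmin 1 (delta / (2 * M + 1))).
  assert (Heps : 0 < eps) by (apply Rmin_glb_lt; [lra|apply Rdiv_lt_0_compat; lra]).
  assert (Heps1 : eps <= 1) by apply Rmin_l.
  assert (Heps2 : eps * (2 * M + 1) <= delta).
  { apply Rle_trans with (delta / (2 * M + 1) * (2 * M + 1)).
    - apply Rmult_le_compat_r; [lra|apply Rmin_r].
    - right; field; lra. }
  destruct (taylor_approximation g1 (1 / rho) (RtoC rho * x)%C eps) as [c [N [c0 [c1 Hc]]]]; auto.
  rewrite g10 in c0.
  set (A := sum_sqr c (S N)). set (m := sum_shift c (S N)).
  set (k := fun z => (h1 z * cexp (RtoC (/ 2) * completion c (S N) z))%C).
  assert (Dk0 : cderiv k (RtoC 0) (RtoC (exp (A / 2)) * (RtoC rho * y + RtoC b * m))%C).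
  { replace (RtoC (exp (A / 2)) * (RtoC rho * y + RtoC b * m))%C with
      ((RtoC rho * y) * cexp (RtoC (/ 2) * completion c (S N) (RtoC 0)) +
       h1 (RtoC 0) * (cexp (RtoC (/ 2) * completion c (S N) (RtoC 0)) * (RtoC (/ 2) * (2 * m))))%C.
    - apply (deriv_along_mult (fun z => z) h1 (fun z => cexp (RtoC (/ 2) * completion c (S N) z)%C)); [exact Dh1|].
      apply (deriv_along_comp (fun z => z) cexp (fun z => RtoC (/ 2) * completion c (S N) z)%C); [apply cexp_cderiv|].
      apply deriv_along_scal. apply completion_cderiv_0.
    - rewrite completion_0, <- RtoC_mult, cexp_R, h10. fold A.
      replace (/ 2 * A) with (A / 2) by field.
      replace (RtoC (/ 2) * (2 * m))%C with m; [ring|].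
      rewrite Cmult_assoc, <- RtoC_mult, Rinv_l by lra. ring. }
  assert (Dk : differentiable_disc (1 / rho) k).
  { intros z Hz. destruct (Hh1 z Hz) as [l Hl].
    destruct (completion_differentiable c (S N) z) as [l2 Hl2].
    eexists. apply deriv_along_mult; [exact Hl|].
    apply (deriv_along_comp (fun z => z) cexp (fun z => RtoC (/ 2) * completion c (S N) z)%C); [apply cexp_cderiv|]. apply deriv_along_scal, Hl2. }
  assert (Bk : forall t, 0 <= t <= 1 -> Cmod (k (circle t)) <= 1).
  { intros t Ht. specialize (Hm t Ht). specialize (HM t Ht).
    specialize (Hc (circle t) ltac:(rewrite Cmod_circle; lra)).
    set (p := Cmod (cpoly c (S (S N)) (circle t))).
    assert (Hp : p ^ 2 <= Cmod (g1 (circle t)) ^ 2 + delta).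
    { assert (P1 := Cmod_sub_rev (cpoly c (S (S N)) (circle t)) (g1 (circle t))).
      replace (cpoly c (S (S N)) (circle t) - g1 (circle t))%C with
        (- (g1 (circle t) - cpoly c (S (S N)) (circle t)))%C in P1 by ring.
      rewrite Cmod_opp in P1. fold p in P1.
      assert (P0 : 0 <= p) by apply Cmod_ge_0.
      assert (G0 := Cmod_ge_0 (g1 (circle t))). nra. }
    assert (Hk2 : Cmod (k (circle t)) ^ 2 <= 1).
    { unfold k. rewrite Cmod_mult, Cmod_cexp, re_scal_l, Re_completion by apply Cmod_circle.
      fold p. rewrite Rpow_mult_distr.
      replace (exp (/ 2 * p ^ 2) ^ 2) with (exp (p ^ 2)).
      2:{ replace (exp (/ 2 * p ^ 2) ^ 2) with (exp (/ 2 * p ^ 2) * exp (/ 2 * p ^ 2)) by ring.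
          rewrite <- exp_plus. f_equal. field. }
      apply Rle_trans with (Cmod (h1 (circle t)) ^ 2 * (exp (Cmod (g1 (circle t)) ^ 2) * exp delta)).
      - apply Rmult_le_compat_l; [apply pow2_ge_0|]. rewrite <- exp_plus.
        destruct Hp as [Hp|Hp]; [apply Rlt_le, exp_increasing; auto|rewrite Hp; lra].
      - apply Rle_trans with (exp (- delta) * exp delta).
        + rewrite <- Rmult_assoc. apply Rmult_le_compat_r; [apply Rlt_le, exp_pos|exact Hm].
        + rewrite <- exp_plus, Rplus_opp_l, exp_0. lra. }
    assert (K0 := Cmod_ge_0 (k (circle t))). nra. }
  assert (SP := schwarz_pick k (1 / rho) _ Hr Dk Bk Dk0).
  assert (k0 : Cmod (k (RtoC 0)) = b * exp (A / 2)).
  { unfold k. rewrite completion_0, <- RtoC_mult, cexp_R, h10, <- RtoC_mult, Cmod_R. fold A.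
    replace (/ 2 * A) with (A / 2) by field. apply Rabs_pos_eq.
    apply Rmult_le_pos; [auto|apply Rlt_le, exp_pos]. }
  rewrite k0 in SP.
  assert (EP := exp_pos (A / 2)). assert (A0 : 0 <= A) by apply sum_sqr_nonneg.
  assert (CS := sum_shift_bound c N c0). rewrite c1, Cmod_mult, Arho in CS. fold A m in CS.
  assert (SA : sum_sqr c N <= A).
  { unfold A. simpl. generalize (pow2_ge_0 (Cmod (c (S N)))). simpl. lra. }
  assert (A1 : (rho * Cmod x) ^ 2 <= A).
  { assert (T : forall n, (rho * Cmod x) ^ 2 <= sum_sqr c (S n)).
    { induction n as [|n IH].
      - simpl sum_sqr. rewrite c0, c1, Cmod_0, Cmod_mult, Arho. lra.
      - change (sum_sqr c (S (S n))) with (sum_sqr c (S n) + Cmod (c (S (S n))) ^ 2).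
        generalize (pow2_ge_0 (Cmod (c (S (S n))))). lra. }
    apply T. }
  exists A. split; [|split; [|split]]; auto.
  - assert (L0 := Cmod_ge_0 (RtoC (exp (A / 2)) * (RtoC rho * y + RtoC b * m))).
    assert (0 <= b * exp (A / 2)) by nra. nra.
  - assert (Hmm : Cmod m <= sqrt (A ^ 2 - A * (rho * Cmod x) ^ 2)).
    { rewrite <- (sqrt_pow2 (Cmod m)) by apply Cmod_ge_0. apply sqrt_le_1_alt.
      eapply Rle_trans; [exact CS|]. assert (S0 := sum_sqr_nonneg c N). nra. }
    rewrite Cmod_mult, Cmod_R, Rabs_pos_eq in SP by lra.
    assert (Inv : exp (- A / 2) * exp (A / 2) = 1).
    { rewrite <- exp_plus. replace (- A / 2 + A / 2) with 0 by field. apply exp_0. }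
    assert (B : Cmod (RtoC rho * y + RtoC b * m) <= exp (- A / 2) - b ^ 2 * exp (A / 2)).
    { apply Rmult_le_reg_l with (exp (A / 2)); auto.
      eapply Rle_trans; [exact SP|]. right. rewrite Rmult_minus_distr_l.
      rewrite (Rmult_comm _ (exp (- A / 2))), Inv. ring. }
    assert (T : rho * Cmod y <= Cmod (RtoC rho * y + RtoC b * m) + b * Cmod m).
    { replace (rho * Cmod y) with (Cmod (RtoC rho * y)) by (rewrite Cmod_mult, Arho; auto).
      replace (b * Cmod m) with (Cmod (RtoC b * m)) by (rewrite Cmod_mult, Cmod_R, Rabs_pos_eq; auto).
      assert (X := Cmod_sub_triangle (RtoC rho * y + RtoC b * m) (RtoC b * m)).
      replace (RtoC rho * y + RtoC b * m - RtoC b * m)%C with (RtoC rho * y)%C in X by ring. exact X. }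
    assert (b * Cmod m <= b * sqrt (A ^ 2 - A * (rho * Cmod x) ^ 2)) by (apply Rmult_le_compat_l; auto).
    lra.
Qed.

(** * From discs to the infimum *)

(** The largest modulus of the second component of the derivative, when [P] is the squared modulus
    of the first one and [A] is twice the logarithm of [|B(0)| / b], [B] being the Blaschke product
    of the zeros of the second component. *)
Definition Phi (b A P : R) : R := exp (- A / 2) - b ^ 2 * exp (A / 2) + b * sqrt (A ^ 2 - A * P).

Definition feasible (b P y : R) : Prop :=
  exists A, 0 <= A /\ b * exp (A / 2) <= 1 /\ P <= A /\ y <= Phi b A P.

Lemma competitor_feasible b (X Y : C) r : 0 <= b ->
  kobayashi_competitor D11 ((RtoC 0, RtoC b) : C2) ((X, Y) : C2) r ->
  0 <= r /\ exists x y : R, Cmod X = r * x /\ Cmod Y = r * y /\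
    forall rho, 0 < rho < 1 -> feasible b ((rho * x) ^ 2) (rho * y).
Proof.
  intros Hb [f [l [a [Hf [HD [f0 [Dl [Ha ->]]]]]]]].
  split; [apply Cmod_ge_0|].
  apply is_derive_C2_iff in Dl. destruct Dl as [D1 D2].
  exists (Cmod (fst l)), (Cmod (snd l)).
  split; [|split].
  - rewrite <- Cmod_mult. apply f_equal. symmetry. exact (f_equal fst Ha).
  - rewrite <- Cmod_mult. apply f_equal. symmetry. exact (f_equal snd Ha).
  - intros rho Hrho.
    apply (competitor_bound (fun z => fst (f z)) (fun z => snd (f z)) b (fst l) (snd l) rho); auto.
    + intros z Hz. destruct (Hf z Hz) as [m Hm]. apply is_derive_C2_iff in Hm.
      exists (fst m). apply Hm.
    + intros z Hz. destruct (Hf z Hz) as [m Hm]. apply is_derive_C2_iff in Hm.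
      exists (snd m). apply Hm.
    + exact (f_equal fst f0).
    + exact (f_equal snd f0).
Qed.

Lemma feasible_0 b : 0 <= b < 1 -> feasible b 0 0.
Proof.
  intros Hb. exists 0. unfold Phi. replace (- 0 / 2) with 0 by field. replace (0 / 2) with 0 by field.
  rewrite exp_0. replace (0 ^ 2 - 0 * 0) with 0 by ring. rewrite sqrt_0.
  repeat split; try lra. nra.
Qed.

(** Competitors are compared after the dilation by [rho < 1], so that the conclusion is obtained
    only in the limit [rho -> 1]. *)
Lemma kobayashi_lower b (X Y : C) kappa r : 0 <= b < 1 -> 0 <= kappa ->
  (forall s, 0 < s -> feasible b ((s * Cmod X) ^ 2) (s * Cmod Y) -> s * kappa <= 1) ->
  kobayashi_competitor D11 ((RtoC 0, RtoC b) : C2) ((X, Y) : C2) r -> kappa <= r.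
Proof.
  intros Hb Hk H Hc. destruct (competitor_feasible b X Y r) as [Hr [x [y [HX [HY F]]]]]; auto; try lra.
  destruct (Req_dec r 0) as [E|E].
  - subst r. apply Rnot_lt_le. intros Hk'.
    assert (T := H (2 / kappa)). rewrite HX, HY in T.
    replace ((2 / kappa * (0 * x)) ^ 2) with 0 in T by ring.
    replace (2 / kappa * (0 * y)) with 0 in T by ring.
    replace (2 / kappa * kappa) with 2 in T by (field; lra).
    assert (0 < 2 / kappa) by (apply Rdiv_lt_0_compat; lra).
    assert (FF := feasible_0 b Hb). specialize (T H0 FF). lra.
  - assert (Hr' : 0 < r) by lra.
    assert (S : forall rho, 0 < rho < 1 -> rho * kappa <= r).
    { intros rho Hrho. assert (T := H (rho / r)).
      rewrite HX, HY in T. replace (rho / r * (r * x)) with (rho * x) in T by (field; lra).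
      replace (rho / r * (r * y)) with (rho * y) in T by (field; lra).
      assert (0 < rho / r) by (apply Rdiv_lt_0_compat; lra).
      specialize (T H0 (F rho Hrho)).
      replace (rho * kappa) with (r * (rho / r * kappa)) by (field; lra). nra. }
    apply Rnot_lt_le. intros Hlt.
    assert (K0 : 0 < kappa) by lra.
    specialize (S ((r / kappa + 1) / 2)).
    assert (Q : 0 < r / kappa < 1).
    { split; [apply Rdiv_lt_0_compat; lra|].
      apply Rmult_lt_reg_r with kappa; auto. unfold Rdiv. rewrite Rmult_assoc, Rinv_l; lra. }
    specialize (S ltac:(lra)).
    replace ((r / kappa + 1) / 2 * kappa) with ((r + kappa) / 2) in S by (field; lra). lra.
Qed.

Lemma kobayashi_attained b (X Y : C) kappa : 0 <= b < 1 -> 0 <= kappa ->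
  (forall s, 0 < s -> feasible b ((s * Cmod X) ^ 2) (s * Cmod Y) -> s * kappa <= 1) ->
  kobayashi_competitor D11 ((RtoC 0, RtoC b) : C2) ((X, Y) : C2) kappa ->
  kobayashi D11 ((RtoC 0, RtoC b) : C2) ((X, Y) : C2) = Finite kappa.
Proof.
  intros Hb Hk H Hc. apply is_glb_Rbar_unique. split.
  - intros r Hr. simpl. eapply kobayashi_lower; eauto.
  - intros l Hl. apply Hl. exact Hc.
Qed.

(** * The extremal discs *)

(** Together with [F = A (1 + c t) / (1 - c t)] this is the image, in the Siegel half-space
    [|g|^2 < Re F], of the linear disc [t (c, e)] of the ball under the Cayley transform. *)
Definition disc_fst (A : R) (c e : C) (t : C) : C := (RtoC (sqrt A) * e * t / (1 - c * t))%C.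

(** The exponential of [- F / 2] times a Moebius transformation, which brings in one zero unless
    [s = 1], when it is constant. *)
Definition disc_snd (A s : R) (c w : C) (t : C) : C :=
  ((w * t + RtoC s) / (1 + RtoC s * (w * t))
   * cexp (RtoC (- A / 2) * ((1 + c * t) / (1 - c * t))))%C.

Lemma Re_cayley u : (1 - u)%C <> RtoC 0 ->
  Re ((1 + u) / (1 - u))%C = (1 - Cmod u ^ 2) / Cmod (1 - u)%C ^ 2.
Proof.
  intros H.
  assert (N : 0 < Cmod (1 - u)%C ^ 2) by (apply pow_lt, Cmod_gt_0; auto).
  replace ((1 + u) / (1 - u))%C with (RtoC (/ Cmod (1 - u)%C ^ 2) * ((1 + u) * Cconj (1 - u)))%C.
  - rewrite re_scal_l.
    assert (E : Re ((1 + u) * Cconj (1 - u))%C = 1 - Cmod u ^ 2).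
    { rewrite Cmod2_alt. destruct u as [p q]. simpl. ring. }
    rewrite E. unfold Rdiv. ring.
  - rewrite RtoC_inv, Cmod2_conj by lra. field. split; auto.
    intros E. apply H. rewrite <- (Cconj_conj (1 - u)), E.
    apply injective_projections; simpl; ring.
Qed.

Lemma one_sub_neq_0 u : Cmod u < 1 -> (1 - u)%C <> RtoC 0.
Proof.
  intros H. apply Cmod_gt_0. eapply Rlt_le_trans; [|apply Cmod_sub_rev]. rewrite Cmod_1. lra.
Qed.

Lemma Cmod_mult_lt_1 c t : Cmod c <= 1 -> Cmod t < 1 -> Cmod (c * t)%C < 1.
Proof.
  intros Hc Ht. rewrite Cmod_mult. assert (C0 := Cmod_ge_0 c). assert (T0 := Cmod_ge_0 t). nra.
Qed.

Lemma blaschke_bound s u : 0 <= s <= 1 -> Cmod u < 1 ->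
  (1 + RtoC s * u)%C <> RtoC 0 /\
  Cmod ((u + RtoC s) / (1 + RtoC s * u))%C <= 1 /\
  (s < 1 -> Cmod ((u + RtoC s) / (1 + RtoC s * u))%C < 1).
Proof.
  intros Hs Hu. assert (U0 := Cmod_ge_0 u).
  assert (As : Cmod (RtoC s) = s) by (rewrite Cmod_R, Rabs_pos_eq; lra).
  assert (N : (1 + RtoC s * u)%C <> RtoC 0).
  { replace (1 + s * u)%C with (1 - (- (s * u)))%C by ring. apply one_sub_neq_0.
    rewrite Cmod_opp. apply Cmod_mult_lt_1; lra. }
  assert (D : 0 < Cmod (1 + s * u)) by (apply Cmod_gt_0; auto).
  assert (H : Cmod (1 + s * u)%C ^ 2 - Cmod (u + s)%C ^ 2 = (1 - Cmod u ^ 2) * (1 - s ^ 2)).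
  { rewrite !Cmod2_alt. destruct u as [p q]. simpl. ring. }
  assert (Q0 := Cmod_ge_0 (u + s)).
  assert (U2 : 0 < 1 - Cmod u ^ 2) by nra.
  split; [auto|split]; [|intros Hs1]; rewrite Cmod_div by auto.
  - apply Rmult_le_reg_r with (Cmod (1 + s * u)); auto.
    unfold Rdiv. rewrite Rmult_assoc, Rinv_l by lra. assert (0 <= 1 - s ^ 2) by nra. 
    assert (0 <= (1 - Cmod u ^ 2) * (1 - s ^ 2)) by nra. nra.
  - apply Rmult_lt_reg_r with (Cmod (1 + s * u)); auto.
    unfold Rdiv. rewrite Rmult_assoc, Rinv_l by lra. assert (0 < 1 - s ^ 2) by nra.
    assert (0 < (1 - Cmod u ^ 2) * (1 - s ^ 2)) by (apply Rmult_lt_0_compat; auto). nra.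
Qed.

Lemma disc_in_D11 A s c e w t : 0 <= A -> 0 <= s <= 1 -> (0 < A \/ s < 1) ->
  Cmod c ^ 2 + Cmod e ^ 2 <= 1 -> Cmod w = 1 -> Cmod t < 1 ->
  D11 ((disc_fst A c e t, disc_snd A s c w t) : C2).
Proof.
  intros HA Hs Hor Hce Hw Ht. unfold D11; simpl fst; simpl snd.
  assert (C0 := Cmod_ge_0 c). assert (T0 := Cmod_ge_0 t). assert (E0 := Cmod_ge_0 e).
  assert (Hc1 : Cmod c <= 1) by (generalize (pow2_ge_0 (Cmod e)); nra).
  assert (Hu : Cmod (c * t) < 1) by (apply Cmod_mult_lt_1; auto).
  assert (N := one_sub_neq_0 _ Hu).
  assert (D : 0 < Cmod (1 - c * t)) by (apply Cmod_gt_0; auto).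
  assert (D2 : 0 < Cmod (1 - c * t) ^ 2) by (apply pow_lt; auto).
  destruct (blaschke_bound s (w * t)%C Hs) as [NB [B1 B2]].
  { rewrite Cmod_mult, Hw. lra. }
  set (q := (1 - Cmod (c * t) ^ 2) / Cmod (1 - c * t) ^ 2).
  assert (EG : Cmod (disc_fst A c e t) ^ 2 = A * ((Cmod e * Cmod t) ^ 2 / Cmod (1 - c * t) ^ 2)).
  { unfold disc_fst. rewrite Cmod_div, !Cmod_mult, Cmod_R, Rabs_pos_eq by (auto; apply sqrt_pos).
    rewrite <- (sqrt_sqrt A) at 2 by auto. field. lra. }
  assert (Hq : (Cmod e * Cmod t) ^ 2 / Cmod (1 - c * t) ^ 2 < q).
  { unfold q, Rdiv. apply Rmult_lt_compat_r; [apply Rinv_0_lt_compat; auto|].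
    rewrite Cmod_mult, !Rpow_mult_distr. nra. }
  unfold disc_snd. rewrite Cmod_mult, Cmod_cexp, re_scal_l, Re_cayley by auto. fold q.
  set (B := Cmod ((w * t + s) / (1 + s * (w * t)))) in *.
  assert (B0 : 0 <= B) by apply Cmod_ge_0.
  rewrite EG, Rpow_mult_distr.
  replace (exp (- A / 2 * q) ^ 2) with (exp (- (A * q))).
  2:{ replace (exp (- A / 2 * q) ^ 2) with (exp (- A / 2 * q) * exp (- A / 2 * q)) by ring.
      rewrite <- exp_plus. f_equal. field. }
  assert (P := exp_pos (- (A * q))).
  destruct Hor as [HA'|Hs'].
  - apply Rle_lt_trans with (exp (- (A * q))).
    + assert (B ^ 2 <= 1) by nra. nra.
    + apply exp_increasing.
      apply Ropp_lt_contravar. apply Rmult_lt_compat_l; auto.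
  - specialize (B2 Hs'). assert (B ^ 2 < 1) by nra.
    apply Rlt_le_trans with (exp (- (A * q))); [nra|].
    destruct (Rle_lt_or_eq_dec 0 A HA) as [HA'|HA'].
    + apply Rlt_le, exp_increasing, Ropp_lt_contravar, Rmult_lt_compat_l; auto.
    + rewrite <- HA', !Rmult_0_l. lra.
Qed.

(** At [0] the Moebius factor has the value [s = b exp (A / 2)] and the derivative
    [(1 - s^2) w], while the exponential has the value [exp (- A / 2)] and the logarithmic
    derivative [- A c]. The case [A = 0] gives the vertical discs, [s = 0] the linear discs
    through the origin, [s = 1] the zero-free ones. *)
Lemma disc_competitor b A (c e w a X Y : C) :
  0 <= b < 1 -> 0 <= A -> b * exp (A / 2) <= 1 ->
  Cmod c ^ 2 + Cmod e ^ 2 <= 1 -> Cmod w = 1 ->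
  X = (a * (RtoC (sqrt A) * e))%C ->
  Y = (a * (RtoC (exp (- A / 2) * (1 - (b * exp (A / 2)) ^ 2)) * w - RtoC (b * A) * c))%C ->
  kobayashi_competitor D11 ((RtoC 0, RtoC b) : C2) ((X, Y) : C2) (Cmod a).
Proof.
  intros Hb HA Hs Hce Hw HX HY.
  set (s := b * exp (A / 2)) in *.
  assert (EP := exp_pos (A / 2)).
  assert (Hs0 : 0 <= s <= 1) by (unfold s in *; split; [nra|auto]).
  assert (Es : s * exp (- A / 2) = b).
  { unfold s. rewrite Rmult_assoc, <- exp_plus. replace (A / 2 + - A / 2) with 0 by field.
    rewrite exp_0; ring. }
  assert (Hor : 0 < A \/ s < 1).
  { destruct (Rle_lt_or_eq_dec 0 A HA) as [HA'|HA']; auto. right. unfold s.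
    rewrite <- HA'. replace (0 / 2) with 0 by field. rewrite exp_0. lra. }
  assert (Hc1 : Cmod c <= 1).
  { assert (C0 := Cmod_ge_0 c). assert (E0 := pow2_ge_0 (Cmod e)). nra. }
  assert (Dc : forall t, cderiv (fun t => 1 - c * t)%C t (0 - c * 1)%C).
  { intros t. apply deriv_along_minus; [apply deriv_along_const|apply deriv_along_scal, deriv_along_inc]. }
  assert (Dc' : forall t, cderiv (fun t => 1 + c * t)%C t (0 + c * 1)%C).
  { intros t. apply deriv_along_plus; [apply deriv_along_const|apply deriv_along_scal, deriv_along_inc]. }
  assert (D1 : forall t, Cmod t < 1 -> cderiv (disc_fst A c e) t
     ((RtoC (sqrt A) * e * 1 * (1 - c * t) - RtoC (sqrt A) * e * t * (0 - c * 1)) / ((1 - c * t) * (1 - c * t)))%C).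
  { intros t Ht.
    apply (deriv_along_div (fun z => z) (fun t => RtoC (sqrt A) * e * t)%C (fun t => 1 - c * t)%C).
    - apply one_sub_neq_0, Cmod_mult_lt_1; auto.
    - apply deriv_along_scal, deriv_along_inc.
    - apply Dc. }
  assert (D2 : forall t, Cmod t < 1 -> cderiv (disc_snd A s c w) t
     ((((w * 1 + 0) * (1 + RtoC s * (w * t)) - (w * t + RtoC s) * (0 + RtoC s * (w * 1)))
        / ((1 + RtoC s * (w * t)) * (1 + RtoC s * (w * t))))
       * cexp (RtoC (- A / 2) * ((1 + c * t) / (1 - c * t)))
      + (w * t + RtoC s) / (1 + RtoC s * (w * t)) *
        (cexp (RtoC (- A / 2) * ((1 + c * t) / (1 - c * t))) *
         (RtoC (- A / 2) * (((0 + c * 1) * (1 - c * t) - (1 + c * t) * (0 - c * 1)) / ((1 - c * t) * (1 - c * t))))))%C).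
  { intros t Ht.
    apply (deriv_along_mult (fun z => z) (fun t => (w * t + RtoC s) / (1 + RtoC s * (w * t)))%C
      (fun t => cexp (RtoC (- A / 2) * ((1 + c * t) / (1 - c * t))))%C).
    - apply (deriv_along_div (fun z => z) (fun t => w * t + RtoC s)%C (fun t => 1 + RtoC s * (w * t))%C).
      + apply blaschke_bound; auto. rewrite Cmod_mult, Hw. lra.
      + apply deriv_along_plus; [apply deriv_along_scal, deriv_along_inc|apply deriv_along_const].
      + apply deriv_along_plus; [apply deriv_along_const|].
        apply deriv_along_scal, deriv_along_scal, deriv_along_inc.
    - apply (deriv_along_comp (fun z => z) cexp (fun t => RtoC (- A / 2) * ((1 + c * t) / (1 - c * t)))%C);
      [apply cexp_cderiv|].
      apply deriv_along_scal.
      apply (deriv_along_div (fun z => z) (fun t => 1 + c * t)%C (fun t => 1 - c * t)%C); auto.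
      apply one_sub_neq_0, Cmod_mult_lt_1; auto. }
  exists (fun t => (disc_fst A c e t, disc_snd A s c w t) : C2).
  exists ((RtoC (sqrt A) * e)%C, (RtoC (exp (- A / 2) * (1 - s ^ 2)) * w - RtoC (b * A) * c)%C), a.
  assert (U : Cmod (RtoC 0) < 1) by (rewrite Cmod_0; lra).
  assert (Ex0 : cexp (RtoC (- A / 2) * ((1 + c * 0) / (1 - c * 0)))%C = RtoC (exp (- A / 2))).
  { rewrite <- cexp_R. f_equal. field. }
  assert (N1 : (1 + RtoC s * (w * 0))%C <> 0).
  { replace (1 + RtoC s * (w * 0))%C with (RtoC 1) by ring. apply RtoC_neq; lra. }
  split; [|split; [|split; [|split; [|split]]]].
  - intros z Hz. eexists. apply is_derive_C2_iff; simpl.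
    instantiate (1 := (_, _)). split; [apply D1|apply D2]; exact Hz.
  - intros t Ht. apply disc_in_D11; auto.
  - apply injective_projections; simpl.
    + unfold disc_fst. field.
    + unfold disc_snd. rewrite Ex0, <- Es, RtoC_mult. field.
  - apply is_derive_C2_iff; cbn [fst snd]; split.
    + specialize (D1 (RtoC 0) U). 
      match type of D1 with deriv_along _ _ _ ?l => replace (RtoC (sqrt A) * e)%C with l; [exact D1|] end.
      field.
    + specialize (D2 (RtoC 0) U). rewrite Ex0 in D2.
      match type of D2 with deriv_along _ _ _ ?l =>
        replace (RtoC (exp (- A / 2) * (1 - s ^ 2)) * w - RtoC (b * A) * c)%C with l; [exact D2|] end.
      rewrite <- Es. replace (- A / 2) with (- (A * / 2)) by field.
      simpl. rewrite !RtoC_mult, RtoC_minus, !RtoC_mult, RtoC_opp, RtoC_mult, RtoC_inv by lra.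
      field.
  - apply injective_projections; simpl; symmetry; auto.
  - reflexivity.
Qed.

(** * The maximization over alpha *)

Lemma mean_value_open (f : R -> R) a b : a < b ->
  (forall x, a < x < b -> exists d, is_derive f x d) ->
  (forall x, a <= x <= b -> continuity_pt f x) ->
  exists c d, a < c < b /\ is_derive f c d /\ f b - f a = d * (b - a).
Proof.
  intros Hab Hd Hc.
  assert (pr1 : forall c, a < c < b -> derivable_pt f c).
  { intros c Hcb. apply ex_derive_Reals_0. destruct (Hd c Hcb) as [d H]. exists d; auto. }
  destruct (MVT f id a b pr1 (fun c _ => derivable_pt_id c) Hab Hc) as [c [P E]].
  { intros c _. apply derivable_continuous_pt, derivable_pt_id. }
  exists c, (derive_pt f c (pr1 c P)). split; [auto|split].
  - apply is_derive_Reals. apply derive_pt_eq_1 with (pr1 c P). reflexivity.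
  - rewrite (derive_pt_eq_0 id c 1 (derivable_pt_id c) (derivable_pt_lim_id c)) in E.
    unfold id in E. lra.
Qed.

Lemma increasing_on (f : R -> R) a b : a <= b ->
  (forall x, a < x < b -> exists d, is_derive f x d /\ 0 <= d) ->
  (forall x, a <= x <= b -> continuity_pt f x) -> f a <= f b.
Proof.
  intros Hab Hd Hc. destruct (Rle_lt_or_eq_dec a b Hab) as [H|H]; [|subst; lra].
  destruct (mean_value_open f a b H) as [c [d [Hcb [D E]]]]; auto.
  { intros x Hx. destruct (Hd x Hx) as [d [D _]]. exists d; auto. }
  destruct (Hd c Hcb) as [d' [D' P]].
  assert (d = d') by (rewrite <- (is_derive_unique _ _ _ D); apply is_derive_unique; auto). subst. nra.
Qed.

Lemma strictly_increasing_on (f : R -> R) a b : a < b ->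
  (forall x, a < x < b -> exists d, is_derive f x d /\ 0 < d) ->
  (forall x, a <= x <= b -> continuity_pt f x) -> f a < f b.
Proof.
  intros H Hd Hc.
  destruct (mean_value_open f a b H) as [c [d [Hcb [D E]]]]; auto.
  { intros x Hx. destruct (Hd x Hx) as [d [D _]]. exists d; auto. }
  destruct (Hd c Hcb) as [d' [D' P]].
  assert (d = d') by (rewrite <- (is_derive_unique _ _ _ D); apply is_derive_unique; auto). subst. nra.
Qed.

Lemma is_derive_continuity_pt (f : R -> R) x d : is_derive f x d -> continuity_pt f x.
Proof.
  intros H. apply derivable_continuous_pt. exists d. apply is_derive_Reals; auto.
Qed.

Lemma derivable_continuity (f : R -> R) : (forall x, ex_derive f x) -> continuity f.
Proof. intros H x. destruct (H x) as [d D]. eapply is_derive_continuity_pt; eauto. Qed.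

Lemma intermediate_value (f : R -> R) a b y : a <= b -> (forall x, ex_derive f x) ->
  (f a <= y <= f b \/ f b <= y <= f a) -> exists x, a <= x <= b /\ f x = y.
Proof.
  intros Hab Hf Hy. destruct (IVT_gen f a b y) as [x [Hx E]].
  - apply derivable_continuity; auto.
  - destruct Hy; [rewrite Rmin_left, Rmax_right|rewrite Rmin_right, Rmax_left]; lra.
  - rewrite Rmin_left, Rmax_right in Hx by auto. exists x; auto.
Qed.

(** The curve [P = psi b A] is the set of critical points of [Phi b A P] in [A]. *)
Definition psi (b A : R) : R := A * (1 - b ^ 2 * exp A).

(** The value of [Phi] along the critical curve. *)
Definition phi (b A : R) : R := exp (- A / 2) * (1 - b ^ 2 * exp A) + b ^ 2 * A * exp (A / 2).

Lemma exp_half A : exp (A / 2) * exp (A / 2) = exp A.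
Proof. rewrite <- exp_plus. f_equal. field. Qed.

Lemma exp_half_neg A : exp (- A / 2) * exp (A / 2) = 1.
Proof. rewrite <- exp_plus. replace (- A / 2 + A / 2) with 0 by field. apply exp_0. Qed.

Lemma ex_derive_psi b A : ex_derive (psi b) A.
Proof. unfold psi. auto_derive. auto. Qed.

(** On the curve the argument of the square root is the square of [A b exp (A / 2)]. *)
Lemma Phi_curve b A : 0 <= b -> 0 <= A -> Phi b A (psi b A) = phi b A.
Proof.
  intros Hb HA. unfold Phi, phi, psi.
  assert (E := exp_half A). assert (N := exp_half_neg A).
  assert (P := exp_pos (A / 2)).
  replace (A ^ 2 - A * (A * (1 - b ^ 2 * exp A))) with ((A * (b * exp (A / 2))) ^ 2).
  2:{ rewrite <- E. ring. }
  rewrite sqrt_pow2 by (apply Rmult_le_pos; nra).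
  rewrite <- E. replace (exp (- A / 2) * (1 - b ^ 2 * (exp (A / 2) * exp (A / 2)))) with
   (exp (- A / 2) - b ^ 2 * ((exp (- A / 2) * exp (A / 2)) * exp (A / 2))) by ring.
  rewrite N. ring.
Qed.

Lemma Phi_antitone b A P P' : 0 <= b -> 0 <= A -> P <= P' -> Phi b A P' <= Phi b A P.
Proof.
  intros Hb HA H. unfold Phi. apply Rplus_le_compat_l, Rmult_le_compat_l; auto.
  apply sqrt_le_1_alt. nra.
Qed.

Lemma phi_sqr b A : phi b A ^ 2 =
  b ^ 4 * A ^ 2 * exp A + (1 - b ^ 2 * exp A) ^ 2 * exp (- A) + 2 * b ^ 2 * psi b A.
Proof.
  unfold phi, psi.
  assert (E := exp_half A). assert (N := exp_half_neg A).
  assert (M : exp (- A / 2) * exp (- A / 2) = exp (- A)) by (rewrite <- exp_plus; f_equal; field).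
  replace ((exp (- A / 2) * (1 - b ^ 2 * exp A) + b ^ 2 * A * exp (A / 2)) ^ 2) with
   ((exp (- A / 2) * exp (- A / 2)) * (1 - b ^ 2 * exp A) ^ 2
    + b ^ 4 * A ^ 2 * (exp (A / 2) * exp (A / 2))
    + 2 * b ^ 2 * (A * (1 - b ^ 2 * exp A)) * (exp (- A / 2) * exp (A / 2))) by ring.
  rewrite E, N, M. ring.
Qed.

Section Fixed_b.
Variable b : R.
Hypothesis hb0 : 0 < b.
Hypothesis hb1 : b < 1.
Let L := - 2 * ln b.

Lemma L_pos : 0 < L.
Proof. unfold L. assert (H := ln_increasing b 1 hb0 hb1). rewrite ln_1 in H. lra. Qed.

Lemma b_exp_L : b * exp (L / 2) = 1.
Proof.
  unfold L. replace (-2 * ln b / 2) with (- ln b) by field. rewrite exp_Ropp, exp_ln by auto. field. lra.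
Qed.

Lemma exp_neg_L : exp (- L / 2) = b.
Proof. unfold L. replace (- (-2 * ln b) / 2) with (ln b) by field. apply exp_ln; auto. Qed.

Lemma b2_exp_L : b ^ 2 * exp L = 1.
Proof.
  rewrite <- exp_half. replace (b ^ 2 * (exp (L / 2) * exp (L / 2))) with ((b * exp (L / 2)) * (b * exp (L / 2))) by ring.
  rewrite b_exp_L. ring.
Qed.

Lemma exp_half_le_1_iff A : b * exp (A / 2) <= 1 <-> A <= L.
Proof.
  rewrite <- b_exp_L. split; intros H.
  - apply Rnot_lt_le. intros HL. assert (exp (L / 2) < exp (A / 2)) by (apply exp_increasing; lra). nra.
  - apply Rmult_le_compat_l; [lra|]. destruct H as [H|H]; [apply Rlt_le, exp_increasing; lra|rewrite H; lra].
Qed.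

Lemma b2_exp_lt A : A < L -> b ^ 2 * exp A < 1.
Proof.
  intros H. rewrite <- b2_exp_L. apply Rmult_lt_compat_l; [apply pow_lt; auto|apply exp_increasing; auto].
Qed.

Lemma psi_pos A : 0 < A < L -> 0 < psi b A.
Proof. intros [H1 H2]. unfold psi. assert (H := b2_exp_lt A H2). nra. Qed.

Lemma psi_lt A : 0 < A -> psi b A < A.
Proof.
  intros H. unfold psi. assert (E := exp_pos A). assert (B : 0 < b ^ 2) by (apply pow_lt; auto).
  assert (0 < b ^ 2 * exp A) by nra. nra.
Qed.

Lemma psi_0 : psi b 0 = 0. Proof. unfold psi; ring. Qed.

Lemma psi_L : psi b L = 0. Proof. unfold psi. rewrite b2_exp_L. ring. Qed.

Lemma Phi_L P : Phi b L P = b * sqrt (L ^ 2 - L * P).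
Proof.
  unfold Phi. rewrite exp_neg_L. replace (b ^ 2 * exp (L / 2)) with (b * (b * exp (L / 2))) by ring.
  rewrite b_exp_L. ring.
Qed.

Lemma Phi_L_nonneg P : 0 <= Phi b L P.
Proof. rewrite Phi_L. apply Rmult_le_pos; [lra|apply sqrt_pos]. Qed.

Lemma Phi_L_sqr P : P <= L -> Phi b L P ^ 2 = b ^ 2 * (L ^ 2 - L * P).
Proof.
  intros H. rewrite Phi_L. assert (HL := L_pos). rewrite Rpow_mult_distr.
  f_equal. apply pow2_sqrt. nra.
Qed.

(** The point [am] is the zero of [psi']; to its left [psi] increases, to its right it decreases. *)
Lemma psi_max_exists : exists am, 0 < am < L /\ (1 + am) * (b ^ 2 * exp am) = 1.
Proof.
  assert (HL := L_pos).
  destruct (intermediate_value (fun A => (1 + A) * (b ^ 2 * exp A)) 0 L 1) as [am [H E]].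
  - lra.
  - intros x. auto_derive. auto.
  - left. rewrite exp_0, b2_exp_L. split; nra.
  - exists am. split; auto. split.
    + destruct (Rle_lt_or_eq_dec 0 am) as [K|K]; [lra|auto|].
      rewrite <- K, exp_0 in E. nra.
    + destruct (Rle_lt_or_eq_dec am L) as [K|K]; [lra|auto|].
      rewrite K, b2_exp_L in E. lra.
Qed.

Variable am : R.
Hypothesis am_bounds : 0 < am < L.
Hypothesis am_eq : (1 + am) * (b ^ 2 * exp am) = 1.

Lemma psi_derive A : is_derive (psi b) A (1 - (1 + A) * (b ^ 2 * exp A)).
Proof. unfold psi. auto_derive; auto. ring. Qed.

Lemma slope_lt A A' : 0 <= A < A' -> (1 + A) * (b ^ 2 * exp A) < (1 + A') * (b ^ 2 * exp A').
Proof.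
  intros H. assert (E := exp_pos A). assert (exp A < exp A') by (apply exp_increasing; lra).
  assert (B : 0 < b ^ 2) by (apply pow_lt; auto).
  apply Rmult_le_0_lt_compat; nra.
Qed.

Lemma psi_increasing A A' : 0 <= A -> A < A' -> A' <= am -> psi b A < psi b A'.
Proof.
  intros H1 H2 H3. apply strictly_increasing_on; auto.
  - intros x Hx. eexists. split; [apply psi_derive|].
    assert (S := slope_lt x am). rewrite am_eq in S. lra.
  - intros x _. eapply is_derive_continuity_pt, psi_derive.
Qed.

Lemma psi_decreasing A A' : am <= A -> A < A' -> psi b A' < psi b A.
Proof.
  intros H1 H2. apply Ropp_lt_cancel. apply (strictly_increasing_on (fun x => - psi b x)); auto.
  - intros x Hx. eexists. split.
    + apply (is_derive_opp (psi b)). apply psi_derive.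
    + assert (S := slope_lt am x). rewrite am_eq in S.
      change (0 < - (1 - (1 + x) * (b ^ 2 * exp x))). lra.
  - intros x _. eapply is_derive_continuity_pt. apply (is_derive_opp (psi b)). apply psi_derive.
Qed.

Lemma psi_le_max A : 0 <= A -> psi b A <= psi b am.
Proof.
  intros H. destruct (Rtotal_order A am) as [K|[K|K]].
  - apply Rlt_le, psi_increasing; lra.
  - rewrite K; lra.
  - apply Rlt_le, psi_decreasing; lra.
Qed.

(** With [q = sqrt (1 - P / A)] and [s = b exp (A / 2)] the derivative is
    [b / 2 ((q + 1 / q) - (s + 1 / s))]. As [q] and [s] are at most 1, its sign is that of [s - q],
    that is of [s^2 - q^2 = (P - psi A) / A]. *)
Lemma Phi_derive P A : 0 < P -> P < A -> A <= L ->
  exists d, is_derive (fun A => Phi b A P) A d /\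
   (psi b A <= P -> 0 <= d) /\ (psi b A < P -> 0 < d) /\ (P <= psi b A -> d <= 0).
Proof.
  intros HP HA HL.
  assert (HS : 0 < A ^ 2 - A * P) by nra.
  set (S := sqrt (A ^ 2 - A * P)).
  assert (S0 : 0 < S) by (apply sqrt_lt_R0; auto).
  assert (SS : S * S = A ^ 2 - A * P) by (apply sqrt_sqrt; lra).
  set (q := S / A). set (s := b * exp (A / 2)).
  assert (EP := exp_pos (A / 2)).
  assert (Hq : 0 < q) by (apply Rdiv_lt_0_compat; lra).
  assert (Eq : q * q = 1 - P / A).
  { unfold q. replace (S / A * (S / A)) with (S * S / (A * A)) by (field; lra). rewrite SS. field. lra. }
  assert (PA : 0 < P / A) by (apply Rdiv_lt_0_compat; lra).
  assert (Hq1 : q < 1) by nra.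
  assert (Hs : 0 < s) by (unfold s; nra).
  assert (Hs1 : s <= 1) by (apply exp_half_le_1_iff; auto).
  assert (Ess : s * s = b ^ 2 * exp A).
  { unfold s. rewrite <- (exp_half A). ring. }
  assert (Hd : s * s - q * q = (P - psi b A) / A).
  { rewrite Ess, Eq. unfold psi. field. lra. }
  exists (b / 2 * ((s - q) * ((1 - q * s) / (q * s)))).
  assert (W : 0 < (1 - q * s) / (q * s)) by (apply Rdiv_lt_0_compat; nra).
  split.
  - unfold Phi. auto_derive.
    + nra.
    + replace (A * (A * 1) + - (A * P)) with (A ^ 2 - A * P) by ring. fold S.
      replace (- A * / 2) with (- A / 2) by reflexivity. change (A * / 2) with (A / 2).
      replace (exp (- A / 2)) with (b / s).
      2:{ unfold s. assert (N := exp_half_neg A). apply Rmult_eq_reg_r with (exp (A / 2)); [|lra].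
          rewrite N. field. lra. }
      replace (exp (A / 2)) with (s / b) by (unfold s; field; lra).
      replace S with (q * A) by (unfold q; field; lra).
      assert (EPq : P = A * (1 - q * q)) by (rewrite Eq; field; lra).
      rewrite EPq. field. repeat split; lra.
  - split; [|split]; intros K.
    + assert (0 <= s * s - q * q).
      { rewrite Hd. apply Rmult_le_pos; [lra|apply Rlt_le, Rinv_0_lt_compat; lra]. }
      assert (0 <= s - q) by nra.
      apply Rmult_le_pos; [lra|]. apply Rmult_le_pos; lra.
    + assert (0 < s * s - q * q).
      { rewrite Hd. apply Rmult_lt_0_compat; [lra|apply Rinv_0_lt_compat; lra]. }
      assert (0 < s - q) by nra.
      apply Rmult_lt_0_compat; [lra|]. apply Rmult_lt_0_compat; lra.
    + assert (s * s - q * q <= 0).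
      { rewrite Hd. assert (0 < / A) by (apply Rinv_0_lt_compat; lra). unfold Rdiv. nra. }
      assert (s - q <= 0) by nra.
      assert (0 <= b / 2 * ((q - s) * ((1 - q * s) / (q * s)))); [|lra].
      apply Rmult_le_pos; [lra|]. apply Rmult_le_pos; lra.
Qed.

Lemma Phi_continuous P A : continuity_pt (fun A => Phi b A P) A.
Proof.
  apply continuity_pt_filterlim. unfold Phi.
  apply (continuous_plus (V := R_NormedModule) (fun A => exp (- A / 2) - b ^ 2 * exp (A / 2))
    (fun A => b * sqrt (A ^ 2 - A * P))).
  - apply (ex_derive_continuous (K := R_AbsRing) (V := R_NormedModule)). auto_derive. auto.
  - apply (continuous_mult (K := R_AbsRing) (fun _ => b) (fun A => sqrt (A ^ 2 - A * P))); [apply continuous_const|].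
    apply (continuous_comp (fun A => A ^ 2 - A * P) sqrt).
    + apply (ex_derive_continuous (K := R_AbsRing) (V := R_NormedModule)). auto_derive. auto.
    + apply continuous_sqrt.
Qed.

Lemma Phi_increasing P A A' : 0 < P -> P <= A -> A <= A' -> A' <= L ->
  (forall x, A < x < A' -> psi b x <= P) -> Phi b A P <= Phi b A' P.
Proof.
  intros HP HA HAA HL H. apply (increasing_on (fun A => Phi b A P)); auto.
  - intros x Hx. destruct (Phi_derive P x) as [d [D [D1 _]]]; try lra. exists d; auto.
  - intros x _. apply Phi_continuous.
Qed.

Lemma Phi_strictly_increasing P A A' : 0 < P -> P <= A -> A < A' -> A' <= L ->
  (forall x, A < x < A' -> psi b x < P) -> Phi b A P < Phi b A' P.
Proof.
  intros HP HA HAA HL H. apply (strictly_increasing_on (fun A => Phi b A P)); auto.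
  - intros x Hx. destruct (Phi_derive P x) as [d [D [_ [D1 _]]]]; try lra. exists d; auto.
  - intros x _. apply Phi_continuous.
Qed.

Lemma Phi_decreasing P A A' : 0 < P -> P <= A -> A <= A' -> A' <= L ->
  (forall x, A < x < A' -> P <= psi b x) -> Phi b A' P <= Phi b A P.
Proof.
  intros HP HA HAA HL H. apply Ropp_le_cancel.
  apply (increasing_on (fun A => - Phi b A P)); auto.
  - intros x Hx. destruct (Phi_derive P x) as [d [D [_ [_ D1]]]]; try lra. exists (- d).
    split; [apply (is_derive_opp (fun A => Phi b A P)); auto|]. specialize (D1 (H x Hx)). lra.
  - intros x _. apply continuity_pt_opp, Phi_continuous.
Qed.

(** If [P] is below the maximum of [psi], then [psi] takes the value [P] at some [A1 < am < A2], and
    [Phi] increases up to [A1], decreases up to [A2] and increases again up to [L]. Otherwise it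
    increases throughout. *)
Lemma Phi_max P A : 0 < P -> P <= A -> A <= L ->
  Phi b A P <= Phi b L P \/
  exists A1, 0 < A1 < am /\ psi b A1 = P /\ Phi b A P <= phi b A1.
Proof.
  intros HP HA HL.
  destruct (Rle_dec (psi b am) P) as [K|K].
  - left. apply Phi_increasing; auto; [lra|]. intros x Hx.
    eapply Rle_trans; [apply psi_le_max; lra|exact K].
  - apply Rnot_le_lt in K.
    destruct (intermediate_value (psi b) 0 am P) as [A1 [H1 E1]]; [lra|apply ex_derive_psi|rewrite psi_0; lra|].
    destruct (intermediate_value (psi b) am L P) as [A2 [H2 E2]]; [lra|apply ex_derive_psi|rewrite psi_L; lra|].
    assert (H10 : 0 < A1) by (destruct (Req_dec A1 0) as [E|E]; [subst A1; rewrite psi_0 in E1; lra|lra]).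
    assert (H1m : A1 < am) by (destruct (Req_dec A1 am) as [E|E]; [subst A1; lra|lra]).
    assert (H2m : am < A2) by (destruct (Req_dec A2 am) as [E|E]; [subst A2; lra|lra]).
    assert (PA1 : P < A1) by (rewrite <- E1; apply psi_lt; auto).
    assert (EP : phi b A1 = Phi b A1 P) by (rewrite <- E1; symmetry; apply Phi_curve; lra).
    destruct (Rle_dec A A2) as [KA2|KA2].
    + right. exists A1. split; [lra|split; [auto|]]. rewrite EP.
      destruct (Rle_dec A A1) as [KA1|KA1].
      * apply Phi_increasing; auto; [lra|]. intros x Hx. rewrite <- E1. apply Rlt_le, psi_increasing; lra.
      * apply Phi_decreasing; auto; [lra|lra|]. intros x Hx.
        destruct (Rle_dec x am) as [Kx|Kx].
        -- rewrite <- E1. apply Rlt_le, psi_increasing; lra.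
        -- rewrite <- E2. apply Rlt_le, psi_decreasing; lra.
    + left. apply Phi_increasing; auto; [lra|]. intros x Hx.
      rewrite <- E2. apply Rlt_le, psi_decreasing; lra.
Qed.

(** For [P = psi A], [A] maximizes [Phi b x P] over [x] in [A, am], which allows [A] to be replaced
    by [A'] at the cost of an inequality. What remains is a comparison of
    [sqrt (B^2 - B P)] at [B = A'] and at [B = L], two functions of [P] of which the former
    decreases faster. *)
Lemma gap_decreasing A A' : 0 < A -> A < A' -> A' <= am ->
  phi b A' - Phi b L (psi b A') < phi b A - Phi b L (psi b A).
Proof.
  intros H0 H1 H2.
  rewrite <- !Phi_curve by lra.
  set (P := psi b A). set (P' := psi b A').
  assert (HP : 0 < P) by (apply psi_pos; lra).
  assert (HPP : P < P') by (apply psi_increasing; lra).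
  assert (HP' : P' < A') by (apply psi_lt; lra).
  assert (HPA : P < A) by (apply psi_lt; lra).
  assert (M : Phi b A' P <= Phi b A P).
  { apply Phi_decreasing; auto; try lra. intros x Hx. apply Rlt_le, psi_increasing; lra. }
  assert (D : Phi b A' P' - Phi b A' P < Phi b L P' - Phi b L P); [|lra].
  unfold Phi.
  assert (S : forall B Q, 0 < B -> 0 < Q -> Q < B -> sqrt (B ^ 2 - B * Q) = B * sqrt (1 - Q / B)).
  { intros B Q HB HQ HQB. replace (B ^ 2 - B * Q) with (B ^ 2 * (1 - Q / B)) by (field; lra).
    rewrite sqrt_mult_alt by apply pow2_ge_0. rewrite sqrt_pow2 by lra. reflexivity. }
  rewrite !S by lra.
  set (u := sqrt (1 - P / A')). set (u' := sqrt (1 - P' / A')).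
  set (w := sqrt (1 - P / L)). set (w' := sqrt (1 - P' / L)).
  assert (I : forall B Q, 0 < B -> Q < B -> 0 < 1 - Q / B).
  { intros B Q HB HQ. assert (0 < (B - Q) / B) by (apply Rdiv_lt_0_compat; lra).
    replace (1 - Q / B) with ((B - Q) / B) by (field; lra). auto. }
  assert (Eu : u * u = 1 - P / A') by (apply sqrt_sqrt, Rlt_le, I; lra).
  assert (Eu' : u' * u' = 1 - P' / A') by (apply sqrt_sqrt, Rlt_le, I; lra).
  assert (Ew : w * w = 1 - P / L) by (apply sqrt_sqrt, Rlt_le, I; lra).
  assert (Ew' : w' * w' = 1 - P' / L) by (apply sqrt_sqrt, Rlt_le, I; lra).
  assert (u0 : 0 < u) by (apply sqrt_lt_R0, I; lra).
  assert (u'0 : 0 < u') by (apply sqrt_lt_R0, I; lra).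
  assert (w0 : 0 < w) by (apply sqrt_lt_R0, I; lra).
  assert (w'0 : 0 < w') by (apply sqrt_lt_R0, I; lra).
  assert (IA : / L < / A') by (apply Rinv_lt_contravar; nra).
  assert (IL : 0 < / L) by (apply Rinv_0_lt_compat; lra).
  assert (uw : u < w) by (unfold Rdiv in *; nra).
  assert (uw' : u' < w') by (unfold Rdiv in *; nra).
  (* both increments are quotients with the numerator [P' - P] *)
  assert (E1 : A' * (u - u') = (P' - P) / (u + u')).
  { apply Rmult_eq_reg_r with (u + u'); [|lra].
    replace (A' * (u - u') * (u + u')) with (A' * (u * u - u' * u')) by ring.
    rewrite Eu, Eu'. field. split; lra. }
  assert (E2 : L * (w - w') = (P' - P) / (w + w')).
  { apply Rmult_eq_reg_r with (w + w'); [|lra].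
    replace (L * (w - w') * (w + w')) with (L * (w * w - w' * w')) by ring.
    rewrite Ew, Ew'. field. split; lra. }
  assert (E3 : (P' - P) / (w + w') < (P' - P) / (u + u')).
  { apply Rmult_lt_compat_l; [lra|]. apply Rinv_lt_contravar; [apply Rmult_lt_0_compat; lra|lra]. }
  rewrite <- E1, <- E2 in E3.
  assert (b * (L * (w - w')) < b * (A' * (u - u'))) by (apply Rmult_lt_compat_l; auto). lra.
Qed.

(** To the right of [am] the curve consists of local minima of [Phi], from which [Phi] increases up
    to [L]. *)
Lemma gap_negative A : am <= A -> A < L -> phi b A < Phi b L (psi b A).
Proof.
  intros H1 H2. rewrite <- Phi_curve by lra.
  apply Phi_strictly_increasing; try lra.
  - apply psi_pos; lra.
  - apply Rlt_le, psi_lt; lra.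
  - intros x Hx. apply psi_decreasing; lra.
Qed.

(** The difference of the squares of [phi] and of [Phi] at [L], which is free of square roots; it is
    the equation for [beta] up to a positive factor. *)
Definition gap_sqr (A : R) : R := phi b A ^ 2 - b ^ 2 * (L ^ 2 - L * psi b A).

Lemma gap_sqr_factor A : 0 <= A <= L -> gap_sqr A =
  (phi b A - Phi b L (psi b A)) * (phi b A + Phi b L (psi b A)).
Proof.
  intros H. unfold gap_sqr. rewrite <- Phi_L_sqr; [ring|].
  destruct (Rle_lt_or_eq_dec 0 A) as [K|K]; [lra|apply Rlt_le, Rlt_le_trans with A; [apply psi_lt; auto|lra]|].
  rewrite <- K, psi_0. apply Rlt_le, L_pos.
Qed.

Lemma phi_pos A : 0 <= A < L -> 0 < phi b A.
Proof.
  intros H. unfold phi. assert (E := b2_exp_lt A ltac:(lra)).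
  assert (E1 := exp_pos (- A / 2)). assert (E2 := exp_pos (A / 2)).
  assert (0 <= b ^ 2 * A * exp (A / 2)).
  { apply Rmult_le_pos; [apply Rmult_le_pos; [apply pow2_ge_0|lra]|lra]. }
  assert (0 < exp (- A / 2) * (1 - b ^ 2 * exp A)) by (apply Rmult_lt_0_compat; lra). lra.
Qed.

Lemma gap_sqr_sign A : 0 <= A < L ->
  (0 < gap_sqr A <-> Phi b L (psi b A) < phi b A) /\ (gap_sqr A = 0 <-> Phi b L (psi b A) = phi b A).
Proof.
  intros H. rewrite gap_sqr_factor by lra.
  assert (F1 := phi_pos A H). assert (F2 := Phi_L_nonneg (psi b A)).
  split; split; intros K; nra.
Qed.

(** The inequality [y < sinh y] at [y = L / 2]. *)
Lemma neg_ln_lt_sinh : b * L < 1 - b ^ 2.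
Proof.
  assert (HL := L_pos).
  assert (H : 0 < exp (L / 2) - exp (- (L / 2)) - 2 * (L / 2)).
  { replace 0 with ((fun y => exp y - exp (- y) - 2 * y) 0).
    2:{ simpl. rewrite Ropp_0. ring. }
    apply (strictly_increasing_on (fun y => exp y - exp (- y) - 2 * y)); [lra| |].
    - intros y Hy. exists (exp y + exp (- y) - 2). split; [auto_derive; auto; ring|].
      rewrite exp_Ropp. assert (E : 1 < exp y) by (rewrite <- exp_0; apply exp_increasing; lra).
      replace (exp y + / exp y - 2) with ((exp y - 1) ^ 2 * / exp y) by (field; lra).
      apply Rmult_lt_0_compat; [apply pow_lt; lra|apply Rinv_0_lt_compat; lra].
    - intros y _. apply derivable_continuity. intros x. auto_derive; auto. }
  replace (- (L / 2)) with (- L / 2) in H by field. rewrite exp_neg_L in H.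
  assert (E := b_exp_L). nra.
Qed.

(** At 0 the sign of the gap is given by [neg_ln_lt_sinh], at [am] by [gap_negative]. *)
Lemma beta_exists : exists beta, 0 < beta < am /\ gap_sqr beta = 0.
Proof.
  assert (HL := L_pos).
  assert (G0 : 0 < gap_sqr 0).
  { unfold gap_sqr. rewrite psi_0. unfold phi. replace (- 0 / 2) with 0 by field. rewrite exp_0.
    assert (B := neg_ln_lt_sinh). assert (0 < b * L) by nra.
    replace ((1 * (1 - b ^ 2 * 1) + b ^ 2 * 0 * exp (0 / 2)) ^ 2) with ((1 - b ^ 2) ^ 2) by ring. nra. }
  assert (Gm : gap_sqr am < 0).
  { rewrite gap_sqr_factor by lra. assert (K := gap_negative am ltac:(lra) ltac:(lra)).
    assert (F1 := phi_pos am ltac:(lra)). assert (F2 := Phi_L_nonneg (psi b am)). nra. }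
  destruct (intermediate_value gap_sqr 0 am 0) as [beta [H E]]; [lra| |lra|].
  { intros x. unfold gap_sqr, phi, psi. auto_derive. auto. }
  exists beta. split; auto. split.
  - destruct (Req_dec beta 0) as [K|K]; [subst beta; lra|lra].
  - destruct (Req_dec beta am) as [K|K]; [subst beta; lra|lra].
Qed.

Variable beta : R.
Hypothesis beta_bounds : 0 < beta < am.
Hypothesis beta_eq : gap_sqr beta = 0.

Lemma beta_gap : Phi b L (psi b beta) = phi b beta.
Proof. apply gap_sqr_sign; auto. lra. Qed.

Lemma gap_pos_iff A : 0 < A < am -> (Phi b L (psi b A) < phi b A <-> A < beta).
Proof.
  intros H. assert (E := beta_gap). split; intros K.
  - apply Rnot_le_lt. intros [T|T].
    + assert (G := gap_decreasing beta A). lra.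
    + subst A. lra.
  - assert (G := gap_decreasing A beta). lra.
Qed.

Lemma beta_unique A : 0 < A < L -> gap_sqr A = 0 -> A = beta.
Proof.
  intros H E. apply gap_sqr_sign in E; [|lra].
  destruct (Rle_dec am A) as [K|K].
  - assert (G := gap_negative A). lra.
  - assert (EB := beta_gap). destruct (Rtotal_order A beta) as [T|[T|T]]; auto.
    + assert (G := gap_decreasing A beta). lra.
    + assert (G := gap_decreasing beta A). lra.
Qed.

Lemma alpha_solution_iff v A : alpha_solution b v A <-> 0 < A < L /\ phi b A ^ 2 = v * psi b A.
Proof.
  unfold alpha_solution. fold L. split; intros [H E]; split; auto.
  - assert (P := psi_pos A H). rewrite phi_sqr. unfold psi in *.
    apply (f_equal (fun x => x * (A * (1 - b ^ 2 * exp A)))) in E.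
    unfold Rdiv in E. rewrite Rmult_assoc, Rinv_l in E by lra. lra.
  - assert (P := psi_pos A H). rewrite phi_sqr in E. unfold psi in *.
    apply Rmult_eq_reg_r with (A * (1 - b ^ 2 * exp A)); [|lra].
    unfold Rdiv. rewrite Rmult_assoc, Rinv_l by lra. lra.
Qed.

(** The arithmetic-geometric inequality for the two terms of [phi]; it is the reason for the
    threshold [4 b^2]. *)
Lemma phi_sqr_ge A : 0 <= A -> 4 * b ^ 2 * psi b A <= phi b A ^ 2.
Proof.
  intros HA. unfold phi, psi.
  assert (N := exp_half_neg A). assert (E := exp_half A).
  set (p := exp (- A / 2) * (1 - b ^ 2 * exp A)). set (q := b ^ 2 * A * exp (A / 2)).
  replace (4 * b ^ 2 * (A * (1 - b ^ 2 * exp A))) with (4 * (p * q)).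
  - assert (Q := pow2_ge_0 (p - q)). nra.
  - unfold p, q. replace (4 * (exp (- A / 2) * (1 - b ^ 2 * exp A) * (b ^ 2 * A * exp (A / 2)))) with
      (4 * b ^ 2 * (A * (1 - b ^ 2 * exp A)) * (exp (- A / 2) * exp (A / 2))) by ring.
    rewrite N. ring.
Qed.

(** The two terms of [phi] coincide at [am]. *)
Lemma phi_sqr_am : phi b am ^ 2 = 4 * b ^ 2 * psi b am.
Proof.
  unfold phi, psi. assert (N := exp_half_neg am). assert (E := exp_half am).
  assert (K : 1 - b ^ 2 * exp am = am * (b ^ 2 * exp am)) by lra.
  rewrite K.
  replace (exp (- am / 2) * (am * (b ^ 2 * exp am))) with (b ^ 2 * am * exp (am / 2)).
  - rewrite <- E. ring.
  - rewrite <- E. replace (exp (- am / 2) * (am * (b ^ 2 * (exp (am / 2) * exp (am / 2))))) with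
     ((exp (- am / 2) * exp (am / 2)) * (b ^ 2 * am * exp (am / 2))) by ring. rewrite N. ring.
Qed.

Lemma alpha_exists v : 4 * b ^ 2 <= v -> exists A, alpha_solution b v A.
Proof.
  intros Hv.
  destruct (intermediate_value (fun A => phi b A ^ 2 - v * psi b A) 0 am 0) as [A [H E]].
  - lra.
  - intros x. unfold phi, psi. auto_derive. auto.
  - right. rewrite psi_0, phi_sqr_am. assert (P := psi_pos am am_bounds).
    split; [nra|]. rewrite Rmult_0_r, Rminus_0_r. apply pow2_ge_0.
  - exists A. apply alpha_solution_iff. split; [|lra]. split; [|lra].
    destruct (Req_dec A 0) as [K|K]; [|lra]. subst A. rewrite psi_0 in E.
    assert (F := phi_pos 0 ltac:(lra)). nra.
Qed.

Lemma alpha_solution_v v A : alpha_solution b v A -> 4 * b ^ 2 <= v.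
Proof.
  intros H. apply alpha_solution_iff in H. destruct H as [H E].
  assert (P := psi_pos A H). assert (Q := phi_sqr_ge A ltac:(lra)). nra.
Qed.

(** The interior critical point beats the zero-free discs only before [beta]. *)
Lemma feasible_cases P y : 0 < P -> feasible b P y -> P <= L /\
  (y <= Phi b L P \/ Phi b L P < y /\ exists A, 0 < A < beta /\ psi b A = P /\ y <= phi b A).
Proof.
  intros HP [A [H0 [H1 [H2 H3]]]]. apply exp_half_le_1_iff in H1. split; [lra|].
  destruct (Rle_dec y (Phi b L P)) as [K|K]; [left; auto|right].
  apply Rnot_le_lt in K. split; auto.
  destruct (Phi_max P A HP H2 H1) as [M|[A1 [M1 [M2 M3]]]]; [lra|].
  exists A1. split; [|split; [auto|lra]]. split; [lra|].
  apply gap_pos_iff; auto. rewrite M2. lra.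
Qed.

(** If not, [y] exceeds the zero-free bound at [P = p^2] but not [phi A], for some [A < beta] with
    [psi A = P]. So [phi^2 - v psi] is nonnegative at [A]; and it is nonpositive at [beta], where
    [phi] is the zero-free bound, because the ratio of the square of that bound to [P] decreases in
    [P]. A zero in between solves the equation for [alpha]. *)
Lemma feasible_zero_free p y v :
  0 < p -> 0 <= y -> y ^ 2 = v * p ^ 2 -> (forall A, alpha_solution b v A -> beta < A) ->
  feasible b (p ^ 2) y -> p ^ 2 / L + y ^ 2 / (b ^ 2 * L ^ 2) <= 1.
Proof.
  intros Hp Hy Hv Hno HF.
  assert (HP : 0 < p ^ 2) by (apply pow_lt; auto).
  assert (HL := L_pos).
  destruct (feasible_cases _ _ HP HF) as [HPL [K|[K [A [HA [EA KA]]]]]].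
  - assert (S := Phi_L_sqr (p ^ 2) HPL).
    assert (Y2 : y ^ 2 <= b ^ 2 * (L ^ 2 - L * p ^ 2)) by (rewrite <- S; apply pow_incr; lra).
    assert (D : 0 < b ^ 2 * L ^ 2) by (apply Rmult_lt_0_compat; apply pow_lt; auto).
    apply Rmult_le_reg_r with (b ^ 2 * L ^ 2); auto.
    replace ((p ^ 2 / L + y ^ 2 / (b ^ 2 * L ^ 2)) * (b ^ 2 * L ^ 2)) with (b ^ 2 * L * p ^ 2 + y ^ 2)
      by (field; lra). nra.
  - exfalso.
    assert (Pb : 0 < psi b beta) by (apply psi_pos; lra).
    assert (PP : p ^ 2 < psi b beta) by (rewrite <- EA; apply psi_increasing; lra).
    assert (S := Phi_L_sqr (p ^ 2) HPL).
    assert (G1 : 0 <= phi b A ^ 2 - v * psi b A).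
    { rewrite EA, <- Hv. assert (y ^ 2 <= phi b A ^ 2) by (apply pow_incr; lra). lra. }
    assert (G2 : phi b beta ^ 2 - v * psi b beta <= 0).
    { assert (EB := beta_eq). unfold gap_sqr in EB.
      assert (Y2 : b ^ 2 * (L ^ 2 - L * p ^ 2) < v * p ^ 2).
      { rewrite <- S, <- Hv. assert (N := Phi_L_nonneg (p ^ 2)). nra. }
      assert (Bp : 0 < b ^ 2) by (apply pow_lt; auto).
      assert (T1 : b ^ 2 * L ^ 2 < (v + b ^ 2 * L) * p ^ 2) by lra.
      assert (0 < b ^ 2 * L ^ 2) by (apply Rmult_lt_0_compat; [auto|apply pow_lt; auto]).
      assert (0 < v + b ^ 2 * L) by nra.
      assert ((v + b ^ 2 * L) * p ^ 2 < (v + b ^ 2 * L) * psi b beta) by (apply Rmult_lt_compat_l; auto).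
      lra. }
    destruct (intermediate_value (fun A => phi b A ^ 2 - v * psi b A) A beta 0) as [A' [H E]].
    + lra.
    + intros x. unfold phi, psi. auto_derive. auto.
    + right; lra.
    + assert (HS : alpha_solution b v A') by (apply alpha_solution_iff; lra).
      specialize (Hno A' HS). lra.
Qed.

(** For the solution [A] of the equation, [(psi A, phi A)] lies in the direction considered, and
    [phi A] is the maximum of [Phi] over its first variable for [P = psi A]. A longer vector in the
    same direction would have a larger [P], for which this maximum is not larger. *)
Lemma feasible_one_zero P y v A : 0 < A <= beta -> alpha_solution b v A ->
  0 < P -> 0 <= y -> y ^ 2 = v * P -> feasible b P y -> P <= psi b A.
Proof.
  intros HA HS HP Hy Hv [A' [F0 [F1 [F2 F3]]]]. apply exp_half_le_1_iff in F1.
  apply alpha_solution_iff in HS. destruct HS as [_ E].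
  apply Rnot_lt_le. intros Hlt.
  assert (PA : 0 < psi b A) by (apply psi_pos; lra).
  assert (B1 : Phi b A' P <= Phi b A' (psi b A)) by (apply Phi_antitone; lra).
  assert (B2 : Phi b A' (psi b A) <= phi b A).
  { destruct (Phi_max (psi b A) A' PA) as [M|[A1 [M1 [M2 M3]]]]; try lra.
    - eapply Rle_trans; [exact M|]. destruct HA as [HA [HA'|HA']].
      + apply Rlt_le, gap_pos_iff; lra.
      + rewrite HA'. right. apply beta_gap.
    - assert (T : A1 = A); [|rewrite T in M3; exact M3].
      destruct (Rtotal_order A A1) as [T|[T|T]]; [|auto|].
      + assert (Q := psi_increasing A A1). lra.
      + assert (Q := psi_increasing A1 A). lra. }
  assert (v0 : 0 < v).
  { assert (F : 0 < phi b A ^ 2) by (apply pow_lt, phi_pos; lra).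
    apply Rmult_lt_reg_r with (psi b A); lra. }
  assert (y ^ 2 <= phi b A ^ 2) by (apply pow_incr; lra). nra.
Qed.

End Fixed_b.

(** For [P = 0] the derivative of [Phi] in [A] is
    [- (p - b)^2 / (2 p)] with [p = exp (- A / 2)], so the maximum is at [A = 0]. *)
Lemma feasible_vertical b y : 0 < b -> feasible b 0 y -> y <= 1 - b ^ 2.
Proof.
  intros hb [A [F0 [F1 [F2 F3]]]]. eapply Rle_trans; [exact F3|].
  unfold Phi. rewrite Rmult_0_r, Rminus_0_r, sqrt_pow2 by auto.
  assert (H : - (1 - b ^ 2) <= - (exp (- A / 2) - b ^ 2 * exp (A / 2) + b * A)); [|lra].
  replace (- (1 - b ^ 2)) with ((fun A => - (exp (- A / 2) - b ^ 2 * exp (A / 2) + b * A)) 0).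
  2:{ simpl. replace (- 0 / 2) with 0 by field. replace (0 / 2) with 0 by field. rewrite exp_0. ring. }
  apply (increasing_on (fun A => - (exp (- A / 2) - b ^ 2 * exp (A / 2) + b * A))); auto.
  - intros x Hx. exists (/ 2 * (exp (- x / 2) + b ^ 2 * exp (x / 2)) - b). split.
    + auto_derive; auto. unfold Rdiv. field.
    + assert (N := exp_half_neg x). set (p := exp (- x / 2)) in *. set (q := exp (x / 2)) in *.
      assert (Hp : 0 < p) by apply exp_pos.
      assert (Hq : q = / p) by (apply Rmult_eq_reg_l with p; [rewrite N, Rinv_r; lra|lra]).
      rewrite Hq. replace (/ 2 * (p + b ^ 2 * / p) - b) with (/ 2 * ((p - b) ^ 2 * / p)) by (field; lra).
      apply Rmult_le_pos; [lra|]. apply Rmult_le_pos; [apply pow2_ge_0|apply Rlt_le, Rinv_0_lt_compat; auto].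
  - intros x _. apply derivable_continuity. intros z. auto_derive. auto.
Qed.

Lemma kobayashi_sqr_Finite D (z zeta : C2) kappa : kobayashi D z zeta = Finite kappa ->
  kobayashi_sqr D z zeta = Finite (kappa * kappa).
Proof. intros H. unfold kobayashi_sqr. rewrite H. reflexivity. Qed.

Lemma polar_form (z : C) : exists w, Cmod w = 1 /\ z = (RtoC (Cmod z) * w)%C.
Proof.
  destruct (Ceq_dec z (RtoC 0)) as [E|E].
  - exists (RtoC 1). rewrite Cmod_1. split; auto. rewrite E, Cmod_0. ring.
  - assert (P : 0 < Cmod z) by (apply Cmod_gt_0; auto).
    assert (N : RtoC (Cmod z) <> RtoC 0) by (apply RtoC_neq; lra).
    exists (z / RtoC (Cmod z))%C. split.
    + rewrite Cmod_div, Cmod_R, Rabs_pos_eq by (auto; lra). field. lra.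
    + field. auto.
Qed.

Lemma le_1_of_sqr x : 0 <= x -> x * x <= 1 -> x <= 1.
Proof. intros. nra. Qed.

(** * The three cases of the theorem *)

(** The vector [u (X, Y)] lies in the domain if and only if this is less than 1. *)
Definition gauge_fun (X Y u : R) : R := (Y * u) ^ 2 * exp ((X * u) ^ 2).

Lemma gauge_fun_increasing X Y u u' : 0 < Y -> 0 <= u -> u < u' -> gauge_fun X Y u < gauge_fun X Y u'.
Proof.
  intros HY Hu Huu. unfold gauge_fun.
  assert (E : exp ((X * u) ^ 2) <= exp ((X * u') ^ 2)).
  { assert (H : (X * u) ^ 2 <= (X * u') ^ 2).
    { rewrite !Rpow_mult_distr. apply Rmult_le_compat_l; [apply pow2_ge_0|apply pow_incr; lra]. }
    destruct H as [H|H]; [apply Rlt_le, exp_increasing; auto|rewrite H; lra]. }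
  assert (P := exp_pos ((X * u) ^ 2)).
  assert (S : (Y * u) ^ 2 < (Y * u') ^ 2).
  { rewrite !Rpow_mult_distr. apply Rmult_lt_compat_l; [apply pow_lt; auto|]. nra. }
  assert (0 <= (Y * u) ^ 2) by apply pow2_ge_0. nra.
Qed.

Lemma gauge_fun_lt_iff X Y u u' : 0 < Y -> 0 <= u -> 0 <= u' ->
  (gauge_fun X Y u < gauge_fun X Y u' <-> u < u').
Proof.
  intros HY Hu Hu'. split; intros H; [|apply gauge_fun_increasing; auto].
  apply Rnot_le_lt. intros [K|K].
  - assert (T := gauge_fun_increasing X Y u' u HY Hu' K). lra.
  - subst; lra.
Qed.

Lemma gauge_exists X Y : 0 < Y -> exists u, 0 < u /\ gauge_fun X Y u = 1.
Proof.
  intros HY. assert (IY : 0 < / Y) by (apply Rinv_0_lt_compat; auto).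
  (* [(Y u)^2] alone reaches 1 at [u = 1 / Y] *)
  destruct (intermediate_value (gauge_fun X Y) 0 (/ Y) 1) as [u [H E]].
  - lra.
  - intros x. unfold gauge_fun. auto_derive. auto.
  - left. unfold gauge_fun. split.
    + replace ((Y * 0) ^ 2) with 0 by ring. lra.
    + rewrite Rinv_r by lra. rewrite <- exp_0 at 1. rewrite pow1, Rmult_1_l.
      destruct (pow2_ge_0 (X * / Y)) as [K|K]; [apply Rlt_le, exp_increasing; auto|rewrite K; lra].
  - exists u. split; auto. destruct (Req_dec u 0) as [K|K]; [|lra].
    subst u. unfold gauge_fun in E. replace ((Y * 0) ^ 2) with 0 in E by ring. lra.
Qed.

Lemma minkowski_equation_iff (X Y : C) t : 0 < Cmod Y -> 0 < t ->
  minkowski_equation X Y t <-> gauge_fun (Cmod X) (Cmod Y) (/ t) = 1.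
Proof.
  intros HY Ht. unfold minkowski_equation.
  assert (It : 0 < / t) by (apply Rinv_0_lt_compat; auto).
  assert (G : 0 < (Cmod Y * / t) ^ 2) by (apply pow_lt; nra).
  assert (E : Cmod X ^ 2 / t ^ 2 + ln (Cmod Y ^ 2) - 2 * ln t = ln (gauge_fun (Cmod X) (Cmod Y) (/ t))).
  { unfold gauge_fun. rewrite ln_mult, ln_exp by (auto; apply exp_pos).
    rewrite (Rpow_mult_distr (Cmod Y)), ln_mult by (apply pow_lt; auto).
    replace (ln ((/ t) ^ 2)) with (- (2 * ln t)).
    - field. lra.
    - replace ((/ t) ^ 2) with (/ t * / t) by ring. rewrite ln_mult, ln_Rinv by auto. ring. }
  rewrite E. assert (P : 0 < gauge_fun (Cmod X) (Cmod Y) (/ t)).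
  { unfold gauge_fun. apply Rmult_lt_0_compat; [auto|apply exp_pos]. }
  split; intros H.
  - apply ln_inv; try lra. rewrite ln_1; auto.
  - rewrite H. apply ln_1.
Qed.

Lemma D11_scal_iff (X Y : C) t : 0 < t ->
  D11 (scal (RtoC (/ t)) ((X, Y) : C2)) <-> gauge_fun (Cmod X) (Cmod Y) (/ t) < 1.
Proof.
  intros Ht. assert (It : 0 < / t) by (apply Rinv_0_lt_compat; auto).
  unfold D11, gauge_fun.
  change (fst (scal (RtoC (/ t)) ((X, Y) : C2))) with (RtoC (/ t) * X)%C.
  change (snd (scal (RtoC (/ t)) ((X, Y) : C2))) with (RtoC (/ t) * Y)%C.
  rewrite !Cmod_mult, !Cmod_R, !Rabs_pos_eq by lra.
  rewrite (Rmult_comm (Cmod X)), (Rmult_comm (Cmod Y)).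
  assert (P := exp_pos ((/ t * Cmod X) ^ 2)). rewrite exp_Ropp.
  split; intros H.
  - apply Rmult_lt_reg_r with (/ exp ((/ t * Cmod X) ^ 2)); [apply Rinv_0_lt_compat; auto|].
    rewrite Rmult_assoc, Rinv_r, Rmult_1_r by lra. lra.
  - apply Rmult_lt_reg_r with (exp ((/ t * Cmod X) ^ 2)); auto. rewrite Rinv_l; lra.
Qed.

Lemma feasible_centre X Y s : 0 < s -> 0 < Y -> feasible 0 ((s * X) ^ 2) (s * Y) ->
  gauge_fun X Y s <= 1.
Proof.
  intros Hs HY [A [H0 [_ [H1 H2]]]]. unfold Phi in H2. unfold gauge_fun.
  replace (exp (- A / 2) - 0 ^ 2 * exp (A / 2) + 0 * sqrt (A ^ 2 - A * (s * X) ^ 2))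
    with (exp (- A / 2)) in H2 by ring.
  assert (E : exp (- A / 2) * exp (- A / 2) = exp (- A)) by (rewrite <- exp_plus; f_equal; field).
  assert (P := exp_pos (- A / 2)).
  assert (S : (Y * s) ^ 2 <= exp (- A)).
  { rewrite <- E. replace ((Y * s) ^ 2) with ((s * Y) * (s * Y)) by ring.
    apply Rmult_le_compat; nra. }
  apply Rle_trans with (exp (- A) * exp A).
  - apply Rmult_le_compat; [apply pow2_ge_0|apply Rlt_le, exp_pos|auto|].
    replace ((X * s) ^ 2) with ((s * X) ^ 2) by ring.
    destruct H1 as [H1|H1]; [apply Rlt_le, exp_increasing; auto|rewrite H1; lra].
  - rewrite <- exp_plus. replace (- A + A) with 0 by ring. rewrite exp_0. lra.
Qed.

Lemma kobayashi_centre (X Y : C) u : 0 < Cmod Y -> 0 < u -> gauge_fun (Cmod X) (Cmod Y) u = 1 ->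
  kobayashi D11 ((RtoC 0, RtoC 0) : C2) ((X, Y) : C2) = Finite (/ u).
Proof.
  intros HY Hu E. assert (Iu : 0 < / u) by (apply Rinv_0_lt_compat; auto).
  apply kobayashi_attained; try lra.
  - intros s Hs HF. apply feasible_centre in HF; auto.
    assert (s <= u).
    { apply Rnot_lt_le. intros K. apply (gauge_fun_increasing (Cmod X) (Cmod Y)) in K; lra. }
    apply Rmult_le_reg_r with u; auto. rewrite Rmult_assoc, Rinv_l; lra.
  - destruct (polar_form X) as [wX [UX EX]]. destruct (polar_form Y) as [wY [UY EY]].
    assert (X0 := Cmod_ge_0 X).
    set (p := Cmod X * u). assert (Hp : 0 <= p) by (unfold p; nra).
    assert (EY2 : Cmod Y * u = exp (- p ^ 2 / 2)).
    { unfold gauge_fun in E. fold p in E.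
      assert (N := exp_half_neg (p ^ 2)). assert (H := exp_half (p ^ 2)).
      assert (P := exp_pos (p ^ 2 / 2)).
      assert (Q : 0 < Cmod Y * u * exp (p ^ 2 / 2)) by (repeat apply Rmult_lt_0_compat; auto).
      assert (Q2 : (Cmod Y * u * exp (p ^ 2 / 2)) * (Cmod Y * u * exp (p ^ 2 / 2)) = 1).
      { rewrite <- E, <- H. ring. }
      assert (Q3 : Cmod Y * u * exp (p ^ 2 / 2) = 1) by nra.
      apply Rmult_eq_reg_r with (exp (p ^ 2 / 2)); lra. }
    rewrite <- (Rabs_pos_eq (/ u)), <- Cmod_R by lra.
    apply (disc_competitor 0 (p ^ 2) (RtoC 0) wX wY); try lra.
    + apply pow2_ge_0.
    + rewrite Cmod_0, UX. lra.
    + auto.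
    + rewrite sqrt_pow2 by auto. rewrite EX at 1. unfold p.
      rewrite Cmult_assoc, <- RtoC_mult. do 2 f_equal. field. lra.
    + rewrite Rmult_0_l. replace (1 - 0 ^ 2) with 1 by ring. rewrite Rmult_1_r, <- EY2.
      rewrite EY at 1. rewrite Cmult_0_r.
      replace (RtoC (Cmod Y * u) * wY - 0)%C with (RtoC (Cmod Y * u) * wY)%C by ring.
      rewrite Cmult_assoc, <- RtoC_mult. do 2 f_equal. field. lra.
Qed.

(** The domain contains the complex line [w = 0]. *)
Lemma kobayashi_centre_horizontal (X : C) :
  kobayashi D11 ((RtoC 0, RtoC 0) : C2) ((X, RtoC 0) : C2) = Finite 0.
Proof.
  apply is_glb_Rbar_unique. split.
  - intros r Hr. simpl. destruct (competitor_feasible 0 X (RtoC 0) r) as [H _]; auto. lra.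
  - intros l Hl.
    assert (K : forall r, 0 < r -> Rbar_le l (Finite r)).
    { intros r Hr. apply Hl.
      assert (D1 : forall z, cderiv (fun t => X / RtoC r * t)%C z (X / RtoC r * 1)%C).
      { intros z. apply deriv_along_scal, deriv_along_inc. }
      assert (D2 : forall z, cderiv (fun _ => RtoC 0) z (RtoC 0)).
      { intros z. apply deriv_along_const. }
      exists (fun t => ((X / RtoC r * t)%C, RtoC 0) : C2), ((X / RtoC r * 1)%C, RtoC 0), (RtoC r).
      split; [|split; [|split; [|split; [|split]]]].
      - intros z _. exists ((X / RtoC r * 1)%C, RtoC 0). apply is_derive_C2_iff; cbn [fst snd]. auto.
      - intros t _. unfold D11; cbn [fst snd]. rewrite Cmod_0. replace (0 ^ 2) with 0 by ring. apply exp_pos.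
      - apply injective_projections; simpl; auto. ring.
      - apply is_derive_C2_iff; cbn [fst snd]. auto.
      - apply injective_projections; simpl.
        + change (RtoC r * (X / RtoC r * 1) = X)%C. field. apply RtoC_neq; lra.
        + change (RtoC r * 0 = 0)%C. ring.
      - rewrite Cmod_R, Rabs_pos_eq; lra. }
    destruct l as [l| |]; simpl in *; auto.
    + apply Rnot_lt_le. intros Hl0. specialize (K (l / 2)). lra.
    + apply (K 1). lra.
Qed.

Lemma minkowski_value (X Y : C) u : 0 < Cmod Y -> 0 < u -> gauge_fun (Cmod X) (Cmod Y) u = 1 ->
  minkowski D11 ((X, Y) : C2) = Finite (/ u).
Proof.
  intros HY Hu E. assert (Iu : 0 < / u) by (apply Rinv_0_lt_compat; auto).
  assert (H : forall t, 0 < t -> (D11 (scal (RtoC (/ t)) ((X, Y) : C2)) <-> / u < t)).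
  { intros t Ht. rewrite D11_scal_iff by auto. rewrite <- E.
    assert (It : 0 < / t) by (apply Rinv_0_lt_compat; auto).
    rewrite gauge_fun_lt_iff by lra.
    split; intros K.
    - rewrite <- (Rinv_inv t). apply Rinv_lt_contravar; [nra|auto].
    - rewrite <- (Rinv_inv u). apply Rinv_lt_contravar; [nra|auto]. }
  apply is_glb_Rbar_unique. split.
  - intros t [Ht HD]. simpl. apply Rlt_le, H; auto.
  - intros l Hl.
    assert (K : forall e, 0 < e -> Rbar_le l (Finite (/ u + e))).
    { intros e He. apply Hl. split; [lra|]. apply H; lra. }
    destruct l as [l| |]; simpl in *; auto.
    + apply Rnot_lt_le. intros Hl0. specialize (K ((l - / u) / 2)). lra.
    + apply (K 1). lra.
Qed.

Lemma kobayashi_vertical b (Y : C) : 0 < b < 1 ->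
  kobayashi D11 ((RtoC 0, RtoC b) : C2) ((RtoC 0, Y) : C2) = Finite (Cmod Y / (1 - b ^ 2)).
Proof.
  intros Hb. assert (B : 0 < 1 - b ^ 2) by nra. assert (Y0 := Cmod_ge_0 Y).
  assert (K0 : 0 <= Cmod Y / (1 - b ^ 2)).
  { apply Rmult_le_pos; [auto|apply Rlt_le, Rinv_0_lt_compat; auto]. }
  apply kobayashi_attained; auto; try lra.
  - intros s Hs HF. rewrite Cmod_0 in HF. replace ((s * 0) ^ 2) with 0 in HF by ring.
    apply feasible_vertical in HF; [|lra].
    apply Rmult_le_reg_r with (1 - b ^ 2); auto.
    replace (s * (Cmod Y / (1 - b ^ 2)) * (1 - b ^ 2)) with (s * Cmod Y) by (field; lra). lra.
  - destruct (polar_form Y) as [w [U E]].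
    rewrite <- (Rabs_pos_eq (Cmod Y / (1 - b ^ 2))), <- Cmod_R by auto.
    apply (disc_competitor b 0 (RtoC 0) (RtoC 0) w); try lra; auto.
    + replace (0 / 2) with 0 by field. rewrite exp_0. lra.
    + rewrite Cmod_0. lra.
    + ring.
    + rewrite E at 1. replace (- 0 / 2) with 0 by field. replace (0 / 2) with 0 by field. rewrite exp_0.
      rewrite Cmult_0_r. replace (RtoC (1 * (1 - (b * 1) ^ 2)) * w - 0)%C with (RtoC (1 - b ^ 2) * w)%C.
      * rewrite Cmult_assoc, <- RtoC_mult. do 2 f_equal. field. lra.
      * replace (1 * (1 - (b * 1) ^ 2)) with (1 - b ^ 2) by ring. ring.
Qed.

Lemma zero_free_value_eq b (X Y : C) : 0 < b < 1 ->
  zero_free_value b X Y =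
  Cmod X ^ 2 / (- 2 * ln b) + Cmod Y ^ 2 / (b ^ 2 * (- 2 * ln b) ^ 2).
Proof.
  intros Hb. assert (HL := L_pos b ltac:(lra) ltac:(lra)). unfold zero_free_value. field. lra.
Qed.

(** The disc with [A = L], where the vector is on the boundary of the ball of admissible [(c, e)]. *)
Lemma zero_free_competitor b (X Y : C) : 0 < b < 1 -> 0 < zero_free_value b X Y ->
  kobayashi_competitor D11 ((RtoC 0, RtoC b) : C2) ((X, Y) : C2) (sqrt (zero_free_value b X Y)).
Proof.
  intros Hb HZ. assert (HL := L_pos b ltac:(lra) ltac:(lra)).
  set (L := - 2 * ln b) in *. set (k := sqrt (zero_free_value b X Y)).
  assert (Hk : 0 < k) by (apply sqrt_lt_R0; auto).
  assert (Ek : k * k = zero_free_value b X Y) by (apply sqrt_sqrt; lra).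
  assert (HsL : 0 < sqrt L) by (apply sqrt_lt_R0; auto).
  assert (EsL : sqrt L * sqrt L = L) by (apply sqrt_sqrt; lra).
  assert (ebL : b * exp (L / 2) = 1) by (apply b_exp_L; lra).
  assert (N1 : RtoC k <> RtoC 0) by (apply RtoC_neq; lra).
  assert (N2 : RtoC (b * L) <> RtoC 0) by (apply RtoC_neq; nra).
  assert (N3 : RtoC (sqrt L) <> RtoC 0) by (apply RtoC_neq; lra).
  rewrite <- (Rabs_pos_eq k), <- Cmod_R by lra.
  apply (disc_competitor b L (- (Y / (RtoC k * RtoC (b * L))))%C (X / (RtoC k * RtoC (sqrt L)))%C (RtoC 1)); try lra.
  - rewrite Cmod_opp, !Cmod_div, !Cmod_mult, !Cmod_R by (apply Cmult_neq_0; auto).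
    rewrite !Rabs_pos_eq by nra. right.
    apply Rmult_eq_reg_r with (k * k); [|nra].
    rewrite Ek at 2. rewrite zero_free_value_eq by auto. fold L.
    replace ((Cmod Y / (k * (b * L))) ^ 2 + (Cmod X / (k * sqrt L)) ^ 2) with
      (/ (k * k) * (Cmod Y ^ 2 / (b ^ 2 * L ^ 2) + Cmod X ^ 2 / (sqrt L * sqrt L))) by (field; lra).
    rewrite EsL. field. lra.
  - apply Cmod_1.
  - field. auto.
  - rewrite ebL. replace (exp (- L / 2) * (1 - 1 ^ 2)) with 0 by ring. field. auto.
Qed.

Lemma kobayashi_zero_free b beta am (X Y : C) v : 0 < b < 1 ->
  0 < am < - 2 * ln b -> (1 + am) * (b ^ 2 * exp am) = 1 ->
  0 < beta < am -> gap_sqr b beta = 0 ->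
  X <> RtoC 0 -> v = Cmod Y ^ 2 / Cmod X ^ 2 ->
  (forall A, alpha_solution b v A -> beta < A) ->
  kobayashi_sqr D11 ((RtoC 0, RtoC b) : C2) ((X, Y) : C2) = Finite (zero_free_value b X Y).
Proof.
  intros Hb Ham Eam Hbeta Ebeta HX Hv Hno.
  assert (HL := L_pos b ltac:(lra) ltac:(lra)).
  assert (X0 : 0 < Cmod X) by (apply Cmod_gt_0; auto). assert (Y0 := Cmod_ge_0 Y).
  assert (HZ : 0 < zero_free_value b X Y).
  { rewrite zero_free_value_eq by auto.
    assert (0 < Cmod X ^ 2 / (- 2 * ln b)) by (apply Rdiv_lt_0_compat; [apply pow_lt; auto|auto]).
    assert (0 <= Cmod Y ^ 2 / (b ^ 2 * (- 2 * ln b) ^ 2)).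
    { apply Rmult_le_pos; [apply pow2_ge_0|]. apply Rlt_le, Rinv_0_lt_compat.
      apply Rmult_lt_0_compat; apply pow_lt; lra. }
    lra. }
  assert (Ek : sqrt (zero_free_value b X Y) * sqrt (zero_free_value b X Y) = zero_free_value b X Y)
    by (apply sqrt_sqrt; lra).
  rewrite <- Ek. apply kobayashi_sqr_Finite, kobayashi_attained; try lra.
  - apply sqrt_pos.
  - intros s Hs HF. apply le_1_of_sqr; [apply Rmult_le_pos; [lra|apply sqrt_pos]|].
    replace (s * sqrt (zero_free_value b X Y) * (s * sqrt (zero_free_value b X Y))) with
      (s * s * (sqrt (zero_free_value b X Y) * sqrt (zero_free_value b X Y))) by ring.
    rewrite Ek, zero_free_value_eq by auto.
    replace (s * s * (Cmod X ^ 2 / (- 2 * ln b) + Cmod Y ^ 2 / (b ^ 2 * (- 2 * ln b) ^ 2))) with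
      ((s * Cmod X) ^ 2 / (- 2 * ln b) + (s * Cmod Y) ^ 2 / (b ^ 2 * (- 2 * ln b) ^ 2)) by (field; lra).
    apply (feasible_zero_free b ltac:(lra) ltac:(lra) am Ham Eam beta Hbeta Ebeta _ _ v); auto.
    + apply Rmult_lt_0_compat; auto.
    + apply Rmult_le_pos; lra.
    + rewrite Hv. field. lra.
  - apply zero_free_competitor; auto.
Qed.

(** Attained by the disc with [A] the solution of the equation, [|c| = b exp (A / 2)] and
    [|c|^2 + |e|^2 = 1]. *)
Lemma kobayashi_one_zero b beta am (X Y : C) v A : 0 < b < 1 ->
  0 < am < - 2 * ln b -> (1 + am) * (b ^ 2 * exp am) = 1 ->
  0 < beta < am -> gap_sqr b beta = 0 ->
  X <> RtoC 0 -> v = Cmod Y ^ 2 / Cmod X ^ 2 ->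
  alpha_solution b v A -> 0 < A <= beta ->
  kobayashi_sqr D11 ((RtoC 0, RtoC b) : C2) ((X, Y) : C2) = Finite (Cmod X ^ 2 / psi b A).
Proof.
  intros Hb Ham Eam Hbeta Ebeta HX Hv HS HA.
  assert (X0 : 0 < Cmod X) by (apply Cmod_gt_0; auto). assert (Y0 := Cmod_ge_0 Y).
  assert (Pp : 0 < psi b A) by (apply psi_pos; lra).
  assert (Sp : 0 < sqrt (psi b A)) by (apply sqrt_lt_R0; auto).
  assert (Es : sqrt (psi b A) * sqrt (psi b A) = psi b A) by (apply sqrt_sqrt; lra).
  set (k := Cmod X / sqrt (psi b A)).
  assert (Hk : 0 < k) by (apply Rdiv_lt_0_compat; auto).
  replace (Cmod X ^ 2 / psi b A) with (k * k).
  2:{ unfold k. rewrite <- Es at 3. field. lra. }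
  apply kobayashi_sqr_Finite, kobayashi_attained; try lra.
  - intros s Hs HF.
    assert (F := feasible_one_zero b ltac:(lra) ltac:(lra) am Ham Eam beta Hbeta Ebeta
      ((s * Cmod X) ^ 2) (s * Cmod Y) v A HA HS).
    assert (F1 : (s * Cmod X) ^ 2 <= psi b A).
    { apply F; auto.
      - apply pow_lt, Rmult_lt_0_compat; auto.
      - apply Rmult_le_pos; lra.
      - rewrite Hv. field. lra. }
    apply le_1_of_sqr; [apply Rmult_le_pos; lra|].
    replace (s * k * (s * k)) with ((s * Cmod X) ^ 2 / psi b A).
    + apply Rmult_le_reg_r with (psi b A); auto. unfold Rdiv. rewrite Rmult_assoc, Rinv_l; lra.
    + unfold k. rewrite <- Es at 1. field. lra.
  - assert (HS' := HS). apply alpha_solution_iff in HS'; try lra. destruct HS' as [HAL E].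
    destruct (polar_form X) as [wX [UX EX]]. destruct (polar_form Y) as [wY [UY EY]].
    assert (be := b2_exp_lt b ltac:(lra) A ltac:(lra)).
    assert (F0 := phi_pos b ltac:(lra) A ltac:(lra)).
    assert (EYk : Cmod Y = k * phi b A).
    { assert (T : Cmod Y * Cmod Y = (k * phi b A) * (k * phi b A)).
      { replace ((k * phi b A) * (k * phi b A)) with (k * k * phi b A ^ 2) by ring.
        rewrite E, Hv. unfold k. rewrite <- Es at 3. field. lra. }
      assert (0 < k * phi b A) by (apply Rmult_lt_0_compat; auto). nra. }
    assert (Ess : (b * exp (A / 2)) ^ 2 = b ^ 2 * exp A).
    { rewrite <- (exp_half A). ring. }
    rewrite <- (Rabs_pos_eq k), <- Cmod_R by lra.
    apply (disc_competitor b A (- (RtoC (b * exp (A / 2)) * wY))%C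
      (RtoC (sqrt (1 - b ^ 2 * exp A)) * wX)%C wY); try lra; auto.
    + apply exp_half_le_1_iff; lra.
    + rewrite Cmod_opp, !Cmod_mult, UX, UY, !Cmod_R, !Rmult_1_r, !pow2_abs, Ess, pow2_sqrt by lra. lra.
    + rewrite EX at 1. rewrite !Cmult_assoc, <- !RtoC_mult. do 2 f_equal.
      rewrite Rmult_assoc, <- sqrt_mult by lra. fold (psi b A). unfold k. field. lra.
    + rewrite EY at 1. rewrite EYk, Ess. unfold phi.
      rewrite !RtoC_mult, RtoC_plus, !RtoC_mult, <- !RtoC_mult.
      replace (RtoC (exp (- A / 2) * (1 - b ^ 2 * exp A)) * wY - RtoC (b * A) * - (RtoC (b * exp (A / 2)) * wY))%C
       with ((RtoC (exp (- A / 2) * (1 - b ^ 2 * exp A)) + RtoC (b * A) * RtoC (b * exp (A / 2))) * wY)%C by ring.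
      rewrite <- RtoC_mult. replace (b * A * (b * exp (A / 2))) with (b ^ 2 * A * exp (A / 2)) by ring.
      ring.
Qed.

Lemma beta_solution_iff b A : 0 < b < 1 ->
  beta_solution b A <-> 0 < A < - 2 * ln b /\ gap_sqr b A = 0.
Proof.
  intros Hb. assert (HL := L_pos b ltac:(lra) ltac:(lra)). unfold beta_solution.
  assert (N := exp_half_neg A). assert (H := exp_half A). assert (P := exp_pos A).
  assert (E : - (1 / (2 * ln b)) * A * (1 - b ^ 2 * exp A) * exp A
    + 1 / (4 * b ^ 2 * ln b ^ 2) * (b ^ 2 * A * exp A + (1 - b ^ 2 * exp A)) ^ 2 - exp A
    = exp A * / (b ^ 2 * (- 2 * ln b) ^ 2) * gap_sqr b A).
  { unfold gap_sqr.
    assert (F : (b ^ 2 * A * exp A + (1 - b ^ 2 * exp A)) ^ 2 = exp A * phi b A ^ 2).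
    { rewrite <- H at 3. unfold phi.
      replace (exp (A / 2) * exp (A / 2) * (exp (- A / 2) * (1 - b ^ 2 * exp A) + b ^ 2 * A * exp (A / 2)) ^ 2)
       with (((exp (- A / 2) * exp (A / 2)) * (1 - b ^ 2 * exp A) + b ^ 2 * A * (exp (A / 2) * exp (A / 2))) ^ 2) by ring.
      rewrite N, H. ring. }
    rewrite F. unfold psi. field. lra. }
  rewrite E. split; intros [H1 H2]; split; auto.
  - apply Rmult_integral in H2. destruct H2 as [H2|H2]; auto.
    assert (0 < exp A * / (b ^ 2 * (- 2 * ln b) ^ 2)); [|lra].
    apply Rmult_lt_0_compat; auto. apply Rinv_0_lt_compat, Rmult_lt_0_compat; apply pow_lt; lra.
  - rewrite H2. ring.
Qed.

Theorem theorem1p6 (b : R) (hb0 : 0 <= b) (hb1 : b < 1) :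
  (b = 0 ->
     (forall X Y : C, Y <> RtoC 0 ->
        exists mu : R,
          kobayashi D11 ((RtoC 0, RtoC 0) : C2) ((X, Y) : C2) = Finite mu /\
          minkowski D11 ((X, Y) : C2) = Finite mu /\
          unique (fun t : R => 0 < t /\ minkowski_equation X Y t) mu) /\
     (forall X : C,
        kobayashi D11 ((RtoC 0, RtoC 0) : C2) ((X, RtoC 0) : C2) = Finite 0)) /\
  (0 < b ->
     forall Y : C,
       kobayashi_sqr D11 ((RtoC 0, RtoC b) : C2) ((RtoC 0, Y) : C2)
       = Finite (Cmod Y ^ 2 / (1 - b ^ 2)
                 + Cmod (RtoC b * Y)%C ^ 2 / (1 - b ^ 2) ^ 2)) /\
  (0 < b ->
     exists beta : R,
       unique (beta_solution b) beta /\
       forall X Y : C, X <> RtoC 0 ->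
       forall v : R, v = Cmod Y ^ 2 / Cmod X ^ 2 ->
         (v < 4 * b ^ 2 ->
            kobayashi_sqr D11 ((RtoC 0, RtoC b) : C2) ((X, Y) : C2)
            = Finite (zero_free_value b X Y)) /\
         (4 * b ^ 2 <= v ->
            (exists alpha : R, alpha_solution b v alpha) /\
            (forall alpha : R, alpha_solution b v alpha ->
               0 < alpha <= beta ->
               kobayashi_sqr D11 ((RtoC 0, RtoC b) : C2) ((X, Y) : C2)
               = Finite (Cmod X ^ 2 / (alpha * (1 - b ^ 2 * exp alpha)))) /\
            ((forall alpha : R, alpha_solution b v alpha ->
                beta < alpha < - 2 * ln b) ->
               kobayashi_sqr D11 ((RtoC 0, RtoC b) : C2) ((X, Y) : C2)
               = Finite (zero_free_value b X Y)))).
Proof.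
  split; [|split].
  - intros _. split; [|exact kobayashi_centre_horizontal].
    intros X Y HY. assert (Y0 : 0 < Cmod Y) by (apply Cmod_gt_0; auto).
    destruct (gauge_exists (Cmod X) (Cmod Y) Y0) as [u [Hu E]].
    assert (Iu : 0 < / u) by (apply Rinv_0_lt_compat; auto).
    exists (/ u). split; [|split; [|split; [split; [auto|]|]]].
    + apply kobayashi_centre; auto.
    + apply minkowski_value; auto.
    + apply minkowski_equation_iff; auto. rewrite Rinv_inv. auto.
    + intros t [Ht HE]. apply minkowski_equation_iff in HE; auto.
      assert (It : 0 < / t) by (apply Rinv_0_lt_compat; auto).
      rewrite <- (Rinv_inv t). f_equal.
      destruct (Rtotal_order u (/ t)) as [T|[T|T]]; auto; exfalso;
      apply (gauge_fun_increasing (Cmod X) (Cmod Y)) in T; lra.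
  - intros Hb Y.
    replace (Cmod Y ^ 2 / (1 - b ^ 2) + Cmod (b * Y) ^ 2 / (1 - b ^ 2) ^ 2) with
      (Cmod Y / (1 - b ^ 2) * (Cmod Y / (1 - b ^ 2))).
    + apply kobayashi_sqr_Finite, kobayashi_vertical. lra.
    + rewrite Cmod_mult, Cmod_R, Rabs_pos_eq by auto. field. nra.
  - intros Hb. assert (Hb' : 0 < b < 1) by lra.
    destruct (psi_max_exists b Hb hb1) as [am [Ham Eam]].
    destruct (beta_exists b Hb hb1 am Ham Eam) as [beta [Hbeta Ebeta]].
    exists beta. split.
    + split.
      * apply beta_solution_iff; auto. split; auto. lra.
      * intros A HA. apply beta_solution_iff in HA; auto. destruct HA as [HA EA].
        symmetry. apply (beta_unique b Hb hb1 am Ham Eam beta Hbeta Ebeta A); auto.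
    + intros X Y HX v Hv. split; [|intros Hv4; split; [|split]].
      * intros Hv4. apply (kobayashi_zero_free b beta am X Y v); auto.
        intros A HA. apply alpha_solution_v in HA; auto. lra.
      * apply (alpha_exists b Hb am Ham Eam v Hv4).
      * intros A HA HAb. apply (kobayashi_one_zero b beta am X Y v A); auto.
      * intros Hno. apply (kobayashi_zero_free b beta am X Y v); auto.
        intros A HA. apply Hno; auto.
Qed.
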